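(* Let $d\in\mathbb{N}^*$, $\gamma>1$, and let $\mathcal{D}$ be a family of Lip-$\gamma$ vector fields on $\mathbb{R}^d$. Let $y\in\mathbb{R}^d$ and $p=\dim P_{\mathcal{D}}(y)$. Then there exist a subset $V_y\subseteq\mathbb{R}^d$ with $y\in V_y\subseteq\mathbb{L}_y(\mathcal{D})$ and a Lip-$\gamma$ diffeomorphism $\Psi_y:V_y\to B_p(0,1)$ with $\Psi_y(y)=0$. Moreover, $V_y$ carries a $p$-dimensional Lip-$\gamma$ manifold structure induced by $\Psi_y^{-1}$ (obtained by transporting via $\Psi_y^{-1}$ a Lip-$\gamma$ manifold structure on the unit ball $B_p(0,1)$), and its tangent space is given precisely by $P_{\mathcal{D}}$: for every $z\in V_y$, $\mathrm{d}(\Psi_y^{-1})(\Psi_y(z))(\mathbb{R}^p)=P_{\mathcal{D}}(z)$.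
   Context: Lip-$\gamma$ regularity: for $\gamma>0$ let $m$ be the integer with $0<\gamma-m\leq1$. For normed spaces $E,F$ and $U\subseteq E$ (arbitrary subset), a collection $(g^0,\ldots,g^m)$, $g^0:U\to F$, $g^k:U\to\mathcal{L}_s(E^{\otimes k},F)$, is Lip-$\gamma$ if there is $M$ with $\|g^k(x)(v)\|\leq M\|v\|$ and $\|R_k(x,y)(v)\|\leq M\|x-y\|^{\gamma-k}\|v\|$ for all $k$, $x,y\in U$, $v=v_1\otimes\cdots\otimes v_k$, where $g^k(x)(v)=\sum_{j=k}^m g^j(y)\big(\frac{v\otimes(x-y)^{\otimes(j-k)}}{(j-k)!}\big)+R_k(x,y)(v)$; on open sets $g^1,\ldots,g^m$ are the derivatives of $g^0$. A Lip-$\gamma$ diffeomorphism is a bijection which is Lip-$\gamma$ with Lip-$\gamma$ inverse. $B_p(0,1)$ is the open Euclidean unit ball. For a Lip-$1$ vector field $g$ on $\mathbb{R}^d$, $\tilde g_t$ is its time-$t$ flow. A $\mathcal{D}$-diffeomorphism is a composition $\tilde g^k_{t_k}\circ\cdots\circ\tilde g^1_{t_1}$ with $g^i\in\mathcal{D}$, $t_i\in\mathbb{R}$; the orbit $\mathbb{L}_y(\mathcal{D})$ is the set of images of $y$ under $\mathcal{D}$-diffeomorphisms. $\mathcal{L}(\mathcal{D})(z)=\mathrm{span}\{g(z):g\in\mathcal{D}\}$. A distribution $\Delta$ (assignment $z\mapsto\Delta(z)\subseteq\mathbb{R}^d$ linear subspace) is $\mathcal{D}$-invariant if for every $\mathcal{D}$-diffeomorphism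 $h$ and $z$, $\mathrm{d}h(z)$ maps $\Delta(z)$ onto $\Delta(h(z))$. $P_{\mathcal{D}}$ is the smallest $\mathcal{D}$-invariant distribution containing $\mathcal{L}(\mathcal{D})$; $P_{\mathcal{D}}(z)$ is spanned by the vectors $\mathrm{d}h(h^{-1}(z))(v)$ with $h$ a $\mathcal{D}$-diffeomorphism and $v\in\mathcal{L}(\mathcal{D})(h^{-1}(z))$. Lip-$\gamma$ manifold: an $n$-dimensional topological manifold $M$ with a countable family $(U_i,\phi_i)_{i\in I}$, $U_i\subseteq M$ open, $\phi_i:M\to\mathbb{R}^n$ compactly supported with $\phi_i|_{U_i}$ a homeomorphism onto $B_n(0,1)$, such that $(U_i)$ is a precompact locally finite cover, there is $\delta\in(0,1)$ with $(\phi_i|_{U_i})^{-1}(B_n(0,1-\delta))$ covering $M$, and there is $L$ with $\|\phi_j\circ(\phi_i|_{U_i})^{-1}\|_{\mathrm{Lip}-\gamma}\leq L$ on $B_n(0,1)$ for all $i,j$. A homeomorphism $H:M\to N$ transports such an atlas to $(H(U_i),\phi_i\circ H^{-1})$. *)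

(* Defs.v *)
From HB Require Import structures.
From mathcomp Require Import all_boot all_order all_algebra.
From mathcomp Require Import all_classical all_reals all_analysis.
Set Implicit Arguments. Unset Strict Implicit. Unset Printing Implicit Defensive.
Import Order.TTheory GRing.Theory Num.Theory.
Import numFieldNormedType.Exports.
Local Open Scope classical_set_scope.
Local Open Scope ring_scope.

Section LipGamma.
Variable R : realType.

Definition enorm (n : nat) (v : 'rV[R]_n) : R :=
  Num.sqrt (\sum_(i < n) (v ord0 i) ^+ 2).

Definition eball (n : nat) : set 'rV[R]_n := [set v | enorm v < 1].

(* norm of an elementary tensor v_1 ⊗ ... ⊗ v_k *)
Definition tnorm (n : nat) (v : seq 'rV[R]_n) : R := \prod_(u <- v) enorm u.

(* g k x is the symmetric linear map on E^{⊗k}, given by its (symmetric,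
   multilinear) values on elementary tensors, represented as sequences of
   size k; g 0 x [::] is g^0(x). k0 is the integer m with 0 < γ - m <= 1. *)
Definition lip_coll (γ : R) (n m : nat) (U : set 'rV[R]_n)
    (g : nat -> 'rV[R]_n -> seq 'rV[R]_n -> 'rV[R]_m) (k0 : nat) (M : R) : Prop :=
  (forall k x, (k <= k0)%N -> U x ->
     (forall v w, size v = k -> perm_eq v w -> g k x v = g k x w) /\
     (forall v i (a : R) u w, size v = k -> (i < k)%N ->
        g k x (set_nth 0 v i (a *: u + w)) =
        a *: g k x (set_nth 0 v i u) + g k x (set_nth 0 v i w))) /\
  (forall k x v, (k <= k0)%N -> U x -> size v = k ->
     enorm (g k x v) <= M * tnorm v) /\
  (forall k x y v, (k <= k0)%N -> U x -> U y -> size v = k ->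
     enorm (g k x v -
            \sum_(k <= j < k0.+1)
               ((j - k)`!%:R)^-1 *: g j y (v ++ nseq (j - k) (x - y)))
     <= M * (enorm (x - y)) `^ (γ - k%:R) * tnorm v).

Definition lip_bound (γ : R) (n m : nat) (U : set 'rV[R]_n)
    (f : 'rV[R]_n -> 'rV[R]_m) (L : R) : Prop :=
  exists (k0 : nat) g, (k0%:R < γ <= k0%:R + 1) /\ lip_coll γ U g k0 L /\
    (forall x, U x -> g 0%N x [::] = f x).

Definition lipg (γ : R) (n m : nat) (U : set 'rV[R]_n)
    (f : 'rV[R]_n -> 'rV[R]_m) : Prop := exists L, lip_bound γ U f L.

Definition lip_diffeo (γ : R) (n m : nat) (V : set 'rV[R]_n) (W : set 'rV[R]_m)
    (Ψ : 'rV[R]_n -> 'rV[R]_m) (Φ : 'rV[R]_m -> 'rV[R]_n) : Prop :=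
  (forall x, V x -> W (Ψ x) /\ Φ (Ψ x) = x) /\
  (forall u, W u -> V (Φ u) /\ Ψ (Φ u) = u) /\
  lipg γ V Ψ /\ lipg γ W Φ.

Definition is_flow (d : nat) (g : 'rV[R]_d -> 'rV[R]_d) (Φ : R -> 'rV[R]_d -> 'rV[R]_d) :=
  forall x, Φ 0 x = x /\ forall t : R, is_derive t (1 : R) (fun s => Φ s x) (g (Φ t x)).

Inductive D_diffeo (d : nat) (D : set ('rV[R]_d -> 'rV[R]_d)) : ('rV[R]_d -> 'rV[R]_d) -> Prop :=
| D_diffeo_id : D_diffeo D id
| D_diffeo_comp g Φ (t : R) h :
    D g -> is_flow g Φ -> D_diffeo D h -> D_diffeo D (Φ t \o h).

Definition Dorbit (d : nat) (D : set ('rV[R]_d -> 'rV[R]_d)) (y : 'rV[R]_d) : set 'rV[R]_d :=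
  [set h y | h in D_diffeo D].

Definition lspan (d : nat) (S : set 'rV[R]_d) : set 'rV[R]_d :=
  [set v | exists s : seq 'rV[R]_d, (forall u, u \in s -> S u) /\ v \in (vector.span s)].

Definition vdim (d : nat) (S : set 'rV[R]_d) (p : nat) : Prop :=
  exists s : seq 'rV[R]_d, (forall u, u \in s -> S u) /\
    (forall v, S v <-> v \in (vector.span s)) /\ \dim (vector.span s) = p.

Definition LD (d : nat) (D : set ('rV[R]_d -> 'rV[R]_d)) (z : 'rV[R]_d) : set 'rV[R]_d :=
  lspan [set g z | g in D].

Definition PD (d : nat) (D : set ('rV[R]_d -> 'rV[R]_d)) (z : 'rV[R]_d) : set 'rV[R]_d :=
  lspan [set u | exists h w v, D_diffeo D h /\ h w = z /\ LD D w v /\ u = 'd h w v].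

(* (U_i, φ_i)_{i in I} is a p-dimensional Lip-γ manifold atlas on M ⊆ T
   (M with the subspace topology); ψ i is the inverse of φ_i|U_i *)
Definition lip_manifold (γ : R) (n : nat) (T : topologicalType) (M : set T)
    (I : Type) (U : I -> set T) (φ : I -> T -> 'rV[R]_n) : Prop :=
  exists ψ : I -> 'rV[R]_n -> T,
    countable [set: I] /\
    (forall i, U i `<=` M /\ exists O, open O /\ U i = O `&` M) /\
    (forall i, compact (M `&` closure [set x | M x /\ φ i x != 0])) /\
    (forall i, {within U i, continuous φ i} /\ {within @eball n, continuous ψ i} /\
       (forall x, U i x -> @eball n (φ i x) /\ ψ i (φ i x) = x) /\
       (forall u, @eball n u -> U i (ψ i u) /\ φ i (ψ i u) = u)) /\
    (forall i, compact (M `&` closure (U i))) /\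
    (forall x, M x -> exists O, open O /\ O x /\
        finite_set [set i | (O `&` U i) !=set0]) /\
    (exists δ : R, 0 < δ < 1 /\
        forall x, M x -> exists i, U i x /\ enorm (φ i x) < 1 - δ) /\
    (exists L : R, forall i j, lip_bound γ (@eball n) (φ j \o ψ i) L).

End LipGamma.

(* Main.v *)
Require Import Defs.
From HB Require Import structures.
From mathcomp Require Import all_boot all_order all_algebra.
From mathcomp Require Import all_classical all_reals all_analysis.
From mathcomp Require Import ring lra zify.
Set Implicit Arguments. Unset Strict Implicit. Unset Printing Implicit Defensive.
Import Order.TTheory GRing.Theory Num.Theory.
Import numFieldNormedType.Exports.
Local Open Scope classical_set_scope.
Local Open Scope ring_scope.

(** For gamma > 1, write gamma = k + al with 0 < al <= 1 and k >= 1.  On convex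
    open sets Lip-gamma regularity amounts to being of class C^{k,al} with
    bounded derivatives (Taylor's formula), so the fields of D are C^{k,al},
    and so are their flows, jointly in time and space.  If the vectors
    b_i = dh_i(w_i)(g_i(w_i)), i < p, form a basis of P_D(y), the map
    t |-> X_1^{t_1} (X_2^{t_2} (... y)), where X_i^s is the conjugate by h_i of
    the flow of g_i, stays in the orbit, has differential t |-> sum_i t_i b_i
    at 0, and its differentials take values in P_D by invariance.  Composed with
    a linear left inverse of t |-> sum_i t_i b_i it is locally invertible, which
    gives the chart; since P_D has constant dimension along the orbit, the image
    of its differential is all of P_D.

    For the manifold structure, any homeomorphism of R^p onto M carries the
    atlas of translated unit balls centred at the points of a fine lattice,
    whose charts are translations multiplied by a cutoff: changes of charts are
    translates of one compactly supported map, hence uniformly Lip-gamma. *)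

(** All estimates are made on real-valued coordinates: there the mean value theorem gives an
    intermediate point, and [Ck] can be defined by recursion on directional derivatives, so that
    inductions on the order apply to the derivatives themselves.

    Flows, taken jointly in time and space, are unbounded. Regularity is therefore carried as [Cg],
    on every ball with constants depending on the ball, and uniform bounds come back at the end, on
    bounded convex sets.

    The assumption gamma > 1 gives k >= 1, which makes the fields Lipschitz and their flows unique.
    When gamma <= 2 the differential of a field is merely Hoelder: the variational equation can be
    solved, being linear, but not differentiated. This base case rests on Gronwall estimates, and
    only higher orders are reached by induction.

    Taylor's formula wants an open convex domain, while V is a p-dimensional piece of the orbit. Its
    chart is therefore built as the restriction of a map that is regular on a ball of the ambient
    space.

    Estimates use the maximum norm of row vectors; the Euclidean norm of the statement enters
    through |v| <= [enorm] v <= n |v|. *)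

Section norms.
Context {R : realType}.

Lemma mx_norm_coord m n (v : 'M[R]_(m, n)) i j : `|v i j| <= `|v|.
Proof.
rewrite [leRHS]/Num.norm /= mx_normrE.
exact: (le_bigmax _ (fun ij : 'I_m * 'I_n => `|v ij.1 ij.2|) (i, j)).
Qed.

Lemma rV_norm_le n (v : 'rV[R]_n) (e : R) :
  0 <= e -> (forall i, `|v ord0 i| <= e) -> `|v| <= e.
Proof.
move=> e0 ve; rewrite [leLHS]/Num.norm /= mx_normrE bigmax_le// => -[i j] _ /=.
by rewrite ord1; exact: ve.
Qed.

Lemma rV_norm_lt n (v : 'rV[R]_n) (e : R) :
  0 < e -> (forall i, `|v ord0 i| < e) -> `|v| < e.
Proof.
move=> e0 ve; rewrite [ltLHS]/Num.norm /= mx_normrE bigmax_lt// => -[i j] _ /=.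
by rewrite ord1; exact: ve.
Qed.

Lemma mx_norm_coordB n (u v : 'rV[R]_n) i : `|u ord0 i - v ord0 i| <= `|u - v|.
Proof. by have := mx_norm_coord (u - v) ord0 i; rewrite !mxE. Qed.

Lemma rV_norm_sum n (v : 'rV[R]_n) : `|v| <= \sum_i `|v ord0 i|.
Proof.
apply: rV_norm_le => [|i]; first exact: sumr_ge0.
by rewrite (bigD1 i)//= lerDl sumr_ge0.
Qed.

Lemma powR_small (a e : R) : 0 < a -> 0 < e ->
  exists2 r : R, 0 < r & forall x, 0 <= x -> x < r -> x `^ a <= e.
Proof.
move=> a0 e0; exists (e `^ a^-1); first exact: powR_gt0.
move=> x x0 xr; apply: (@le_trans _ _ ((e `^ a^-1) `^ a)).
  by apply: ge0_ler_powR; rewrite ?nnegrE ?powR_ge0// ltW.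
by rewrite -powRrM mulVf ?gt_eqF// powRr1// ltW.
Qed.

(** The tolerance e / (C + 1) absorbs a constant C that may be zero. *)
Lemma mul_divr_succ_le (C e : R) : 0 <= C -> 0 <= e -> C * (e / (C + 1)) <= e.
Proof.
move=> C0 e0; rewrite mulrCA ler_piMr// ler_pdivrMr ?ltr_wpDl//.
by rewrite mul1r lerDl.
Qed.

Lemma powR_triv (a x : R) : 0 < a <= 1 -> 0 <= x -> x <= 1 -> x <= x `^ a.
Proof.
move=> /andP[a0 a1] x0 x1; have [->|xn0] := eqVneq x 0; first exact: powR_ge0.
by apply: ger1_powR => //; rewrite lt_neqAle eq_sym xn0 x0.
Qed.

End norms.

(** * Differentials from estimates, and the mean value theorem *)

Section differential.
Context {R : realType}.

Lemma continuous_of_dist (V W : normedModType R) (f : V -> W) (x : V) :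
  (forall e, 0 < e -> exists2 r, 0 < r & forall y, `|x - y| < r -> `|f x - f y| <= e) ->
  {for x, continuous f}.
Proof.
move=> H; apply/cvgrPdist_le => e e0; have [r r0 Hr] := H e e0.
by near=> y; apply: Hr; near: y; exact: (@cvgr_dist_lt _ _ _ _ _ id).
Unshelve. all: by end_near. Qed.

(** The candidate [A] is a bare function, packed as a linear map inside the proof, so that it may be
    given by a formula or by a choice of solutions. Its bound by [k] supplies the continuity on
    which uniqueness of the differential depends. *)
Lemma diff_of_estimate (V W : normedModType R) (f : V -> W) (x : V)
    (A : V -> W) (k : R) : linear A -> (forall h, `|A h| <= k * `|h|) ->
  (forall e, 0 < e -> exists2 r, 0 < r &
     forall h, `|h| < r -> `|f (x + h) - f x - A h| <= e * `|h|) ->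
  differentiable f x /\ forall v, 'd f x v = A v.
Proof.
move=> linA kA Hf.
pose A' : {linear V -> W} := HB.pack A (GRing.isLinear.Build _ _ _ _ A linA).
have cA : continuous A'.
  apply: (@linear_bounded_continuous _ _ _ A').1.
  apply: (@linear_boundedP _ _ _ A').2.
  exists k; split; first exact: num_real.
  move=> r kr y; rewrite (le_trans (kA y))// ler_wpM2r// ltW//.
have E : f \o shift x = cst (f x) + A' +o_ 0 id.
  apply/eqaddoP => e e0 /=.
  have [r r0 Hr] := Hf _ e0.
  apply/nbhs_ballP; exists r => //= h; rewrite -ball_normE /= sub0r normrN => hr.
  have := Hr h hr; rewrite [x + h]addrC /=.
  by rewrite -[in X in X -> _]addrA -opprD; exact.
have dE := diff_unique cA E.
split; last by move=> v; rewrite dE.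
apply/diff_locallyP; split; first by rewrite dE.
by rewrite dE.
Qed.

Lemma diff_estimate (V W : normedModType R) (f : V -> W) (x : V) :
  differentiable f x -> forall e, 0 < e -> exists2 r, 0 < r &
    forall h, `|h| < r -> `|f (x + h) - f x - 'd f x h| <= e * `|h|.
Proof.
move=> /diff_locally /eqaddoP Hf e e0.
have /nbhs_ballP[r /= r0 Hr] := Hf e e0; exists r => // h hr.
have /Hr : ball 0 r h by rewrite -ball_normE /= sub0r normrN.
rewrite (_ : (_ - _) h = f (h + x) - (f x + 'd f x h))//.
by rewrite [h + x]addrC opprD addrA; exact.
Qed.

Lemma near_eq_differentiable (V W : normedModType R) (f g : V -> W) (x : V) :
  (\near x, f x = g x) -> differentiable f x -> differentiable g x.
Proof.
move=> fg df.
have [k k0 kA] := linear_lipschitz (diff_continuous df).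
have [|//||//] := @diff_of_estimate _ _ g x ('d f x) k; first exact: linearP.
move=> e e0; have [r r0 Hr] := diff_estimate df e0.
have /nbhs_ballP[s /= s0 Hs] := fg.
  exists (Num.min r s); first by rewrite lt_min r0.
  move=> h; rewrite lt_min => /andP[hr hs]; rewrite -Hs; last first.
    by rewrite -ball_normE /= opprD addrA subrr sub0r normrN.
by rewrite -(nbhs_singleton fg); exact: Hr.
Qed.

Lemma differentiable_rV (V : normedModType R) m (F : V -> 'rV[R]_m) (x : V) :
  (forall j, differentiable (fun y => F y ord0 j) x) -> differentiable F x.
Proof.
move=> dF.
rewrite (_ : F = \sum_j (fun y => F y ord0 j *: delta_mx ord0 j)).
  by apply: differentiable_sum => j; exact: differentiableZl.
apply/funext => y; rewrite fct_sumE; exact: row_sum_delta.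
Qed.

Lemma differentiable_rV_coord (V : normedModType R) m (F : V -> 'rV[R]_m) (x : V) j :
  differentiable F x -> differentiable (fun y => F y ord0 j) x.
Proof.
move=> dF.
apply: (@differentiable_comp _ _ _ _ F (fun M : 'rV[R]_m => M ord0 j)) => //.
exact: differentiable_coord.
Qed.

Lemma diff_rV_coord (V : normedModType R) m (F : V -> 'rV[R]_m) (x v : V) j :
  differentiable F x -> 'd F x v ord0 j = 'd (fun y => F y ord0 j) x v.
Proof.
move=> dF; rewrite -!deriveE//; last exact: differentiable_rV_coord.
by rewrite derive_mx ?mxE//; exact: diff_derivable.
Qed.

Lemma derive_rV_basis n (W : normedModType R) (f : 'rV[R]_n -> W) (x v : 'rV[R]_n) :
  differentiable f x ->
  'D_v f x = \sum_i v ord0 i *: 'D_(delta_mx ord0 i) f x.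
Proof.
move=> df; rewrite deriveE// {1}(row_sum_delta v) linear_sum.
by apply: eq_bigr => i _; rewrite linearZ/= deriveE.
Qed.

Lemma derive_lin (V W : normedModType R) (f : V -> W) (x : V) :
  differentiable f x -> forall (a : R) u v,
  'D_(a *: u + v) f x = a *: 'D_u f x + 'D_v f x.
Proof. by move=> df a u v; rewrite !deriveE// linearP. Qed.

Lemma is_derive1_rV n (c c' : R -> 'rV[R]_n) (t : R) :
  is_derive t 1 c (c' t) <->
  forall j, is_derive t 1 (fun s => c s ord0 j) (c' t ord0 j).
Proof.
split=> [[dc <-] j|H].
  have dj := (derivable_mxP c t 1).1 dc ord0 j.
  by apply: DeriveDef => //; rewrite derive_mx// mxE.
have dc : derivable c t 1.
  by apply/derivable_mxP => i j; rewrite ord1; have [] := H j.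
apply: DeriveDef => //; rewrite derive_mx//; apply/rowP => j; rewrite mxE.
by apply: derive_val.
Qed.

Lemma is_derive_line (V W : normedModType R) (f : V -> W) (a h : V) (t : R) :
  differentiable f (a + t *: h) ->
  is_derive t 1 (fun s => f (a + s *: h)) ('D_h f (a + t *: h)).
Proof.
move=> df.
have dg : is_diff t (fun s : R => a + s *: h) (fun s => s *: h).
  have d2 : is_diff t (fun s : R => s *: h) (fun s => s *: h) by exact: is_diff_scalel.
  have := @is_diffD _ _ _ (cst a) _ _ _ t (is_diff_cst _ _) d2.
  by rewrite add0r.
have dc : differentiable (fun s : R => f (a + s *: h)) t.
  by apply: differentiable_comp.
apply: DeriveDef; first exact: diff_derivable.
rewrite deriveE// (@diff_comp _ _ _ _ (fun s : R => a + s *: h) f)//=.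
by rewrite diff_val deriveE// scale1r.
Qed.

Lemma is_derive_curve (V W : normedModType R) (f : V -> W) (c : R -> V) (c' : V) (t : R) :
  differentiable f (c t) -> is_derive t 1 c c' ->
  is_derive t 1 (fun s => f (c s)) ('d f (c t) c').
Proof.
move=> df [dc <-]; have dc' := (derivable1_diffP _ _).1 dc.
have dfc : differentiable (f \o c) t by apply: differentiable_comp.
apply: DeriveDef; first exact: diff_derivable.
by rewrite [LHS](@deriveE _ _ _ (f \o c))// diff_comp//= deriveE.
Qed.

(** Convexity, in the parametrized form in which functions are restricted to segments. *)
Definition segment_closed (V : normedModType R) (U : set V) :=
  forall a b t, U a -> U b -> 0 <= t <= 1 -> U (a + t *: (b - a)).

Lemma segment_closed_ball (V : normedModType R) (c : V) (r : R) :
  segment_closed (ball c r).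
Proof.
move=> a b t; rewrite -ball_normE /= => ca cb /andP[t0 t1].
rewrite (_ : c - _ = (1 - t) *: (c - a) + t *: (c - b)); last first.
  rewrite scalerBl scale1r -addrA [- _ + _]addrC -scalerBr opprB.
  by rewrite [c - b + _]addrC addrA subrK opprD addrA -scalerN opprB.
rewrite (le_lt_trans (ler_normD _ _))// !normrZ !ger0_norm ?subr_ge0//.
have [->|tn1] := eqVneq t 1; first by rewrite subrr mul0r add0r mul1r.
rewrite (_ : r = (1 - t) * r + t * r); last by ring.
apply: ltr_leD; last by rewrite ler_wpM2l// ltW.
by rewrite ltr_pM2l// subr_gt0 lt_neqAle tn1.
Qed.

Lemma mean_value01 (r dr : R -> R) :
  (forall t : R, 0 <= t <= 1 -> is_derive t 1 r (dr t)) ->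
  exists2 c, 0 <= c <= 1 & r 1 - r 0 = dr c.
Proof.
move=> Hdr; have [||c] := @MVT_segment R r dr 0 1 ler01.
- by move=> t; rewrite in_itv/= => /andP[t0 t1]; apply: Hdr; rewrite !ltW.
- apply: derivable_within_continuous => t; rewrite in_itv/= => t01.
  by have [] := Hdr t t01.
by rewrite in_itv/= subr0 mulr1 => c01 E; exists c.
Qed.

Lemma mean_value_segment (V : normedModType R) (U : set V) (f : V -> R) a b :
  segment_closed U -> (forall x, U x -> differentiable f x) -> U a -> U b ->
  exists2 x, U x & f b - f a = 'D_(b - a) f x.
Proof.
move=> cU df Ua Ub.
have dg (t : R) : 0 <= t <= 1 -> is_derive t 1 (fun s => f (a + s *: (b - a)))
    ('D_(b - a) f (a + t *: (b - a))).
  by move=> t01; apply: is_derive_line; apply: df; exact: cU.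
have [c c01] := mean_value01 dg.
rewrite scale1r scale0r addr0 addrCA subrr addr0 => E.
by exists (a + c *: (b - a)) => //; exact: cU.
Qed.

End differential.

(** * Functions of class C^{k,al} *)

Definition lip_on {R : realType} (V W : normedModType R) (U : set V) (F : V -> W) :=
  exists2 L : R, 0 <= L & forall a b, U a -> U b -> `|F a - F b| <= L * `|a - b|.

Section hoelder_class.
Context {R : realType} (al : R).
Hypothesis al01 : 0 < al <= 1.

Definition hoelder (V : normedModType R) (U : set V) (f : V -> R) :=
  exists2 C : R, 0 <= C & (forall a, U a -> `|f a| <= C) /\
    forall a b, U a -> U b -> `|f a - f b| <= C * `|a - b| `^ al.

Section Ck_def.
Context (V : normedModType R) (U : set V).

(** The class C^{k,al} with bounded derivatives; the Hoelder condition is imposed at the top order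
    only. Nothing is said about uniformity in the direction [v]: it is recovered by expanding [v] in
    the canonical basis. *)
Fixpoint Ck k (f : V -> R) : Prop :=
  if k is k'.+1 then
    [/\ exists2 C : R, 0 <= C & forall a, U a -> `|f a| <= C,
        forall a, U a -> differentiable f a &
        forall v, Ck k' ('D_v f)]
  else hoelder U f.

End Ck_def.

Lemma Ck_bounded k (V : normedModType R) (U : set V) f : Ck U k f ->
  exists2 C : R, 0 <= C & forall a, U a -> `|f a| <= C.
Proof. by case: k => [[C C0 [] ? _]|k []//]; exists C. Qed.

Lemma Ck_derive k (V : normedModType R) (U : set V) f v :
  Ck U k.+1 f -> Ck U k ('D_v f).
Proof. by move=> [_ _ H]; exact: H. Qed.

Lemma Ck_diff k (V : normedModType R) (U : set V) f x :
  Ck U k.+1 f -> U x -> differentiable f x.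
Proof. by move=> [_ + _]; exact. Qed.

Lemma Ck_sub k (V : normedModType R) (U U' : set V) f :
  U' `<=` U -> Ck U k f -> Ck U' k f.
Proof.
move=> sU; elim: k f => [f [C C0 [H1 H2]]|k IH f [[C C0 H1] H2 H3]].
  by exists C => //; split=> [a /sU/H1|a b /sU Ua /sU Ub]//; exact: H2.
split; [by exists C => // a /sU/H1|by move=> a /sU/H2|by move=> v; apply: IH; exact: H3].
Qed.

Lemma Ck_eq k (V : normedModType R) (U : set V) f g :
  open U -> (forall x, U x -> f x = g x) -> Ck U k f -> Ck U k g.
Proof.
move=> oU; elim: k f g => [f g fg [C C0 [H1 H2]]|k IH f g fg [[C C0 H1] H2 H3]].
  exists C => //; split=> [a Ua|a b Ua Ub]; first by rewrite -fg//; exact: H1.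
  by rewrite -!fg//; exact: H2.
have nfg x : U x -> \near x, f x = g x.
  by move=> Ux; apply: filterS (open_nbhs_nbhs (conj oU Ux)) => y; exact: fg.
split; first by exists C => // a Ua; rewrite -fg//; exact: H1.
  by move=> a Ua; apply: near_eq_differentiable (nfg _ Ua) (H2 _ Ua).
by move=> v; apply: IH (H3 v) => x Ux; apply: near_eq_derive; exact: nfg.
Qed.

Lemma hoelderW (V : normedModType R) (U : set V) (f : V -> R) :
  (exists2 C : R, 0 <= C & forall a, U a -> `|f a| <= C) ->
  (exists2 C : R, 0 <= C &
    forall a b, U a -> U b -> `|f a - f b| <= C * `|a - b| `^ al) -> hoelder U f.
Proof.
move=> [C C0 H] [C' C'0 H']; exists (C + C'); first exact: addr_ge0.
split=> [a Ua|a b Ua Ub]; first by rewrite (le_trans (H _ Ua))// lerDl.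
by rewrite (le_trans (H' _ _ Ua Ub))// ler_wpM2r ?powR_ge0// lerDr.
Qed.

Lemma hoelderD (V : normedModType R) (U : set V) (f g : V -> R) :
  hoelder U f -> hoelder U g -> hoelder U (fun x => f x + g x).
Proof.
move=> [C C0 [H1 H2]] [D D0 [K1 K2]]; exists (C + D); first exact: addr_ge0.
split=> [a Ua|a b Ua Ub].
  by rewrite (le_trans (ler_normD _ _))// lerD ?H1 ?K1.
rewrite opprD addrACA mulrDl (le_trans (ler_normD _ _))// lerD//.
  exact: H2.
exact: K2.
Qed.

Lemma hoelderM (V : normedModType R) (U : set V) (f g : V -> R) :
  hoelder U f -> hoelder U g -> hoelder U (fun x => f x * g x).
Proof.
move=> [C C0 [H1 H2]] [D D0 [K1 K2]]; apply: hoelderW.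
  exists (C * D); first exact: mulr_ge0.
  by move=> a Ua; rewrite normrM ler_pM ?H1 ?K1.
exists (C * D + C * D) => [|a b Ua Ub]; first by rewrite addr_ge0// mulr_ge0.
rewrite (_ : _ - _ = f a * (g a - g b) + (f a - f b) * g b); last by ring.
rewrite (le_trans (ler_normD _ _))// [leRHS]mulrDl !normrM; apply: lerD.
  by rewrite -mulrA ler_pM ?H1 ?K2.
by rewrite mulrAC ler_pM ?H2 ?K1.
Qed.

Lemma Ck_cst k (V : normedModType R) (U : set V) (c : R) : Ck U k (cst c).
Proof.
elim: k c => [|k IH] c /=.
  exists `|c| => //; split=> // a b _ _; rewrite subrr normr0.
  by rewrite mulr_ge0// powR_ge0.
split; [by exists `|c| | by move=> a _; exact: differentiable_cst|move=> v].
by rewrite (_ : 'D_v _ = cst 0); [exact: IH|apply/funext => x; rewrite derive_cst].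
Qed.

Lemma CkD k (V : normedModType R) (U : set V) (f g : V -> R) : open U ->
  Ck U k f -> Ck U k g -> Ck U k (fun x => f x + g x).
Proof.
move=> oU; elim: k f g => [|k IH] f g /=; first exact: hoelderD.
move=> [[C C0 H1] H2 H3] [[D D0 K1] K2 K3]; split.
- exists (C + D); first exact: addr_ge0.
  by move=> a Ua; rewrite (le_trans (ler_normD _ _))// lerD ?H1 ?K1.
- by move=> a Ua; apply: differentiableD; [exact: H2|exact: K2].
- move=> v; apply: (Ck_eq oU _ (IH _ _ (H3 v) (K3 v))) => x Ux.
  by rewrite deriveD//; apply: diff_derivable; [exact: H2|exact: K2].
Qed.

Lemma Ck_sum k (V : normedModType R) (U : set V) I (r : seq I) (P : pred I)
    (f : I -> V -> R) : open U ->
  (forall i, P i -> Ck U k (f i)) -> Ck U k (fun x => \sum_(i <- r | P i) f i x).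
Proof.
move=> oU H; elim: r => [|i r IH].
  rewrite (_ : (fun _ => _) = cst 0); first exact: Ck_cst.
  by apply/funext => x; rewrite big_nil.
case Pi : (P i); last first.
  rewrite (_ : (fun _ => _) = (fun x => \sum_(i <- r | P i) f i x))//.
  by apply/funext => x; rewrite big_cons Pi.
rewrite (_ : (fun _ => _) = (fun x => f i x + \sum_(i <- r | P i) f i x)).
  by apply: CkD => //; exact: H.
by apply/funext => x; rewrite big_cons Pi.
Qed.

Section rV_domain.
Context (n : nat) (U : set 'rV[R]_n).
Hypotheses (oU : open U) (cU : segment_closed U).

Lemma lip_of_bounded_derive (f : 'rV[R]_n -> R) (C : 'I_n -> R) :
  (forall x, U x -> differentiable f x) -> (forall i, 0 <= C i) ->
  (forall i x, U x -> `|'D_(delta_mx ord0 i) f x| <= C i) -> lip_on U f.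
Proof.
move=> df C0 HC; exists (\sum_i C i); first by rewrite sumr_ge0.
move=> a b Ua Ub.
have [x Ux ->] := mean_value_segment cU df Ub Ua.
rewrite derive_rV_basis; last exact: df.
rewrite (le_trans (ler_norm_sum _ _ _))// mulr_suml ler_sum// => i _.
rewrite normrZ mulrC ler_pM//; first exact: HC.
exact: mx_norm_coord.
Qed.

Lemma Ck1_lip (f : 'rV[R]_n -> R) : Ck U 1 f -> lip_on U f.
Proof.
move=> [_ H2 H3].
pose C i := projT1 (cid2 (@Ck_bounded 0 _ _ _ (H3 (delta_mx ord0 i)))).
apply: (@lip_of_bounded_derive _ C) => //.
  by move=> i; rewrite /C; case: cid2.
by move=> i a Ua; rewrite /C; case: cid2 => //= x _; exact.
Qed.

(** For |a - b| <= 1 the power |a - b|^al dominates |a - b|, since al <= 1; beyond 1 the power is at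
    least 1 and the bound on f suffices. *)
Lemma lip_hoelder (f : 'rV[R]_n -> R) : lip_on U f ->
  (exists2 C : R, 0 <= C & forall a, U a -> `|f a| <= C) -> hoelder U f.
Proof.
move=> [L L0 HL] [C C0 HC]; apply: hoelderW; first by exists C.
exists (L + (C + C)); first by rewrite !addr_ge0.
move=> a b Ua Ub; have [ab1|/ltW ab1] := leP `|a - b| 1.
  rewrite (le_trans (HL _ _ Ua Ub))// ler_pM ?lerDl ?addr_ge0//.
  exact: powR_triv.
rewrite (le_trans (ler_normB _ _))//.
rewrite (@le_trans _ _ (L + (C + C)))//.
  by rewrite (le_trans (lerD (HC _ Ua) (HC _ Ub)))// lerDr.
rewrite ler_peMr ?addr_ge0// -(powRr0 `|a - b|) ler_powR//.
by have /andP[/ltW] := al01.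
Qed.

(** Only the bottom order has content: on a convex set, bounded derivatives give a Lipschitz
    function, hence a Hoelder one. *)
Lemma CkS k (f : 'rV[R]_n -> R) : Ck U k.+1 f -> Ck U k f.
Proof.
elim: k f => [|k IH] f Hf.
  by apply: lip_hoelder; [exact: Ck1_lip|have [] := Hf].
have [H1 H2 H3] := Hf; split => //.
by move=> v; apply: IH; exact: H3.
Qed.

Lemma Ck_le k l (f : 'rV[R]_n -> R) : (l <= k)%N -> Ck U k f -> Ck U l f.
Proof.
move=> /subnK <-; elim: (k - l)%N => // m IH.
by rewrite addSn => /CkS.
Qed.

Lemma CkM k (f g : 'rV[R]_n -> R) :
  Ck U k f -> Ck U k g -> Ck U k (fun x => f x * g x).
Proof.
elim: k f g => [|k IH] f g; first exact: hoelderM.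
move=> Hf Hg; have [[C C0 H1] H2 H3] := Hf; have [[D D0 K1] K2 K3] := Hg; split.
- exists (C * D); first exact: mulr_ge0.
  by move=> a Ua; rewrite normrM ler_pM ?H1 ?K1.
- by move=> a Ua; apply: differentiableM; [exact: H2|exact: K2].
- move=> v.
  apply: (Ck_eq oU _ (CkD oU (IH _ _ (CkS Hf) (K3 v)) (IH _ _ (CkS Hg) (H3 v)))).
  by move=> x Ux; rewrite deriveM//; apply: diff_derivable; [exact: H2|exact: K2].
Qed.

Lemma CkZ k (c : R) (f : 'rV[R]_n -> R) : Ck U k f -> Ck U k (fun x => c * f x).
Proof. by move=> Hf; apply: CkM => //; exact: Ck_cst. Qed.

Lemma Ck_prod k I (r : seq I) (P : pred I) (f : I -> 'rV[R]_n -> R) :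
  (forall i, P i -> Ck U k (f i)) -> Ck U k (fun x => \prod_(i <- r | P i) f i x).
Proof.
move=> H; elim: r => [|i r IH].
  rewrite (_ : (fun _ => _) = cst 1); first exact: Ck_cst.
  by apply/funext => x; rewrite big_nil.
case Pi : (P i); last first.
  rewrite (_ : (fun _ => _) = (fun x => \prod_(i <- r | P i) f i x))//.
  by apply/funext => x; rewrite big_cons Pi.
rewrite (_ : (fun _ => _) = (fun x => f i x * \prod_(i <- r | P i) f i x)).
  by apply: CkM => //; exact: H.
by apply/funext => x; rewrite big_cons Pi.
Qed.

Lemma Ck_exp k (f : 'rV[R]_n -> R) N : Ck U k f -> Ck U k (fun x => f x ^+ N).
Proof.
move=> Hf; elim: N => [|N IH]; first by under eq_fun do rewrite expr0; exact: Ck_cst.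
by under eq_fun do rewrite exprS; exact: CkM.
Qed.

Lemma Ck_det k p (M : 'rV[R]_n -> 'M[R]_p) :
  (forall i j, Ck U k (fun x => M x i j)) -> Ck U k (fun x => \det (M x)).
Proof.
move=> HM; apply: Ck_sum => // s _; apply: CkM; first exact: Ck_cst.
by apply: Ck_prod => i _.
Qed.

Lemma Ck_inv k (f : 'rV[R]_n -> R) (c : R) : 0 < c ->
  (forall x, U x -> c <= `|f x|) -> Ck U k f -> Ck U k (fun x => (f x)^-1).
Proof.
move=> c0 cf.
have fn0 x : U x -> f x != 0.
  by move=> Ux; rewrite -normr_gt0 (lt_le_trans c0)// cf.
have B a : U a -> `|(f a)^-1| <= c^-1.
  by move=> Ua; rewrite normfV lef_pV2 ?posrE ?normr_gt0 ?fn0// cf.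
elim: k => [|k IH] Hf.
  have [C C0 [H1 H2]] := Hf; apply: hoelderW.
    by exists c^-1; rewrite ?invr_ge0 ?ltW.
  exists (c^-1 * C * c^-1); first by rewrite !mulr_ge0// invr_ge0 ltW.
  move=> a b Ua Ub.
  rewrite (_ : _ - _ = (f a)^-1 * (f b - f a) * (f b)^-1); last first.
    by rewrite mulrBr mulVf ?fn0// mulrBl mul1r mulfK// fn0.
  rewrite !normrM distrC [leRHS]mulrAC ler_pM ?B// ?mulr_ge0//.
  by rewrite -[leRHS]mulrA ler_pM ?B ?H2.
have [H1 H2 H3] := Hf; split.
- by exists c^-1; rewrite ?invr_ge0 ?ltW.
- by move=> a Ua; apply: differentiableV; rewrite ?fn0//; exact: H2.
- move=> v; have IHf := IH (CkS Hf).
  apply: (Ck_eq oU _ (CkZ (-1) (CkM (H3 v) (CkM IHf IHf)))) => x Ux.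
  rewrite (@deriveV _ _ f)//; last by apply: diff_derivable; exact: H2.
    by rewrite /GRing.scale /= expr2 invfM mulN1r mulNr mulrC.
  exact: fn0.
Qed.

Lemma Ck_coord k (j : 'I_n) : bounded_set U -> Ck U k (fun x => x ord0 j).
Proof.
move=> bU.
have dj (x : 'rV[R]_n) : differentiable (fun x : 'rV[R]_n => x ord0 j) x.
  exact: differentiable_coord.
have [C C0 HC] : exists2 C : R, 0 <= C & forall a : 'rV[R]_n, U a -> `|a ord0 j| <= C.
  have [C C0 HC] := pinfty_ex_gt0 bU; exists C; first exact: ltW.
  by move=> a Ua; rewrite (le_trans (mx_norm_coord _ _ _))// HC.
suff Hk l : Ck U l.+1 (fun x => x ord0 j).
  case: k => [|k]; first by apply: CkS; exact: Hk.
  exact: Hk.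
split; [by exists C|by []|move=> v].
rewrite (_ : 'D_v _ = cst (v ord0 j)); first exact: Ck_cst.
apply/funext => x; rewrite deriveE//.
by rewrite -(@diff_rV_coord _ _ _ id)// diff_val.
Qed.

Lemma lip_on_rV m (F : 'rV[R]_n -> 'rV[R]_m) :
  (forall j, lip_on U (fun x => F x ord0 j)) -> lip_on U F.
Proof.
move=> H; pose L j := projT1 (cid2 (H j)).
have L0 j : 0 <= L j by rewrite /L; case: cid2.
have HL j a b : U a -> U b -> `|F a ord0 j - F b ord0 j| <= L j * `|a - b|.
  by rewrite /L; case: cid2 => //= x _; exact.
exists (\sum_j L j); first by rewrite sumr_ge0.
move=> a b Ua Ub; rewrite (le_trans (rV_norm_sum _))// mulr_suml ler_sum// => j _.
by rewrite !mxE; exact: HL.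
Qed.

Lemma derive_comp_rV m (W : set 'rV[R]_m) (f : 'rV[R]_m -> R) (F : 'rV[R]_n -> 'rV[R]_m)
    (x v : 'rV[R]_n) :
  (forall j, differentiable (fun x => F x ord0 j) x) -> differentiable f (F x) ->
  'D_v (f \o F) x =
    \sum_j 'D_v (fun x => F x ord0 j) x * 'D_(delta_mx ord0 j) f (F x).
Proof.
move=> dF df; have dF' := differentiable_rV dF.
rewrite deriveE; last exact: differentiable_comp.
rewrite diff_comp//= -deriveE// derive_rV_basis//; apply: eq_bigr => j _.
by rewrite diff_rV_coord// -deriveE.
Qed.

(** A composite of two al-Hoelder maps is in general only al^2-Hoelder. The inner map is thus
    assumed Lipschitz in addition to its class, and this assumption passes unchanged through the
    induction, in which the chain rule produces products of derivatives of [F] with composites of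
    derivatives of [f]. *)
Lemma Ck_comp k m (W : set 'rV[R]_m) (f : 'rV[R]_m -> R) (F : 'rV[R]_n -> 'rV[R]_m) :
  lip_on U F -> (forall x, U x -> W (F x)) ->
  (forall j, Ck U k (fun x => F x ord0 j)) -> Ck W k f -> Ck U k (f \o F).
Proof.
move=> [L L0 HL] UW; elim: k f => [|k IH] f HF Hf.
  have [C C0 [H1 H2]] := Hf; apply: hoelderW.
    by exists C => // a Ua; apply: H1; exact: UW.
  exists (C * L `^ al) => [|a b Ua Ub]; first by rewrite mulr_ge0// powR_ge0.
  rewrite (le_trans (H2 _ _ (UW _ Ua) (UW _ Ub)))// -mulrA ler_wpM2l//.
  rewrite -powRM// ge0_ler_powR ?nnegrE ?mulr_ge0//; first by case/andP: al01 => /ltW.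
  exact: HL.
have [[C C0 H1] H2 H3] := Hf; split.
- by exists C => // a Ua; apply: H1; exact: UW.
- move=> a Ua; apply: differentiable_comp; last by apply: H2; exact: UW.
  by apply: differentiable_rV => j; have [_ + _] := HF j; exact.
- move=> v.
  apply: (@Ck_eq _ _ _ (fun x => \sum_j 'D_v (fun x => F x ord0 j) x *
       ('D_(delta_mx ord0 j) f \o F) x) _ oU).
    move=> x Ux; rewrite [RHS]derive_comp_rV//.
      by move=> j; have [_ + _] := HF j; exact.
    by apply: H2; exact: UW.
  apply: Ck_sum => // j _; apply: CkM; first by have [_ _ H] := HF j; exact: H.
  by apply: IH; [move=> i; apply: CkS; exact: HF|exact: H3].
Qed.

End rV_domain.
End hoelder_class.

(** * Taylor's formula *)

Section taylor.
Context {R : realType} (al : R).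
Hypothesis al01 : 0 < al <= 1.

#[local] Opaque Ck derive.

Lemma derive_scale (V : normedModType R) (f : V -> R) (x v : V) (s : R) :
  differentiable f x -> 'D_(s *: v) f x = s * 'D_v f x.
Proof. by move=> df; rewrite !deriveE// linearZ. Qed.

Section schwarz.
Context (n : nat) (x u v : 'rV[R]_n) (r : R).

(** Two uses of the mean value theorem: in the direction u for the increment of f by s v, then in
    the direction v for D_u f. The left-hand side is symmetric in u and v, which is what Schwarz's
    theorem exploits. *)
Lemma second_difference (f : 'rV[R]_n -> R) (s : R) :
  0 <= s -> s * (`|u| + `|v|) < r -> Ck al (ball x r) 2 f ->
  exists2 p, `|p - x| <= s * (`|u| + `|v|) &
    f (x + s *: u + s *: v) - f (x + s *: u) - (f (x + s *: v) - f x) =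
    s * (s * 'D_v ('D_u f) p).
Proof.
move=> s0 sr Hf; have df y := @Ck_diff _ _ _ _ _ _ y Hf.
have df2 y := @Ck_diff _ _ _ _ _ _ y (Ck_derive u Hf).
have Bin a b : 0 <= a <= 1 -> 0 <= b <= 1 ->
    `|(x + a *: (s *: u) + b *: (s *: v)) - x| <= s * (`|u| + `|v|).
  move=> /andP[a0 a1] /andP[b0 b1].
  rewrite -[x + _ + _]addrA [x + _]addrC addrK (le_trans (ler_normD _ _))//.
  rewrite !normrZ mulrDr.
  rewrite !ger0_norm// lerD//.
    by rewrite ler_piMl// mulr_ge0.
  by rewrite ler_piMl// mulr_ge0.
have Bx a b : 0 <= a <= 1 -> 0 <= b <= 1 -> ball x r (x + a *: (s *: u) + b *: (s *: v)).
  by move=> a01 b01; rewrite -ball_normE /= distrC (le_lt_trans _ sr)// Bin.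
have i0 : 0 <= (0 : R) <= 1 by rewrite lexx ler01.
have i1 : 0 <= (1 : R) <= 1 by rewrite ler01 lexx.
have dphi (t : R) : 0 <= t <= 1 -> is_derive t 1
   (fun t => f ((x + s *: v) + t *: (s *: u)) - f (x + t *: (s *: u)))
   ('D_(s *: u) f ((x + s *: v) + t *: (s *: u)) - 'D_(s *: u) f (x + t *: (s *: u))).
  move=> t01; apply: is_deriveB; apply: is_derive_line; apply: df.
    by rewrite addrAC -[s *: v]scale1r; exact: Bx.
  by rewrite -[_ + _]addr0 -(scale0r (s *: v)); exact: Bx.
have [c c01] := mean_value01 dphi; rewrite !scale1r !scale0r !addr0.
move=> E1; rewrite (addrAC x (s *: u)) E1; clear E1.
have Ua : ball x r (x + c *: (s *: u)).
  by rewrite -[_ + _]addr0 -(scale0r (s *: v)); exact: Bx.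
have Ub : ball x r (x + c *: (s *: u) + s *: v).
  by rewrite -[s *: v]scale1r; exact: Bx.
(* The domain is the segment itself and not the ball, so that the point obtained keeps the form
   whose distance to x is controlled by [Bin]. *)
pose S := [set y | exists2 b, 0 <= b <= 1 & y = x + c *: (s *: u) + b *: (s *: v)].
have [||||p Sp E] := @mean_value_segment _ _ S ('D_u f) (x + c *: (s *: u)) (x + c *: (s *: u) + s *: v).
- move=> _ _ t [a /andP[a0 a1] ->] [b /andP[b0 b1] ->] /andP[t0 t1].
  exists (a + t * (b - a)).
    by apply/andP; split; nra.
  by apply/rowP => i; rewrite !mxE; ring.
- by move=> y [b b01 ->]; apply: df2; exact: Bx.
- by exists 0 => //; rewrite scale0r addr0.
- by exists 1 => //; rewrite scale1r.
have [b b01 pE] := Sp.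
exists p; first by rewrite pE; exact: Bin.
rewrite addrAC !derive_scale; [|exact: df|exact: df].
rewrite -mulrBr E addrAC subrr add0r derive_scale//.
by apply: df2; rewrite pE; exact: Bx.
Qed.
End schwarz.

Lemma hoelder_eq_of_close (V : normedModType R) (B : set V) (F G : V -> R) x :
  hoelder al B F -> hoelder al B G -> B x ->
  (forall q, 0 < q -> exists p p',
     [/\ B p, B p', `|x - p| < q, `|x - p'| < q & G p = F p']) -> F x = G x.
Proof.
move=> [C C0 [_ HC]] [D D0 [_ HD]] Bx H.
apply/eqP; rewrite -subr_eq0 -normr_le0; apply/ler_addgt0Pr => e e0; rewrite add0r.
have [q q0 Hq] : exists2 q, 0 < q & forall x, 0 <= x -> x < q -> x `^ al <= e / (C + D + 1).
  apply: powR_small; first by case/andP: al01.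
  by rewrite divr_gt0// ltr_wpDl// addr_ge0.
have [p [p' [Bp Bp' xp xp' E]]] := H q q0.
rewrite (_ : _ - _ = (F x - F p') - (G x - G p)); last by rewrite E; ring.
rewrite (le_trans (ler_normB _ _))//.
have := HC _ _ Bx Bp'; have := HD _ _ Bx Bp.
have := Hq _ (normr_ge0 _) xp; have := Hq _ (normr_ge0 _) xp'.
set a1 := `|x - p'| `^ al; set a2 := `|x - p| `^ al; set w := e / _.
move=> a1w a2w Hd Hc; apply: (le_trans (lerD Hc Hd)).
apply: (@le_trans _ _ (C * w + D * w)); first by rewrite lerD// ler_wpM2l.
rewrite -mulrDl /w mulrA ler_pdivrMr ?ltr_wpDl ?addr_ge0// mulrC ler_wpM2l ?ltW//.
by rewrite ltrDl.
Qed.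

(** Both mixed derivatives represent the same second difference, each at some point near x. Their
    Hoelder continuity moves the equality to x as the step s shrinks. *)
Lemma derive_commute n (U : set 'rV[R]_n) (f : 'rV[R]_n -> R) (x u v : 'rV[R]_n) :
  open U -> U x -> Ck al U 2 f -> 'D_u ('D_v f) x = 'D_v ('D_u f) x.
Proof.
move=> oU Ux Hf.
have /nbhs_ballP[r /= r0 rU] := open_nbhs_nbhs (conj oU Ux).
have {}Hf := Ck_sub rU Hf.
apply: (hoelder_eq_of_close (Ck_derive u (Ck_derive v Hf))
  (Ck_derive v (Ck_derive u Hf)) (ballxx _ r0)) => q q0.
have N0 : 0 <= `|u| + `|v| by rewrite addr_ge0.
(* The summand 1 covers u = v = 0, and the division by 2 makes the inequality [sm] strict. *)
pose s := Num.min q r / (`|u| + `|v| + 1) / 2.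
have m0 : 0 < Num.min q r by rewrite lt_min q0.
have s0 : 0 < s by rewrite !divr_gt0// ltr_wpDl.
have sm : s * (`|u| + `|v|) < Num.min q r.
  have : s * (`|u| + `|v| + 1) * 2 = Num.min q r.
    by rewrite /s; field; rewrite gt_eqF// ltr_wpDl.
  have : 0 <= s * (`|u| + `|v|) by rewrite mulr_ge0// ltW.
  by lra.
have [sq sr] : s * (`|u| + `|v|) < q /\ s * (`|u| + `|v|) < r.
  by move: sm; rewrite lt_min => /andP[].
have sr' : s * (`|v| + `|u|) < r by rewrite [`|v| + _]addrC.
have [p Hp Ep] := second_difference (ltW s0) sr Hf.
have [p' Hp' Ep'] := second_difference (ltW s0) sr' Hf.
rewrite [`|v| + _]addrC in Hp'.
exists p, p'; split.
- by rewrite -ball_normE /= distrC (le_lt_trans Hp).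
- by rewrite -ball_normE /= distrC (le_lt_trans Hp').
- by rewrite distrC (le_lt_trans Hp).
- by rewrite distrC (le_lt_trans Hp').
apply: (mulfI (lt0r_neq0 s0)); apply: (mulfI (lt0r_neq0 s0)).
apply: (etrans (esym Ep)); apply: (etrans _ Ep'); rewrite (addrAC x).
by move: (f (x + s *: v + s *: u)) (f (x + s *: u)) (f _) (f x) => a b c e'; ring.
Qed.

Section iterated.
Context (n : nat).
Implicit Types (f g : 'rV[R]_n -> R) (vs ws : seq 'rV[R]_n).

(* The opaque proof keeps unification from unfolding iterated derivatives. *)
Fact Dseq_subproof :
  {D : seq 'rV[R]_n -> ('rV[R]_n -> R) -> 'rV[R]_n -> R |
    forall vs f, D vs f = foldl (fun f v => 'D_v f) f vs}.
Proof. by exists (fun vs f => foldl (fun f v => 'D_v f) f vs). Qed.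

Definition Dseq := sval Dseq_subproof.

Lemma DseqE vs f : Dseq vs f = foldl (fun f v => 'D_v f) f vs.
Proof. exact: (svalP Dseq_subproof). Qed.

Lemma Dseq0 f : Dseq [::] f = f.
Proof. by rewrite DseqE. Qed.

Lemma DseqS v vs f : Dseq (v :: vs) f = Dseq vs ('D_v f).
Proof. by rewrite !DseqE. Qed.

Lemma Dseq_cat vs ws f : Dseq (vs ++ ws) f = Dseq ws (Dseq vs f).
Proof. by rewrite !DseqE foldl_cat. Qed.

Context (U : set 'rV[R]_n).
Hypotheses (oU : open U) (cU : segment_closed U).

Lemma Ck_Dseq vs l f : Ck al U (size vs + l) f -> Ck al U l (Dseq vs f).
Proof. by elim: vs f => [|v vs IH] f Hf; rewrite ?Dseq0// DseqS; apply: IH; exact: Ck_derive Hf. Qed.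

Lemma derive_eq_on f g v : (forall x, U x -> f x = g x) ->
  forall x, U x -> 'D_v f x = 'D_v g x.
Proof.
move=> fg x Ux; apply: near_eq_derive.
by apply: filterS (open_nbhs_nbhs (conj oU Ux)) => y; exact: fg.
Qed.

Lemma Dseq_eq vs f g : (forall x, U x -> f x = g x) ->
  forall x, U x -> Dseq vs f x = Dseq vs g x.
Proof.
elim: vs f g => [|v vs IH] f g fg x Ux; first by rewrite !Dseq0 fg.
rewrite !DseqS; by apply: IH => // y Uy; exact: derive_eq_on.
Qed.

Lemma Dseq_zero vs x : Dseq vs (cst 0) x = 0.
Proof.
elim: vs => [|v vs IH]; rewrite ?Dseq0// DseqS (_ : 'D_v (cst 0) = cst 0)//.
by apply/funext => y; rewrite derive_cst.
Qed.

Lemma Dseq_lin vs (a : R) f g : Ck al U (size vs) f -> Ck al U (size vs) g ->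
  forall x, U x -> Dseq vs (fun y => a * f y + g y) x = a * Dseq vs f x + Dseq vs g x.
Proof.
elim: vs f g => [|v vs IH] f g Hf Hg x Ux; rewrite ?Dseq0// !DseqS.
rewrite -IH//; [|exact: Ck_derive Hf|exact: Ck_derive Hg].
apply: Dseq_eq => // y Uy.
have df := @diff_derivable _ _ _ f y v (Ck_diff Hf Uy).
have dg := @diff_derivable _ _ _ g y v (Ck_diff Hg Uy).
have E := @deriveD _ _ _ _ _ _ _ (@derivableZ _ _ _ f a y v df) dg.
by rewrite (@deriveZ _ _ _ f a y v df) in E; exact: E.
Qed.

Lemma Dseq_sum vs I (r : seq I) (a : I -> R) (f : I -> 'rV[R]_n -> R) :
  (forall i, Ck al U (size vs) (f i)) -> forall x, U x ->
  Dseq vs (fun y => \sum_(i <- r) a i * f i y) x = \sum_(i <- r) a i * Dseq vs (f i) x.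
Proof.
move=> Hf x Ux; elim: r => [|i r IH].
  by rewrite big_nil -[RHS](Dseq_zero vs x); apply: Dseq_eq => // y _; rewrite big_nil.
rewrite big_cons -IH -Dseq_lin//.
  by apply: Dseq_eq => // y _; rewrite big_cons.
by apply: Ck_sum => // j _; apply: CkM => //; exact: Ck_cst.
Qed.

Lemma derive_basis_on k f v x : Ck al U k.+1 f -> U x ->
  'D_v f x = \sum_i v ord0 i * 'D_(delta_mx ord0 i) f x.
Proof. by move=> Hf Ux; rewrite derive_rV_basis//; apply: Ck_diff Hf Ux. Qed.

Lemma Dseq_basis vs v f x : Ck al U (size vs).+1 f -> U x ->
  Dseq (v :: vs) f x = \sum_i v ord0 i * Dseq vs ('D_(delta_mx ord0 i) f) x.
Proof.
move=> Hf Ux; have H v := Ck_derive v Hf.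
rewrite DseqS -(Dseq_sum _ _ (fun i => H (delta_mx ord0 i)))//.
by apply: Dseq_eq => // y Uy; exact: (derive_basis_on _ Hf).
Qed.

(** The direction v travels to the front by adjacent exchanges. Each exchange is an equality of
    functions on U, carried through the derivatives that follow by [Dseq_eq]. *)
Lemma Dseq_move vs ws v f x : Ck al U (size vs + size ws).+1 f -> U x ->
  Dseq (vs ++ v :: ws) f x = Dseq (v :: vs ++ ws) f x.
Proof.
elim: vs f => [//|w vs IH] f Hf Ux.
rewrite cat_cons DseqS (IH _ (Ck_derive w Hf) Ux) cat_cons !DseqS.
apply: Dseq_eq Ux => y Uy.
by apply: (derive_commute v w oU Uy); apply: Ck_le Hf.
Qed.

Lemma Dseq_perm vs ws f x : Ck al U (size vs) f -> U x -> perm_eq vs ws ->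
  Dseq vs f x = Dseq ws f x.
Proof.
elim: vs ws f => [|v vs IH] ws f Hf Ux; first by rewrite perm_sym => /perm_nilP ->.
move=> p; have vws : v \in ws by rewrite -(perm_mem p) mem_head.
case/splitPr: vws p => i j p.
have p' : perm_eq vs (i ++ j).
  by move: p; rewrite -cat1s perm_sym -[v :: j]cat1s perm_catCA perm_cat2l perm_sym.
rewrite DseqS Dseq_move//; last by rewrite -size_cat -(perm_size p').
by rewrite DseqS; apply: IH => //; exact: Ck_derive Hf.
Qed.

Lemma Dseq_multilin vs i (a : R) u w f x : Ck al U (size vs) f -> U x -> (i < size vs)%N ->
  Dseq (set_nth 0 vs i (a *: u + w)) f x =
    a * Dseq (set_nth 0 vs i u) f x + Dseq (set_nth 0 vs i w) f x.
Proof.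
elim: vs i f => [//|v vs IH] [|i] f Hf Ux; have H v := Ck_derive v Hf.
  move=> _; rewrite /= !DseqS -(Dseq_lin _ (H u) (H w))//.
  by apply: Dseq_eq => // y Uy; rewrite derive_lin//; apply: Ck_diff Hf Uy.
by rewrite ltnS => ile; rewrite /= !DseqS; apply: IH => //; exact: H.
Qed.

(* The directions are expanded in the canonical basis, so that only finitely many
   functions, the derivatives of f along basis vectors, are involved: this makes the
   constant uniform in vs. *)
Lemma Dseq_functional_bound I (T : I -> ('rV[R]_n -> R) -> R) (w : I -> R) (P : I -> Prop) l :
  (forall i, 0 <= w i) ->
  (forall i f g, P i -> (forall x, U x -> f x = g x) -> T i f = T i g) ->
  (forall i m (a : 'I_m -> R) (f : 'I_m -> 'rV[R]_n -> R), P i ->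
     (forall j, Ck al U l (f j)) ->
     T i (fun x => \sum_j a j * f j x) = \sum_j a j * T i (f j)) ->
  (forall f, Ck al U l f -> exists2 C, 0 <= C & forall i, P i -> `|T i f| <= C * w i) ->
  forall k f, Ck al U (k + l) f -> exists2 C, 0 <= C &
    forall i vs, P i -> size vs = k -> `|T i (Dseq vs f)| <= C * w i * \prod_(v <- vs) `|v|.
Proof.
move=> w0 Teq Tlin Tb; elim=> [|k IH] f Hf.
  have [C C0 HC] := Tb _ Hf; exists C => // i vs Pi /size0nil ->.
  by rewrite big_nil mulr1 Dseq0; exact: HC.
have H v := Ck_derive v Hf.
pose C j := projT1 (cid2 (IH _ (H (delta_mx ord0 j)))).
have C0 j : 0 <= C j by rewrite /C; case: cid2.
have HC j i vs : P i -> size vs = k ->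
    `|T i (Dseq vs ('D_(delta_mx ord0 j) f))| <= C j * w i * \prod_(v <- vs) `|v|.
  by rewrite /C; case: cid2 => //= x _; exact.
exists (\sum_j C j); first by rewrite sumr_ge0.
move=> i [//|v vs] Pi [svs].
have E x : U x -> Dseq (v :: vs) f x =
    \sum_j v ord0 j * Dseq vs ('D_(delta_mx ord0 j) f) x.
  by move=> Ux; apply: Dseq_basis => //; rewrite svs; apply: Ck_le Hf; rewrite ?ltnS ?leq_addr.
rewrite (Teq _ _ _ Pi E) Tlin//; last first.
  by move=> j; apply: Ck_Dseq; rewrite svs; exact: H.
rewrite (le_trans (ler_norm_sum _ _ _))// !mulr_suml ler_sum// => j _.
rewrite big_cons normrM mulrC mulrCA mulrC ler_pM//; last exact: HC.
exact: mx_norm_coord.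
Qed.

Definition taylor_rem l (x y : 'rV[R]_n) f : R :=
  f x - \sum_(0 <= j < l.+1) (j`!%:R)^-1 * Dseq (nseq j (x - y)) f y.

Lemma taylor_rem_eq l x y f g : U x -> U y -> (forall z, U z -> f z = g z) ->
  taylor_rem l x y f = taylor_rem l x y g.
Proof.
move=> Ux Uy fg; rewrite /taylor_rem fg//; congr (_ - _); apply: eq_bigr => j _.
by congr (_ * _); exact: Dseq_eq.
Qed.

Lemma taylor_rem_sum l x y m (a : 'I_m -> R) (f : 'I_m -> 'rV[R]_n -> R) : U x -> U y ->
  (forall j, Ck al U l (f j)) ->
  taylor_rem l x y (fun x => \sum_j a j * f j x) = \sum_j a j * taylor_rem l x y (f j).
Proof.
move=> Ux Uy Hf; rewrite /taylor_rem.
under [RHS]eq_bigr do rewrite mulrBr.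
rewrite sumrB; congr (_ - _).
under [RHS]eq_bigr do rewrite big_distrr /=.
rewrite exchange_big /= big_nat [RHS]big_nat; apply: eq_bigr => j /andP[_ jl].
rewrite Dseq_sum//; last first.
  by move=> i; rewrite size_nseq; apply: Ck_le (Hf i).
by rewrite big_distrr; apply: eq_bigr => i _; rewrite mulrCA.
Qed.

Lemma Dseq_nseq_scale j (t : R) h f y : Ck al U j f -> U y ->
  Dseq (nseq j (t *: h)) f y = t ^+ j * Dseq (nseq j h) f y.
Proof.
elim: j f => [|j IH] f Hf Uy; first by rewrite expr0 mul1r /= !Dseq0.
have H v := Ck_derive v Hf; rewrite /= !DseqS exprS.
rewrite (@Dseq_eq _ _ (fun y => t * 'D_h f y + cst 0 y))//; last first.
  by move=> z Uz; rewrite addr0 derive_scale//; apply: Ck_diff Hf Uz.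
have E := @Dseq_lin (nseq j (t *: h)) t ('D_h f) (cst 0).
rewrite size_nseq in E; rewrite (E (H h) (Ck_cst _ _ _ _) y Uy).
by rewrite (IH _ (H h) Uy) Dseq_zero addr0 -mulrA.
Qed.

(** Induction on the order: along the segment from y to x = y + h, the derivative of the remainder
    of order l + 1 of f is the remainder of order l of D_h f. The mean value theorem then gains one
    factor |h|. At order 0 the claim is the Hoelder condition. *)
Lemma taylor_bound l f : Ck al U l f -> exists2 C, 0 <= C &
  forall x y, U x -> U y -> `|taylor_rem l x y f| <= C * `|x - y| `^ (l%:R + al).
Proof.
elim: l f => [|l IH] f Hf.
  have [C C0 [_ HC]] := Hf; exists C => // x y Ux Uy.
  by rewrite /taylor_rem big_nat1 /= Dseq0 invr1 mul1r add0r; exact: HC.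
have H v := Ck_derive v Hf.
pose C j := projT1 (cid2 (IH _ (H (delta_mx ord0 j)))).
have C0 j : 0 <= C j by rewrite /C; case: cid2.
have HC j x y : U x -> U y ->
    `|taylor_rem l x y ('D_(delta_mx ord0 j) f)| <= C j * `|x - y| `^ (l%:R + al).
  by rewrite /C; case: cid2 => //= z _; exact.
exists (\sum_j C j) => [|x y Ux Uy]; first by rewrite sumr_ge0.
set h := x - y.
(* The Taylor polynomial as a polynomial in t; its formal derivative is the Taylor polynomial of D_h
   f, which makes the differentiation algebraic. *)
pose p : {poly R} := \poly_(j < l.+2) ((j`!%:R)^-1 * Dseq (nseq j h) f y).
pose r t := f (y + t *: h) - p.[t].
have Uth t : 0 <= t <= 1 -> U (y + t *: h) by move=> t01; exact: cU.
have dr (t : R) : 0 <= t <= 1 -> is_derive t 1 r (taylor_rem l (y + t *: h) y ('D_h f)).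
  move=> t01; rewrite /taylor_rem.
  have -> : \sum_(0 <= j < l.+1) (j`!%:R)^-1 *
      Dseq (nseq j (y + t *: h - y)) ('D_h f) y = (p^`()).[t].
    rewrite (@horner_coef_wide _ l.+1); last first.
      apply/leq_sizeP => j lj; rewrite coef_deriv coef_poly ltnS ltnNge lj /=.
      by rewrite mul0rn.
    rewrite big_mkord; apply: eq_bigr => j _.
    rewrite coef_deriv coef_poly ltnS ltn_ord addrC addKr.
    rewrite Dseq_nseq_scale//; last first.
      by apply: Ck_le (H h) => //; rewrite -ltnS.
    rewrite DseqS -[_ *+ j.+1]mulr_natr.
    have -> : (j.+1)`!%:R = j.+1%:R * j`!%:R :> R by rewrite factS natrM.
    have f0 : j`!%:R != 0 :> R by rewrite pnatr_eq0 -lt0n fact_gt0.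
    have n0 : j.+1%:R != 0 :> R by rewrite pnatr_eq0.
    move: (Dseq _ _ _) (j`!%:R : R) f0 (j.+1%:R : R) n0 => X a a0 b b0.
    by field; rewrite a0.
  apply: is_deriveB; apply: is_derive_line; apply: (Ck_diff Hf); exact: Uth.
have [c c01] := mean_value01 dr.
have -> : r 0 = 0.
  by rewrite /r scale0r addr0 horner_coef0 coef_poly /= Dseq0 invr1 mul1r subrr.
rewrite subr0 => E.
have -> : taylor_rem l.+1 x y f = r 1.
  rewrite /r scale1r /h addrCA subrr addr0 /taylor_rem; congr (_ - _).
  by rewrite horner_poly big_mkord; apply: eq_bigr => j _; rewrite expr1n mulr1.
rewrite E.
(* Applied to D_h f, the induction hypothesis would give a constant depending on h. It is applied
   instead to the finitely many derivatives along basis vectors, and the coordinates of h supply the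
   factor |h|. *)
rewrite (@taylor_rem_eq _ _ _ _ (fun z => \sum_i h ord0 i * 'D_(delta_mx ord0 i) f z))//;
  [|exact: Uth|by move=> z Uz; exact: (derive_basis_on _ Hf)].
rewrite taylor_rem_sum//; [|exact: Uth].
rewrite (le_trans (ler_norm_sum _ _ _))// mulr_suml ler_sum// => i _.
have la0 : 0 < l%:R + al by rewrite ltr_wpDl//; case/andP: al01.
rewrite -natr1 addrAC powRD; last by rewrite gt_eqF// addr_gt0.
rewrite powRr1// normrM mulrC mulrA ler_pM//; last exact: mx_norm_coord.
rewrite (le_trans (HC _ _ _ (Uth _ c01) Uy))// ler_wpM2l//.
apply: ge0_ler_powR; rewrite ?nnegrE//.
  by rewrite addr_ge0//; case/andP: al01 => /ltW.
rewrite addrC addKr normrZ; case/andP: c01 => c0 c1.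
by rewrite ger0_norm// ler_piMl.
Qed.

End iterated.
End taylor.

(** * Lip-gamma functions *)

Section lip_gamma.
Context {R : realType}.

Lemma enorm_ge0 n (v : 'rV[R]_n) : 0 <= enorm v.
Proof. exact: sqrtr_ge0. Qed.

Lemma norm_le_enorm n (v : 'rV[R]_n) : `|v| <= enorm v.
Proof.
apply: rV_norm_le => [|i]; first exact: enorm_ge0.
rewrite -sqrtr_sqr ler_sqrt; last by rewrite sumr_ge0// => j _; exact: sqr_ge0.
by rewrite (bigD1 i)//= lerDl sumr_ge0// => j _; exact: sqr_ge0.
Qed.

Lemma enorm_le_sum n (v : 'rV[R]_n) : enorm v <= \sum_i `|v ord0 i|.
Proof.
have S0 : 0 <= \sum_i `|v ord0 i| by exact: sumr_ge0.
rewrite -[leRHS](ger0_norm S0) -sqrtr_sqr ler_sqrt ?sqr_ge0// expr2 mulr_suml.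
apply: ler_sum => i _; rewrite -real_normK ?num_real// expr2 ler_wpM2l//.
by rewrite (bigD1 i)//= lerDl sumr_ge0.
Qed.

Lemma enorm_le_norm n (v : 'rV[R]_n) : enorm v <= n%:R * `|v|.
Proof.
rewrite (le_trans (enorm_le_sum v))//.
have -> : n%:R * `|v| = \sum_(i < n) `|v| by rewrite sumr_const card_ord mulr_natl.
by apply: ler_sum => i _; exact: mx_norm_coord.
Qed.

Lemma enormZ n (a : R) (v : 'rV[R]_n) : enorm (a *: v) = `|a| * enorm v.
Proof.
rewrite /enorm; under eq_bigr do rewrite mxE exprMn.
by rewrite -mulr_sumr sqrtrM ?sqr_ge0// sqrtr_sqr.
Qed.

Lemma enorm0 n : enorm (0 : 'rV[R]_n) = 0.
Proof. by rewrite -(scale0r 0) enormZ normr0 mul0r. Qed.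

Lemma enorm_continuous n : continuous (@enorm R n).
Proof.
move=> v; apply: (@continuous_comp _ _ _ (fun v : 'rV[R]_n => \sum_i (v ord0 i) ^+ 2)
  (@Num.sqrt R)); last exact: sqrt_continuous.
rewrite (_ : (fun _ => _) = \sum_(i < n) (fun v : 'rV[R]_n => v ord0 i) ^+ 2).
  apply: differentiable_continuous; apply: differentiable_sum => i.
  by apply: differentiableX; exact: differentiable_coord.
by apply/funext => w; rewrite fct_sumE; apply: eq_bigr.
Qed.

Lemma eball_open n : open (@eball R n).
Proof.
rewrite (_ : @eball R n = @enorm R n @^-1` [set x | x < 1])//.
by apply: open_comp => //; move=> x _; exact: enorm_continuous.
Qed.

Lemma prod_norm_le_tnorm n (vs : seq 'rV[R]_n) : \prod_(v <- vs) `|v| <= tnorm vs.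
Proof. by apply: ler_prod => v _; rewrite normr_ge0 norm_le_enorm. Qed.

Lemma tnorm_ge0 n (vs : seq 'rV[R]_n) : 0 <= tnorm vs.
Proof. by rewrite /tnorm prodr_ge0// => v _; exact: enorm_ge0. Qed.

Lemma lip_bound_sub (ga : R) n m (U V : set 'rV[R]_n) (f : 'rV[R]_n -> 'rV[R]_m) L :
  V `<=` U -> lip_bound ga U f L -> lip_bound ga V f L.
Proof.
move=> VU [k0 [g [k0g [[H1 [H2 H3]] H4]]]]; exists k0, g; split=> //; split; last first.
  by move=> x /VU; exact: H4.
split; first by move=> k x kk /VU; exact: H1.
split; first by move=> k x v kk /VU; exact: H2.
by move=> k x y v kk /VU Ux /VU Uy; exact: H3.
Qed.

Lemma lip_bound_eq (ga : R) n m (U : set 'rV[R]_n) (f g : 'rV[R]_n -> 'rV[R]_m) L :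
  (forall x, U x -> f x = g x) -> lip_bound ga U f L -> lip_bound ga U g L.
Proof.
move=> fg [k0 [G [k0g [H H4]]]]; exists k0, G; split=> //; split=> //.
by move=> x Ux; rewrite H4// fg.
Qed.

Lemma lip_bound_le (ga : R) n m (U : set 'rV[R]_n) (f : 'rV[R]_n -> 'rV[R]_m) L L' :
  L <= L' -> lip_bound ga U f L -> lip_bound ga U f L'.
Proof.
move=> LL' [k0 [g [k0g [[H1 [H2 H3]] H4]]]]; exists k0, g; split=> //; split=> //.
split=> //; split.
  move=> k x v kk Ux sv; rewrite (le_trans (H2 _ _ _ kk Ux sv))//.
  by rewrite ler_wpM2r// tnorm_ge0.
move=> k x y v kk Ux Uy sv; rewrite (le_trans (H3 _ _ _ _ kk Ux Uy sv))//.
by rewrite ler_wpM2r ?tnorm_ge0// ler_wpM2r// powR_ge0.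
Qed.

Lemma lip_bound_shift (ga : R) n m (U V : set 'rV[R]_n) (f : 'rV[R]_n -> 'rV[R]_m) L a :
  (forall x, V x -> U (x + a)) -> lip_bound ga U f L ->
  lip_bound ga V (fun x => f (x + a)) L.
Proof.
move=> VU [k0 [g [k0g [[H1 [H2 H3]] H4]]]].
exists k0, (fun k x v => g k (x + a) v); split=> //; split; last first.
  by move=> x /VU; exact: H4.
split; first by move=> k x kk /VU; exact: H1.
split; first by move=> k x v kk /VU; exact: H2.
move=> k x y v kk /VU Ux /VU Uy sv; have := H3 k _ _ v kk Ux Uy sv.
by rewrite (_ : x + a - (y + a) = x - y)// opprD addrACA subrr addr0.
Qed.

(** The collection consists of the iterated derivatives of the coordinates. Both kinds of bound are
    instances of [Dseq_functional_bound]: for the evaluation at x, and for the Taylor remainder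
    between y and x. *)
Lemma Ck_lip_bound (ga : R) k0 n m (U : set 'rV[R]_n) (F : 'rV[R]_n -> 'rV[R]_m) :
  k0%:R < ga <= k0%:R + 1 -> open U -> segment_closed U ->
  (forall j, Ck (ga - k0%:R) U k0 (fun x => F x ord0 j)) ->
  exists2 L, 0 <= L & lip_bound ga U F L.
Proof.
move=> k0g oU cU HF.
have al01 : 0 < ga - k0%:R <= 1.
  by case/andP: k0g => g1 g2; rewrite subr_gt0 g1 lerBlDl.
have Fk k l j : (k + l <= k0)%N -> Ck (ga - k0%:R) U (k + l) (fun x => F x ord0 j).
  by move=> kl; apply: (Ck_le al01 cU kl (HF j)).
(* The condition k <= k0 stands inside the existential, so that constants can be chosen for all k at
   once and then summed. *)
have B1 k j : exists2 C, 0 <= C & (k <= k0)%N -> forall x vs, U x -> size vs = k ->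
    `|Dseq vs (fun x => F x ord0 j) x| <= C * \prod_(v <- vs) `|v|.
  have [kk|kk] := leqP k k0; last first.
    by exists 0 => // kk'; move: (leq_ltn_trans kk' kk); rewrite ltnn.
  have [|||||C C0 HC] := @Dseq_functional_bound R _ al01 n U oU cU 'rV[R]_n
    (fun x f => f x) (fun _ => 1) U 0 _ _ _ _ k (fun x => F x ord0 j).
  - by move=> _; exact: ler01.
  - by move=> i f g Ui; exact.
  - by [].
  - by move=> f [C C0 [HC _]]; exists C => // x Ux; rewrite mulr1 HC.
  - by apply: Fk; rewrite addn0.
  by exists C => // _ x vs Ux sv; have := HC x vs Ux sv; rewrite mulr1.
(* Here the functionals are indexed by pairs (x, y), and the weight |x - y|^(ga - k) is what makes
   the constant independent of the pair. *)
have B2 k j : exists2 C, 0 <= C & (k <= k0)%N -> forall x y vs, U x -> U y -> size vs = k ->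
    `|taylor_rem (k0 - k) x y (Dseq vs (fun x => F x ord0 j))| <=
      C * `|x - y| `^ (ga - k%:R) * \prod_(v <- vs) `|v|.
  have [kk|kk] := leqP k k0; last first.
    by exists 0 => // kk'; move: (leq_ltn_trans kk' kk); rewrite ltnn.
  have [|||||C C0 HC] := @Dseq_functional_bound R _ al01 n U oU cU ('rV[R]_n * 'rV[R]_n)
    (fun p f => taylor_rem (k0 - k) p.1 p.2 f)
    (fun p => `|p.1 - p.2| `^ (ga - k%:R)) (fun p => U p.1 /\ U p.2) (k0 - k)
    _ _ _ _ k (fun x => F x ord0 j).
  - by move=> p; exact: powR_ge0.
  - by move=> [x y] f g [/= Ux Uy] fg; exact: (@taylor_rem_eq _ _ _ oU).
  - by move=> [x y] p a f [/= Ux Uy] Hf; exact: (taylor_rem_sum al01 oU cU).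
  - move=> f Hf; have [C C0 HC] := taylor_bound al01 oU cU Hf.
    exists C => // -[x y] [/= Ux Uy]; have := HC _ _ Ux Uy.
    rewrite natrB//.
    by rewrite (_ : k0%:R - k%:R + (ga - k0%:R) = ga - k%:R)//; ring.
  - by apply: Fk; rewrite subnKC.
  by exists C => // _ x y vs Ux Uy sv; have := HC (x, y) vs (conj Ux Uy) sv.
pose C1 k j := projT1 (cid2 (B1 k j)).
have C10 k j : 0 <= C1 k j by rewrite /C1; case: cid2.
have HC1 k j x vs : (k <= k0)%N -> U x -> size vs = k ->
    `|Dseq vs (fun x => F x ord0 j) x| <= C1 k j * \prod_(v <- vs) `|v|.
  by rewrite /C1; case: cid2 => //= C _ H kk; exact: H.
pose C2 k j := projT1 (cid2 (B2 k j)).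
have C20 k j : 0 <= C2 k j by rewrite /C2; case: cid2.
have HC2 k j x y vs : (k <= k0)%N -> U x -> U y -> size vs = k ->
    `|taylor_rem (k0 - k) x y (Dseq vs (fun x => F x ord0 j))| <=
      C2 k j * `|x - y| `^ (ga - k%:R) * \prod_(v <- vs) `|v|.
  by rewrite /C2; case: cid2 => //= C _ H kk; exact: H.
pose L := \sum_(k < k0.+1) \sum_j (C1 k j + C2 k j).
have L0 : 0 <= L.
  by rewrite /L sumr_ge0// => k _; rewrite sumr_ge0// => j _; rewrite addr_ge0.
have L1 k : (k <= k0)%N -> \sum_j C1 k j <= L.
  move=> kk; have lk : (k < k0.+1)%N by rewrite ltnS.
  rewrite /L (bigD1 (Ordinal lk))//= -[leLHS]addr0 lerD//.
    by apply: ler_sum => j _; rewrite lerDl.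
  by rewrite sumr_ge0// => i _; rewrite sumr_ge0// => j _; rewrite addr_ge0.
have L2 k : (k <= k0)%N -> \sum_j C2 k j <= L.
  move=> kk; have lk : (k < k0.+1)%N by rewrite ltnS.
  rewrite /L (bigD1 (Ordinal lk))//= -[leLHS]addr0 lerD//.
    by apply: ler_sum => j _; rewrite lerDr.
  by rewrite sumr_ge0// => i _; rewrite sumr_ge0// => j _; rewrite addr_ge0.
exists L => //.
pose g (k : nat) x (vs : seq 'rV[R]_n) : 'rV[R]_m :=
  \row_j Dseq vs (fun x => F x ord0 j) x.
exists k0, g; split=> //; split; last first.
  by move=> x Ux; apply/rowP => j; rewrite mxE Dseq0.
have Fsz vs j : (size vs <= k0)%N -> Ck (ga - k0%:R) U (size vs) (fun x => F x ord0 j).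
  by move=> sv; have := @Fk (size vs) 0%N j; rewrite addn0; exact.
split.
  move=> k x kk Ux; split=> [v w sv vw|v i a u w sv ik]; apply/rowP => j; rewrite !mxE.
    by apply: (Dseq_perm al01 oU cU) => //; apply: Fsz; rewrite sv.
  have svk : (size v <= k0)%N by rewrite sv.
    have ivk : (i < size v)%N by rewrite sv.
    exact (@Dseq_multilin R (ga - k0%:R) n U oU v i a u w _ x (Fsz _ v j svk) Ux ivk).
split.
  move=> k x v kk Ux sv; rewrite (le_trans (enorm_le_sum _))//.
  apply: (@le_trans _ _ (\sum_j C1 k j * tnorm v)); last first.
    by rewrite -mulr_suml ler_wpM2r ?tnorm_ge0// L1.
  apply: ler_sum => j _; rewrite mxE (le_trans (HC1 _ _ _ _ kk Ux sv))//.
  by rewrite ler_wpM2l// prod_norm_le_tnorm.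
move=> k x y v kk Ux Uy sv; rewrite (le_trans (enorm_le_sum _))//.
have gk0 : 0 <= ga - k%:R.
  have /andP[/ltW + _] := al01; rewrite subr_ge0 subr_ge0; apply: le_trans.
  by rewrite ler_nat.
apply: (@le_trans _ _ (\sum_j C2 k j * enorm (x - y) `^ (ga - k%:R) * tnorm v)); last first.
  rewrite -mulr_suml ler_wpM2r ?tnorm_ge0// -mulr_suml ler_wpM2r ?powR_ge0//.
  exact: L2.
apply: ler_sum => j _; rewrite !mxE.
rewrite (_ : _ - _ = taylor_rem (k0 - k) x y (Dseq v (fun x => F x ord0 j))); last first.
  rewrite /taylor_rem summxE; congr (_ - _).
  (* Reindexing by j = k + i: differentiating along v followed by i copies of x - y gives the i-th
     Taylor term of the derivative along v. *)
  rewrite -{1}[k]add0n big_addn subSn//; apply: eq_bigr => i _.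
  by rewrite !mxE addnK Dseq_cat.
rewrite (le_trans (HC2 _ _ _ _ _ kk Ux Uy sv))//.
apply: ler_pM => //.
- by rewrite mulr_ge0// powR_ge0.
- by rewrite prodr_ge0.
- rewrite ler_wpM2l// ge0_ler_powR// ?nnegrE ?enorm_ge0//.
  exact: norm_le_enorm.
- exact: prod_norm_le_tnorm.
Qed.

End lip_gamma.

(** * From Lip-gamma collections on the whole space to Hoelder classes *)

Section lip_to_Ck.
Context {R : realType}.

Lemma enorm_coord n (v : 'rV[R]_n) i : `|v ord0 i| <= enorm v.
Proof. by rewrite (le_trans (mx_norm_coord v ord0 i))// norm_le_enorm. Qed.

Section collection.
Context (ga : R) (n m k0 : nat) (L : R)
  (G : nat -> 'rV[R]_n -> seq 'rV[R]_n -> 'rV[R]_m).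
Hypotheses (k0g : k0%:R < ga <= k0%:R + 1) (HG : lip_coll ga setT G k0 L).

(** Read off the bound at order 0, where the empty tensor has norm 1. *)
Lemma lip_coll_const_ge0 : 0 <= L.
Proof.
have [_ [H _]] := HG; have := H 0%N 0 [::] (leq0n _) I erefl.
by rewrite /tnorm big_nil mulr1; apply: le_trans; exact: enorm_ge0.
Qed.

Lemma tnorm_cat (vs ws : seq 'rV[R]_n) : tnorm (vs ++ ws) = tnorm vs * tnorm ws.
Proof. by rewrite /tnorm big_cat. Qed.

Lemma tnorm_nseq l (h : 'rV[R]_n) : tnorm (nseq l h) = enorm h ^+ l.
Proof.
elim: l => [|l IH]; first by rewrite /tnorm big_nil expr0.
by rewrite exprS -IH /tnorm big_cons.
Qed.

Lemma lip_coll_linear x v j : (size v < k0)%N ->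
  linear (fun w => G (size v).+1 x (rcons v w) ord0 j).
Proof.
move=> sk a u w; have [H _] := HG; have [_ H2] := H _ x sk I.
have sz : size (rcons v 0) = (size v).+1 by rewrite size_rcons.
have E z : set_nth 0 (rcons v 0) (size v) z = rcons v z.
  by elim: v {sk H2 sz} => //= y v ->.
have := H2 (rcons v 0) (size v) a u w sz (ltnSn _); rewrite !E => ->.
by rewrite !mxE.
Qed.

(** In the expansion at order [size v] the first two terms are the value and the expected
    derivative. Each of the at most k0 other terms carries two or more factors h, hence is quadratic
    for |h| <= 1. The remainder is |h| times |h|^(ga - size v - 1). *)
Lemma lip_coll_estimate x h v j : (size v < k0)%N -> enorm h <= 1 ->
  `|G (size v) (x + h) v ord0 j - G (size v) x v ord0 j -
    G (size v).+1 x (rcons v h) ord0 j| <=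
    (k0.+1%:R * L * tnorm v) * (enorm h * (enorm h + enorm h `^ (ga - (size v).+1%:R))).
Proof.
move=> sk h1; have [_ [H2 H3]] := HG.
have L0 := lip_coll_const_ge0.
have := H3 (size v) (x + h) x v (ltnW sk) I I erefl.
rewrite [x + h - x]addrAC subrr add0r.
rewrite big_ltn ?ltnS ?(ltnW sk)// big_ltn ?ltnS// subnn subSnn /=.
rewrite invr1 !scale1r cats0 cats1; set S := \sum_(_ <= _ < _) _ => E.
have {}E := le_trans (enorm_coord _ j) E; rewrite !mxE in E.
have SE : `|S ord0 j| <= k0%:R * (L * tnorm v * enorm h ^+ 2).
  rewrite summxE (le_trans (ler_norm_sum _ _ _))//.
  apply: (@le_trans _ _ (\sum_((size v).+2 <= i < k0.+1) L * tnorm v * enorm h ^+ 2)).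
    rewrite big_nat [leRHS]big_nat; apply: ler_sum => i /andP[i1 i2].
    rewrite mxE normrM.
    apply: (@le_trans _ _ (1 * `|G i x (v ++ nseq (i - size v) h) ord0 j|)).
      rewrite ler_wpM2r// ger0_norm ?invr_ge0// invf_le1 ?ltr0n ?fact_gt0//.
      by rewrite ler1n fact_gt0.
    rewrite mul1r (le_trans (enorm_coord _ _))//.
    have si : size (v ++ nseq (i - size v) h) = i.
      by rewrite size_cat size_nseq subnKC// (leq_trans _ i1)// -addn2 leq_addr.
    rewrite (le_trans (H2 _ _ _ _ I si))// tnorm_cat mulrA ler_wpM2l ?mulr_ge0 ?tnorm_ge0//.
    rewrite tnorm_nseq ler_wiXn2l ?enorm_ge0//.
    by rewrite -(leq_add2r (size v)) subnK ?add2n// (leq_trans _ i1)// -addn2 leq_addr.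
  rewrite sumr_const_nat -[leLHS]mulr_natl ler_wpM2r ?ler_nat//.
    by rewrite !mulr_ge0 ?tnorm_ge0 ?exprn_ge0 ?enorm_ge0.
  by rewrite subSS leq_subLR leq_addl.
rewrite (_ : _ - _ = (G (size v) (x + h) v ord0 j -
   (G (size v) x v ord0 j + (G (size v).+1 x (rcons v h) ord0 j + S ord0 j))) + S ord0 j);
  last by ring.
rewrite (le_trans (ler_normD _ _))// (le_trans (lerD E SE))//.
have gs : 0 < ga - (size v)%:R.
  by case/andP: k0g => g1 _; rewrite subr_gt0 (le_lt_trans _ g1)// ler_nat ltnW.
have -> : enorm h `^ (ga - (size v)%:R) = enorm h * enorm h `^ (ga - (size v).+1%:R).
  by rewrite -(mulr_powRB1 (enorm_ge0 h) gs) -addrA -opprD natr1.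
rewrite -[k0.+1%:R]natr1.
have T0 := tnorm_ge0 v; have e0 := enorm_ge0 h; have p0 := powR_ge0 (enorm h) (ga - (size v).+1%:R).
move: (enorm h) (enorm h `^ _) (tnorm v) e0 p0 T0 => e p T e0 p0 T0.
have K0 : 0 <= k0%:R :> R by [].
have LT : 0 <= L * T by rewrite mulr_ge0.
rewrite (_ : (k0%:R + 1) * L * T * (e * (e + p)) =
  L * (e * p) * T + k0%:R * (L * T * e ^+ 2) + (k0%:R * (L * T * (e * p)) + L * T * e ^+ 2)).
  by rewrite lerDl addr_ge0// !mulr_ge0// ?exprn_ge0.
by ring.
Qed.

(** Since size v + 1 <= k0 < ga, the exponent ga - size v - 1 is positive and the error in
    [lip_coll_estimate] is o(|h|): each member of the collection is the derivative of the preceding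
    one. *)
Lemma lip_coll_diff x v j : (size v < k0)%N ->
  differentiable (fun x => G (size v) x v ord0 j) x /\
  forall w, 'D_w (fun x => G (size v) x v ord0 j) x =
            G (size v).+1 x (rcons v w) ord0 j.
Proof.
move=> sk; have [_ [H2 _]] := HG.
have [|h|e e0|d dE] := @diff_of_estimate R _ _ (fun x => G (size v) x v ord0 j) x
  (fun w => G (size v).+1 x (rcons v w) ord0 j) (L * tnorm v * n%:R).
- exact: lip_coll_linear.
- rewrite (le_trans (enorm_coord _ _))//.
  rewrite (le_trans (H2 _ _ _ sk I _)) ?size_rcons// -cats1 tnorm_cat mulrA -[leRHS]mulrA.
  rewrite ler_wpM2l ?mulr_ge0 ?lip_coll_const_ge0 ?tnorm_ge0//.
  by rewrite /tnorm big_seq1 enorm_le_norm.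
- have b0 : 0 < ga - (size v).+1%:R.
    by case/andP: k0g => g1 _; rewrite subr_gt0 (le_lt_trans _ g1)// ler_nat.
  set K := k0.+1%:R * L * tnorm v.
  have K0 : 0 <= K by rewrite !mulr_ge0 ?lip_coll_const_ge0 ?tnorm_ge0.
  (* Half of the tolerance goes to |h| and half to its power; the factor n pays for [enorm] h <= n
     |h|. *)
  have e'0 : 0 < e / (K * n%:R + 1) / 2.
    by rewrite !divr_gt0// ltr_wpDl// mulr_ge0.
  have [r r0 Hr] := powR_small b0 e'0.
  pose s := Num.min (Num.min r 1) (e / (K * n%:R + 1) / 2) / n.+1%:R.
  exists s; first by rewrite divr_gt0// !lt_min r0 ltr01 e'0.
  move=> h hs.
  have hn : enorm h < Num.min (Num.min r 1) (e / (K * n%:R + 1) / 2).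
    move: hs; rewrite ltr_pdivlMr// mulrC; apply: le_lt_trans.
    by rewrite (le_trans (enorm_le_norm _))// ler_wpM2r// ler_nat.
  move: hn; rewrite !lt_min => /andP[/andP[hr h1] he].
  have := @lip_coll_estimate x h v j sk (ltW h1); rewrite -/K => /le_trans; apply.
  have X := Hr _ (enorm_ge0 h) hr.
  apply: (@le_trans _ _ (K * (enorm h * (e / (K * n%:R + 1))))).
    rewrite ler_wpM2l// ler_wpM2l ?enorm_ge0//.
    by rewrite (le_trans (lerD (ltW he) X))// -splitr.
  apply: (@le_trans _ _ (K * ((n%:R * `|h|) * (e / (K * n%:R + 1))))).
    rewrite ler_wpM2l// ler_wpM2r ?enorm_le_norm//.
    by rewrite divr_ge0 ?ltW// ltr_wpDl// mulr_ge0.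
  rewrite (_ : K * _ = e * (K * n%:R / (K * n%:R + 1)) * `|h|); last by ring.
  rewrite ler_wpM2r// ler_piMr ?ltW// ltr_pdivrMr ?mul1r ?ltrDl//.
  by rewrite ltr_wpDl// mulr_ge0.
by split=> // w; rewrite deriveE// dE.
Qed.

(** Descent from the top order: at order k0 the expansion has a single term, so its remainder
    estimate is the Hoelder condition. Below, differentiation appends a direction to v and lowers
    l. *)
Lemma lip_coll_Ck l v j (U : set 'rV[R]_n) : (size v + l)%N = k0 ->
  Ck (ga - k0%:R) U l (fun x => G (size v) x v ord0 j).
Proof.
have [_ [H2 H3]] := HG.
have B w : (size w <= k0)%N -> exists2 C : R, 0 <= C &
    forall a, U a -> `|G (size w) a w ord0 j| <= C.
  move=> sw; exists (L * tnorm w); first by rewrite mulr_ge0 ?lip_coll_const_ge0 ?tnorm_ge0.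
  by move=> a _; rewrite (le_trans (enorm_coord _ _))// H2.
elim: l v => [|l IH] v sv.
  rewrite addn0 in sv; apply: hoelderW; first by apply: B; rewrite sv.
  exists (L * n%:R `^ (ga - k0%:R) * tnorm v) => [|a b _ _].
    by rewrite !mulr_ge0 ?lip_coll_const_ge0 ?tnorm_ge0// powR_ge0.
  have := H3 k0 a b v (leqnn _) I I sv.
  rewrite big_nat1 subnn /= invr1 scale1r cats0 sv => E.
  have := le_trans (enorm_coord _ j) E; rewrite !mxE => /le_trans; apply.
  rewrite [leRHS]mulrAC ler_wpM2r ?tnorm_ge0// -mulrA ler_wpM2l ?lip_coll_const_ge0//.
  rewrite -powRM// ge0_ler_powR ?nnegrE ?enorm_ge0 ?mulr_ge0 ?enorm_le_norm//.
  by case/andP: k0g => g1 _; rewrite subr_ge0 ltW.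
have sk : (size v < k0)%N by rewrite -sv addnS ltnS leq_addr.
split; first by apply: B; exact: ltnW.
  by move=> a _; have [] := lip_coll_diff a j sk.
move=> w; rewrite (_ : 'D_w _ = fun x => G (size (rcons v w)) x (rcons v w) ord0 j).
  by apply: IH; rewrite size_rcons addSnnS.
by apply/funext => x; have [_ ->] := lip_coll_diff x j sk; rewrite size_rcons.
Qed.

End collection.

(** [lip_bound] hides the integer part of gamma under a quantifier; this identifies it with the one
    fixed in the proof. *)
Lemma nat_gap_unique (ga : R) k l :
  k%:R < ga <= k%:R + 1 -> l%:R < ga <= l%:R + 1 -> k = l.
Proof.
move=> /andP[k1 k2] /andP[l1 l2]; apply/eqP; rewrite eqn_leq.
have := lt_le_trans k1 l2; have := lt_le_trans l1 k2.
by rewrite !natr1 !ltr_nat !ltnS => -> ->.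
Qed.

Lemma lipg_setT (ga : R) k0 n m (g : 'rV[R]_n -> 'rV[R]_m) :
  k0%:R < ga <= k0%:R + 1 -> lipg ga setT g ->
  forall j (U : set 'rV[R]_n), Ck (ga - k0%:R) U k0 (fun x => g x ord0 j).
Proof.
move=> k0g [L [k1 [G [k1g [HG E]]]]] j U; rewrite (nat_gap_unique k0g k1g).
have := @lip_coll_Ck ga n m k1 L G k1g HG k1 [::] j U erefl.
by under eq_fun do rewrite E//.
Qed.

Lemma lipg_setT_lip (ga : R) k0 n m (g : 'rV[R]_n -> 'rV[R]_m) :
  (0 < k0)%N -> k0%:R < ga <= k0%:R + 1 -> lipg ga setT g ->
  lip_on setT g /\ exists2 C : R, 0 <= C & forall x, `|g x| <= C.
Proof.
move=> k00 k0g Hg.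
have al01 : 0 < ga - k0%:R <= 1.
  by case/andP: k0g => g1 g2; rewrite subr_gt0 g1 lerBlDl.
have cT : segment_closed [set: 'rV[R]_n] by [].
have Hj j := lipg_setT k0g Hg j setT.
split.
  apply: lip_on_rV => j; apply: (Ck1_lip cT); exact: (Ck_le al01 cT k00 (Hj j)).
pose C j := projT1 (cid2 (Ck_bounded (Hj j))).
have C0 j : 0 <= C j by rewrite /C; case: cid2.
have HC j x : `|g x ord0 j| <= C j by rewrite /C; case: cid2 => //= c _; exact.
exists (\sum_j C j) => [|x]; first by rewrite sumr_ge0.
by rewrite (le_trans (rV_norm_sum _))// ler_sum.
Qed.

End lip_to_Ck.

(** * Ordinary differential equations *)

Section ode.
Context {R : realType}.

Lemma eq_of_derive_eq (V : normedModType R) (U : set V) (f g : V -> R) a b :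
  segment_closed U -> (forall x, U x -> differentiable f x) ->
  (forall x, U x -> differentiable g x) ->
  (forall x h, U x -> 'D_h f x = 'D_h g x) -> U a -> U b -> f a = g a -> f b = g b.
Proof.
move=> cU df dg H Ua Ub E.
have [|x Ux] := mean_value_segment (f := fun x => f x - g x) cU _ Ua Ub.
  by move=> x Ux; apply: differentiableB; [exact: df|exact: dg].
rewrite deriveB; [|apply: diff_derivable; exact: df|apply: diff_derivable; exact: dg].
by rewrite H// subrr E subrr subr0 => /subr0_eq.
Qed.

Lemma eq_of_derive1_eq (U : set R) (f g h : R -> R) a b :
  segment_closed (U : set R^o) -> (forall t, U t -> is_derive t 1 f (h t)) ->
  (forall t, U t -> is_derive t 1 g (h t)) -> U a -> U b -> f a = g a -> f b = g b.
Proof.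
move=> cU df dg; apply: (@eq_of_derive_eq _ (U : set R^o) f g) => //.
- by move=> x /df[d _]; apply/derivable1_diffP.
- by move=> x /dg[d _]; apply/derivable1_diffP.
move=> x k Ux; have [d dE] := df x Ux; have [d' dE'] := dg x Ux.
have e1 := (derivable1_diffP _ _).1 d; have e2 := (derivable1_diffP _ _).1 d'.
have k1 : k = k *: (1 : R^o) by rewrite /GRing.scale /= mulr1.
by rewrite k1 (derive_scale _ _ e1) (derive_scale _ _ e2) dE dE'.
Qed.

(** The integral from -N has derivative f only to the right of -N. The integrals for different N are
    normalized to vanish at 0, agree where both make sense, and are glued. *)
Lemma antiderivative (f : R -> R) : continuous f ->
  exists F : R -> R, F 0 = 0 /\ forall t : R, is_derive t 1 F (f t).
Proof.
move=> cf.
pose I (N x : R) : R := (\int[@lebesgue_measure R]_(t in [set` `[- N, x]]) (f t))%R.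
have dI (N x : R) : - N < x -> is_derive x 1 (I N) (f x).
  move=> Nx; have [||d] := @continuous_FTC1_closed R f (- N) x (x + 1) _ _ Nx (cf x).
  - by rewrite ltrDl.
  - apply: continuous_compact_integrable; first exact: segment_compact.
    exact: continuous_subspaceT.
  by rewrite derive1E => E; apply: DeriveDef.
pose G (N t : R) := I N t - I N 0.
have dG (N x : R) : - N < x -> is_derive x 1 (G N) (f x).
  move=> Nx; rewrite -[f x]subr0.
  exact: (@is_deriveB _ _ _ (I N) (cst (I N 0)) _ _ _ _ (dI _ _ Nx) (is_derive_cst _ _ _)).
have GG (N M t : R) : 0 < N -> N <= M -> - N < t -> G N t = G M t.
  move=> N0 NM Nt; apply: (@eq_of_derive1_eq [set t | - N < t] _ _ f 0) => //=.
  - move=> a b s /= Na Nb /andP[s0 s1]; rewrite /GRing.scale /=.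
    have : 0 <= s * (b + N) by rewrite mulr_ge0// -(opprK N) subr_ge0 ltW.
    have [->|sn1] := eqVneq s 1; first by move=> _; lra.
    have : 0 < (1 - s) * (a + N).
      by rewrite mulr_gt0//; [rewrite subr_gt0 lt_neqAle sn1|rewrite -(opprK N) subr_gt0].
    by nra.
  - by move=> s /= Ns; apply: dG; rewrite (le_lt_trans _ Ns)// lerN2.
  - by rewrite oppr_lt0.
  - by rewrite /G !subrr.
(* The base point varies with t; near t all these functions coincide with the one for N = |t| +
   2. *)
exists (fun t => G (`|t| + 1) t); split; first by rewrite /G subrr.
move=> t; apply: (@near_eq_is_derive _ _ _ (G (`|t| + 2))); last first.
  by apply: dG; rewrite ltrNl (le_lt_trans (ler_norm _))// normrN ltrDl.
apply/nbhs_ballP; exists 1 => //= s ts.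
apply/esym; apply: GG; first by rewrite ltr_wpDl.
  move: ts; rewrite -ball_normE /= distrC => ts.
  have := ler_distD t s 0; rewrite !subr0; lra.
by rewrite ltrNl (le_lt_trans (ler_norm _))// normrN ltrDl.
Qed.

Lemma antiderivative_rV n (c : R -> 'rV[R]_n) : continuous c ->
  exists C : R -> 'rV[R]_n, C 0 = 0 /\ forall t : R, is_derive t 1 C (c t).
Proof.
move=> cc.
have H j : exists F : R -> R, F 0 = 0 /\ forall t : R, is_derive t 1 F (c t ord0 j).
  apply: antiderivative => t; apply: (@continuous_comp _ _ _ c (fun v => v ord0 j)).
    exact: cc.
  exact: coord_continuous.
pose F j := projT1 (cid (H j)).
have F0 j : F j 0 = 0 by rewrite /F; case: cid => ? [].
have dF j (t : R) : is_derive t 1 (F j) (c t ord0 j) by rewrite /F; case: cid => ? [].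
exists (fun t => \row_j F j t); split; first by apply/rowP => j; rewrite !mxE.
move=> t; apply/(is_derive1_rV _ c) => j.
by under eq_fun do rewrite mxE.
Qed.

Lemma is_derive_continuous (V : normedModType R) (f : R -> V) (t : R) (l : V) :
  is_derive t 1 f l -> {for t, continuous f}.
Proof. by move=> [d _]; apply: differentiable_continuous; apply/derivable1_diffP. Qed.

Lemma growth_scalar (z z' G G' : R -> R) (T : R) :
  (forall t : R, 0 <= t <= T -> is_derive t 1 z (z' t)) ->
  (forall t : R, 0 <= t <= T -> is_derive t 1 G (G' t)) ->
  (forall t : R, 0 <= t <= T -> `|z' t| <= G' t) ->
  forall t : R, 0 <= t <= T -> `|z t - z 0| <= G t - G 0.
Proof.
move=> dz dG H t /andP[t0 tT].
have in0T (s : R) : s \in `[0, t] -> 0 <= s <= T.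
  by rewrite in_itv/= => /andP[-> st]; rewrite (le_trans st).
have main (w w' : R -> R) : (forall t : R, 0 <= t <= T -> is_derive t 1 w (w' t)) ->
  (forall t : R, 0 <= t <= T -> w' t <= G' t) -> w t - w 0 <= G t - G 0.
  move=> dw Hw.
  have dwG (s : R) : 0 <= s <= T -> is_derive s 1 (w - G) (w' s - G' s).
    by move=> sT; apply: is_deriveB; [exact: dw|exact: dG].
  have [||c c0 E] := @MVT_segment R (w - G) (fun s => w' s - G' s) 0 t t0.
  - move=> s sit; apply: dwG; apply: in0T.
    by apply: subset_itv_oo_cc sit.
  - apply: derivable_within_continuous => s sit; have [] // := dwG s (in0T s sit).
  have {E} : w t - G t - (w 0 - G 0) = (w' c - G' c) * (t - 0) by exact: E.
  rewrite subr0 => E.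
  have : (w' c - G' c) * t <= 0.
    by rewrite mulr_le0_ge0// subr_le0 Hw// in0T.
  by rewrite -E; lra.
rewrite ler_norml; apply/andP; split.
  have := main (- z) (fun s => - z' s); rewrite lerNl.
  rewrite (_ : (- z) t - (- z) 0 = - (z t - z 0)); last first.
    by rewrite (_ : (- z) t - (- z) 0 = - z t - - z 0)//; ring.
  apply.
    by move=> s sT; apply: is_deriveN; exact: dz.
  by move=> s sT; rewrite (le_trans (ler_norm _))// normrN H.
by apply: (main z z') => // s sT; rewrite (le_trans (ler_norm _))// H.
Qed.

Lemma is_derive_expRM (a t : R) :
  is_derive t 1 (fun s : R => expR (a * s)) (a * expR (a * t)).
Proof.
have d : is_derive t 1 (fun s : R => a * s) a.
  have := @is_deriveZ R R R id a t 1 1 (is_derive_id _ _).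
  by rewrite [a *: 1]mulr1.
have := @is_derive1_comp R expR (fun s => a * s) t _ _ (is_derive_expR _) d.
by rewrite mulrC.
Qed.

(** The weight exp(2 L t) is chosen so that integrating L K exp(2 L t) returns at most K / 2 times
    the weight: in the weighted supremum norm, integration of an L-Lipschitz right-hand side gains a
    factor 1/2 on any time interval. *)
Lemma growth_step_pos n (z z' : R -> 'rV[R]_n) (L K e T : R) :
  0 < L -> 0 <= K -> 0 <= e ->
  (forall t : R, 0 <= t <= T -> is_derive t 1 z (z' t)) ->
  (forall t : R, 0 <= t <= T -> `|z' t| <= L * K * expR (2 * L * t) + e) ->
  forall t : R, 0 <= t <= T -> `|z t| <= `|z 0| + e * T + K / 2 * expR (2 * L * t).
Proof.
move=> L0 K0 e0 dz H t tT.
have tT' := tT; case/andP: tT' => t0 tT'.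
have E0 : 0 <= K / 2 * expR (2 * L * t) by rewrite mulr_ge0 ?expR_ge0// divr_ge0.
have eT : 0 <= e * T by rewrite mulr_ge0// (le_trans t0).
apply: rV_norm_le => [|j]; first by rewrite !addr_ge0.
have dzj (s : R) : 0 <= s <= T -> is_derive s 1 (fun s => z s ord0 j) (z' s ord0 j).
  by move=> sT; move: j; apply/(is_derive1_rV z z' s); exact: dz.
pose G s := K / 2 * expR (2 * L * s) + e * s.
have dG (s : R) : is_derive s 1 G (L * K * expR (2 * L * s) + e).
  apply: is_deriveD.
    have := @is_deriveZ R R R _ (K / 2) s 1 _ (is_derive_expRM (2 * L) s).
    rewrite (_ : K / 2 *: _ = L * K * expR (2 * L * s))//.
    by rewrite /GRing.scale /=; field.
  have := @is_deriveZ R R R id e s 1 1 (is_derive_id _ _).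
  by rewrite [e *: 1]mulr1.
have := @growth_scalar (fun s => z s ord0 j) (fun s => z' s ord0 j) G _ T dzj
  (fun s _ => dG s) _ t tT.
move=> /(_ (fun s sT => le_trans (mx_norm_coord _ _ _) (H s sT))).
rewrite /G mulr0 expR0 mulr1 mulr0 addr0 => X.
rewrite -[z t ord0 j](subrK (z 0 ord0 j)) (le_trans (ler_normD _ _))//.
have := mx_norm_coord (z 0) ord0 j.
have : e * t <= e * T by rewrite ler_wpM2l.
have : 0 <= K / 2 by rewrite divr_ge0.
by lra.
Qed.

Lemma growth_step n (z z' : R -> 'rV[R]_n) (L K e T : R) :
  0 < L -> 0 <= K -> 0 <= e ->
  (forall t : R, `|t| <= T -> is_derive t 1 z (z' t)) ->
  (forall t : R, `|t| <= T -> `|z' t| <= L * K * expR (2 * L * `|t|) + e) ->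
  forall t : R, `|t| <= T -> `|z t| <= `|z 0| + e * T + K / 2 * expR (2 * L * `|t|).
Proof.
move=> L0 K0 e0 dz H t tT; have [t0|/ltW t0] := leP 0 t.
  rewrite [`|t|]ger0_norm//.
  apply: (@growth_step_pos _ z z' L K e T) => //.
  - by move=> s /andP[s0 sT]; apply: dz; rewrite ger0_norm.
  - by move=> s /andP[s0 sT]; have := H s; rewrite ger0_norm//; exact.
  - by rewrite t0 -[t]ger0_norm.
have dzN (s : R) : 0 <= s <= T -> is_derive s 1 (z \o -%R) (- z' (- s)).
  move=> /andP[s0 sT].
  have sT' : `|- s| <= T by rewrite normrN ger0_norm.
  apply/(is_derive1_rV _ (fun s => - z' (- s))) => j; rewrite mxE.
  have d1 := (is_derive1_rV z z' (- s)).1 (dz _ sT') j.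
  have := @is_derive1_comp R (fun s => z s ord0 j) -%R s _ _ d1 (is_deriveNid _ _).
  by rewrite mulrN mulr1.
have HN (s : R) : 0 <= s <= T -> `|- z' (- s)| <= L * K * expR (2 * L * s) + e.
  by move=> /andP[s0 sT]; have := H (- s); rewrite !normrN ger0_norm//; exact.
have tN : 0 <= - t <= T by rewrite oppr_ge0 t0 -ler0_norm.
by have := growth_step_pos L0 K0 e0 dzN HN tN; rewrite /= opprK oppr0 ler0_norm.
Qed.

(** The maximum over [-T, T] of |z| divided by the weight exp(2 L |t|) is attained at some c.
    [growth_step] bounds it by |z 0| + e T plus half of itself, and the half is absorbed; this is
    the origin of both factors 2. *)
Lemma gronwall n (z z' : R -> 'rV[R]_n) (L e T : R) :
  0 < L -> 0 <= e -> (forall t : R, `|t| <= T -> is_derive t 1 z (z' t)) ->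
  (forall t : R, `|t| <= T -> `|z' t| <= L * `|z t| + e) ->
  forall t : R, `|t| <= T -> `|z t| <= 2 * (`|z 0| + e * T) * expR (2 * L * T).
Proof.
move=> L0 e0 dz H t tT.
have T0 : 0 <= T by rewrite (le_trans _ tT).
pose W s := `|z s| * expR (- (2 * L * `|s|)).
have cW : {within `[- T, T], continuous W}.
  apply: continuous_in_subspaceT => s; rewrite inE /= in_itv /= -ler_norml => sT.
  have c1 : {for s, continuous (fun s => `|z s|)}.
    apply: (@continuous_comp _ _ _ z Num.norm); last exact: norm_continuous.
    exact: is_derive_continuous (dz s sT).
  have c2 : {for s, continuous (fun s => expR (- (2 * L * `|s|)))}.
    apply: (@continuous_comp _ _ _ (fun s => - (2 * L * `|s|)) expR); last exact: continuous_expR.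
    apply: cvgN; apply: cvgM; first exact: cvg_cst.
    exact: norm_continuous.
  exact: cvgM c1 c2.
have [|c] := @EVT_max R W (- T) T _ cW; first by lra.
rewrite in_itv /= -ler_norml => cT cmax.
have W0 s : 0 <= W s by rewrite /W mulr_ge0// expR_ge0.
have zW s : `|s| <= T -> `|z s| <= W c * expR (2 * L * `|s|).
  move=> sT; have := cmax s; rewrite in_itv /= -ler_norml => /(_ sT).
  by rewrite /W -ler_pdivlMr ?expR_gt0// -expRN opprK.
have := @growth_step n z z' L (W c) e T L0 (W0 c) e0 dz _ c cT.
have E : forall s, `|s| <= T -> `|z' s| <= L * W c * expR (2 * L * `|s|) + e.
  move=> s sT; rewrite (le_trans (H s sT))// lerD2r -mulrA ler_wpM2l ?(ltW L0)//.
  exact: zW.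
move=> /(_ E) Ec.
have Wc : W c <= 2 * (`|z 0| + e * T).
  have X : W c <= (`|z 0| + e * T) * expR (- (2 * L * `|c|)) + W c / 2.
    have EX : expR (2 * L * `|c|) * expR (- (2 * L * `|c|)) = 1.
      by rewrite -expRD subrr expR0.
    have := ler_wpM2r (expR_ge0 (- (2 * L * `|c|))) Ec.
    by rewrite [in leRHS]mulrDl -[W c / 2 * _ * _]mulrA EX mulr1.
  have : (`|z 0| + e * T) * expR (- (2 * L * `|c|)) <= `|z 0| + e * T.
    rewrite ler_piMr ?addr_ge0 ?mulr_ge0// -[leRHS]expR0 ler_expR oppr_le0.
    by rewrite !mulr_ge0// ltW.
  lra.
rewrite (le_trans (zW t tT))//; apply: ler_pM; rewrite ?expR_ge0//.
by rewrite ler_expR ler_wpM2l// mulr_ge0// ltW.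
Qed.

End ode.

(** * Global solutions by Picard iteration *)

Section picard.
Context {R : realType}.

Lemma half_pow_small (C e : R) : 0 < e -> exists k, C / 2 ^+ k < e.
Proof.
move=> e0; have [C0|C0] := leP C 0.
  by exists 0%N; rewrite expr0 divr1 (le_lt_trans C0).
exists (Num.bound (C / e)).
have X : C / e < (Num.bound (C / e))%:R by apply: archi_boundP; rewrite divr_ge0 ?ltW.
rewrite ltr_pdivrMr ?exprn_gt0// mulrC -ltr_pdivrMr// (lt_trans X)//.
by rewrite -natrX ltr_nat ltn_expl.
Qed.

Lemma le_half_pow0 (x C : R) : (forall k, x <= C / 2 ^+ k) -> x <= 0.
Proof.
move=> H; apply/ler_addgt0Pr => e e0; rewrite add0r.
by have [k Hk] := half_pow_small C e0; rewrite (le_trans (H k))// ltW.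
Qed.

Definition rV_lim n (u : nat -> 'rV[R]_n) : 'rV[R]_n :=
  \row_j lim (u k ord0 j @[k --> \oo]).

Lemma geometric_limit n (u : nat -> 'rV[R]_n) (C : R) :
  (forall k, `|u k.+1 - u k| <= C / 2 ^+ k) ->
  forall k, `|u k - rV_lim u| <= 2 * C / 2 ^+ k.
Proof.
move=> H.
have p2 k : 0 < 2 ^+ k :> R by rewrite exprn_gt0.
have C0 : 0 <= C by have := le_trans (normr_ge0 _) (H 0%N); rewrite expr0 divr1.
have Hkm k m : `|u (k + m)%N - u k| <= 2 * C / 2 ^+ k - 2 * C / 2 ^+ (k + m).
  elim: m => [|m IH]; first by rewrite addn0 !subrr normr0.
  rewrite addnS (le_trans (ler_distD (u (k + m)%N) _ _))//.
  rewrite (le_trans (lerD (H _) IH))// exprS invfM.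
  set a := (2 ^+ (k + m))^-1; rewrite (_ : 2 * C * (2^-1 * a) = C * a); last by field.
  by lra.
have Hkl k l : (k <= l)%N -> `|u l - u k| <= 2 * C / 2 ^+ k.
  move=> /subnKC <-; rewrite (le_trans (Hkm _ _))// lerBlDr lerDl.
  by rewrite divr_ge0 ?mulr_ge0// ltW.
have cj j : cvg (u k ord0 j @[k --> \oo]).
  apply/cauchy_cvgP; apply: cauchy_exP => e e0.
  have [k Hk] := half_pow_small (2 * C) e0.
  exists (u k ord0 j); exists k => //= l kl; rewrite -ball_normE /= distrC.
  rewrite (le_lt_trans _ Hk)// (le_trans _ (Hkl k l kl))//.
  by have := mx_norm_coord (u l - u k) ord0 j; rewrite !mxE.
move=> k; apply: rV_norm_le => [|j].
  by rewrite divr_ge0 ?mulr_ge0// ltW.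
rewrite !mxE; apply/ler_addgt0Pr => e e0.
have /cvgrPdist_lt/(_ e e0)[N _ HN] := cj j.
have := HN (maxn N k) (leq_maxl _ _); have := Hkl k (maxn N k) (leq_maxr _ _).
have := mx_norm_coord (u (maxn N k) - u k) ord0 j; rewrite !mxE /=.
set a := u (maxn N k) ord0 j; set l := lim _ => h1 h2 h3.
rewrite (_ : _ - _ = - (a - u k ord0 j) - (l - a)); last by ring.
by rewrite (le_trans (ler_normB _ _))// normrN lerD//; [exact: le_trans h1 h2|exact: ltW].
Qed.

Section iteration.
Context (n : nat) (F : R -> 'rV[R]_n -> 'rV[R]_n) (x0 : 'rV[R]_n).
(** Continuity is stated along curves: this is what integration uses, and what can be verified for a
    differential taken along a flow line. *)
Hypothesis cF : forall c : R -> 'rV[R]_n, continuous c -> continuous (fun t => F t (c t)).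
Hypothesis lF : forall T : R, exists2 L : R, 0 < L &
  forall t x y, `|t| <= T -> `|F t x - F t y| <= L * `|x - y|.

(** The iterates live in a subset type because each integration consumes the continuity of the
    previous curve. *)
Lemma picard_step (c : {c : R -> 'rV[R]_n | continuous c}) :
  {v : {c : R -> 'rV[R]_n | continuous c} |
    sval v 0 = x0 /\ forall t : R, is_derive t 1 (sval v) (F t (sval c t))}.
Proof.
have [C [C0 dC]] := cid (antiderivative_rV (cF (svalP c))).
have dv (t : R) : is_derive t 1 (fun t => x0 + C t) (F t (sval c t)).
  rewrite -[F _ _]add0r.
  exact: (@is_deriveD _ _ _ (cst x0) C _ _ _ _ (is_derive_cst _ _ _) (dC t)).
have cv : continuous (fun t => x0 + C t) by move=> t; exact: is_derive_continuous (dv t).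
by exists (exist _ _ cv); split => //=; rewrite C0 addr0.
Qed.

Let P c := sval (picard_step c).
Let P0 c : sval (P c) 0 = x0. Proof. by rewrite /P; case: picard_step => ? []. Qed.
Let dP c (t : R) : is_derive t 1 (sval (P c)) (F t (sval c t)).
Proof. by rewrite /P; case: picard_step => ? []. Qed.

Let c0 : {c : R -> 'rV[R]_n | continuous c}.
Proof. by exists (cst x0); exact: cst_continuous. Defined.

Let u k := iter k P c0.
Let u0 k : sval (u k) 0 = x0. Proof. by case: k => [|k] //=; exact: P0. Qed.

(** In the weighted norm the iteration halves distances on [-T, T] whatever T, so one and the same
    sequence converges on the whole line and no local solutions have to be glued. *)
Lemma picard_diff_bound (T : R) : exists2 C : R, 0 <= C &
  forall t, `|t| <= T -> forall k, `|sval (u k.+1) t - sval (u k) t| <= C / 2 ^+ k.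
Proof.
have [T0|T0] := leP 0 T; last first.
  by exists 0 => // t tT; have := le_lt_trans tT T0; rewrite ltNge normr_ge0.
have [L L0 HL] := lF T.
have [||c] := @EVT_max R (fun t => `|sval (u 1) t - sval (u 0) t|) (- T) T _ _.
- by lra.
- apply: continuous_subspaceT => t.
  apply: (@continuous_comp _ _ _ (fun t => sval (u 1) t - sval (u 0) t) Num.norm);
    last exact: norm_continuous.
  by apply: cvgB; [exact: (svalP (u 1))|exact: (svalP (u 0))].
rewrite in_itv /= -ler_norml => cT cmax.
set K := `|_| in cmax.
have Kge0 : 0 <= K by exact: normr_ge0.
have Hk k t : `|t| <= T ->
    `|sval (u k.+1) t - sval (u k) t| <= K / 2 ^+ k * expR (2 * L * `|t|).
  elim: k t => [|k IH] t tT.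
    rewrite expr0 divr1 (le_trans (cmax t _))//; first by rewrite in_itv /= -ler_norml.
    have : expR 0 <= expR (2 * L * `|t|) by rewrite ler_expR !mulr_ge0// ltW.
    by rewrite expR0 => E1; apply: ler_peMr.
  have K0 : 0 <= K / 2 ^+ k by rewrite divr_ge0// exprn_ge0.
  have D1 (s : R) : `|s| <= T -> is_derive s 1 (fun t => sval (u k.+2) t - sval (u k.+1) t)
      (F s (sval (u k.+1) s) - F s (sval (u k) s)).
    by move=> _; apply: is_deriveB; exact: dP.
  have D2 (s : R) : `|s| <= T -> `|F s (sval (u k.+1) s) - F s (sval (u k) s)| <=
      L * (K / 2 ^+ k) * expR (2 * L * `|s|) + 0.
    move=> sT; rewrite addr0 -mulrA (le_trans (HL _ _ _ sT))//.
    by rewrite ler_wpM2l ?(ltW L0)// IH.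
  have := growth_step L0 K0 (lexx _) D1 D2 tT.
  by rewrite !u0 subrr normr0 mul0r !add0r exprSr invfM mulrA.
exists (K * expR (2 * L * T)) => [|t tT k]; first by rewrite mulr_ge0 ?expR_ge0.
rewrite (le_trans (Hk k t tT))// mulrAC ler_wpM2r ?invr_ge0 ?exprn_ge0//.
by rewrite ler_wpM2l// ler_expR ler_wpM2l// mulr_ge0// ltW.
Qed.

Let c t := rV_lim (fun k => sval (u k) t).

Lemma picard_limit_bound (T : R) : exists2 C : R, 0 <= C &
  forall t, `|t| <= T -> forall k, `|sval (u k) t - c t| <= C / 2 ^+ k.
Proof.
have [C C0 HC] := picard_diff_bound T.
exists (2 * C); first by rewrite mulr_ge0.
by move=> t tT; apply: geometric_limit; exact: HC.
Qed.

Lemma picard_limit_continuous : continuous c.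
Proof.
move=> t; have [C C0 HC] := picard_limit_bound (`|t| + 1).
apply/cvgrPdist_lt => e e0.
have e3 : 0 < e / 3 by rewrite divr_gt0.
have [k Hk] := half_pow_small C e3.
have tT : `|t| <= `|t| + 1 by rewrite lerDl.
have /cvgrPdist_lt/(_ _ e3) H := svalP (u k) t.
near=> s.
have sT : `|s| <= `|t| + 1.
  have : `|t - s| < 1 by near: s; exact: (@cvgr_dist_lt _ _ _ _ _ id).
  have := ler_normB t (t - s); rewrite opprB addrCA subrr addr0; lra.
have h1 := le_lt_trans (HC t tT k) Hk; have h2 := le_lt_trans (HC s sT k) Hk.
have h3 : `|sval (u k) t - sval (u k) s| < e / 3 by near: s.
rewrite (_ : c t - c s = - (sval (u k) t - c t) + (sval (u k) t - sval (u k) s) +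
  (sval (u k) s - c s)); last first.
  by apply/rowP => j; rewrite !mxE; ring.
rewrite (le_lt_trans (ler_normD _ _))//.
have := ler_normD (- (sval (u k) t - c t)) (sval (u k) t - sval (u k) s).
rewrite normrN; lra.
Unshelve. all: by end_near. Qed.

(** To see that the limit c is a fixed point, its image v is compared with the iterate of rank k +
    1, which is the image of the iterate of rank k: their derivatives differ by O(2^-k), and so do v
    and c. *)
Theorem picard_exists :
  exists c : R -> 'rV[R]_n, c 0 = x0 /\ forall t : R, is_derive t 1 c (F t (c t)).
Proof.
pose v := P (exist _ c picard_limit_continuous).
exists c; suff E : c = sval v.
  by split; [rewrite E P0|move=> t; rewrite {1}E; exact: dP].
apply/funext => t; apply/eqP; rewrite -subr_eq0 -normr_le0.
have [L L0 HL] := lF `|t|; have [C C0 HC] := picard_limit_bound `|t|.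
apply: (@le_half_pow0 _ (L * C * `|t| + C)) => k.
have eL : 0 <= L * (C / 2 ^+ k) by rewrite mulr_ge0 ?divr_ge0 ?exprn_ge0// ltW.
have D1 (s : R) : `|s| <= `|t| -> is_derive s 1 (fun t => sval v t - sval (u k.+1) t)
    (F s (c s) - F s (sval (u k) s)).
  by move=> _; apply: is_deriveB; exact: dP.
have D2 (s : R) : `|s| <= `|t| -> `|F s (c s) - F s (sval (u k) s)| <=
    L * 0 * expR (2 * L * `|s|) + L * (C / 2 ^+ k).
  move=> sT; rewrite mulr0 mul0r add0r (le_trans (HL _ _ _ sT))// ler_wpM2l ?(ltW L0)//.
  by rewrite distrC HC.
have X := growth_step L0 (lexx _) eL D1 D2 (lexx _).
rewrite u0 P0 subrr normr0 mul0r mul0r addr0 add0r in X.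
have Y := HC t (lexx _) k.+1.
rewrite (_ : c t - _ = - (sval v t - sval (u k.+1) t) - (sval (u k.+1) t - c t)); last first.
  by apply/rowP => j; rewrite !mxE; ring.
rewrite (le_trans (ler_normB _ _))// normrN (le_trans (lerD X Y))//.
rewrite mulrDl lerD//; first by rewrite le_eqVlt; apply/orP; left; apply/eqP; ring.
by rewrite ler_wpM2l// lef_pV2 ?posrE ?exprn_gt0// ler_weXn2l// ler1n.
Qed.

End iteration.
End picard.

(** * Maps of class C^{k,al} on every ball *)

Section global_class.
Context {R : realType} (al : R).
Hypothesis al01 : 0 < al <= 1.

(** The constants hidden in [Ck] may grow with the radius r, so that linear maps and flows belong to
    the class. *)
Definition Cg k n m (F : 'rV[R]_n -> 'rV[R]_m) : Prop :=
  forall r j, Ck al (ball 0 r) k (fun x => F x ord0 j).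

Lemma ball0E n (r : R) (x : 'rV[R]_n) : ball 0 r x <-> `|x| < r.
Proof. by rewrite -ball_normE /= sub0r normrN. Qed.

Lemma ball_bounded n (c : 'rV[R]_n) (r : R) : bounded_set (ball c r).
Proof.
exists (`|c| + r); split; first exact: num_real.
move=> M rM x; rewrite -ball_normE /= => xr.
have := ler_normB c (c - x); rewrite opprB addrCA subrr addr0; lra.
Qed.

Lemma Cg_le k l n m (F : 'rV[R]_n -> 'rV[R]_m) : (l <= k)%N -> Cg k F -> Cg l F.
Proof.
by move=> lk HF r j; apply: (Ck_le al01 _ lk (HF r j)); exact: segment_closed_ball.
Qed.

Lemma Cg_bounded k n m (F : 'rV[R]_n -> 'rV[R]_m) r : Cg k F ->
  exists2 C : R, 0 <= C & forall x, ball 0 r x -> `|F x| <= C.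
Proof.
move=> HF; pose C j := projT1 (cid2 (Ck_bounded (HF r j))).
have C0 j : 0 <= C j by rewrite /C; case: cid2.
have HC j x : ball 0 r x -> `|F x ord0 j| <= C j.
  by rewrite /C; case: cid2 => //= c _; exact.
exists (\sum_j C j) => [|x Bx]; first by rewrite sumr_ge0.
by rewrite (le_trans (rV_norm_sum _))// ler_sum// => j _; exact: HC.
Qed.

Lemma Cg_lip k n m (F : 'rV[R]_n -> 'rV[R]_m) r : (0 < k)%N -> Cg k F ->
  lip_on (ball 0 r) F.
Proof.
move=> k0 HF; apply: lip_on_rV => j; apply: Ck1_lip; first exact: segment_closed_ball.
exact: (Cg_le k0 HF).
Qed.

Lemma Cg_differentiable k n m (F : 'rV[R]_n -> 'rV[R]_m) x : (0 < k)%N -> Cg k F ->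
  differentiable F x.
Proof.
move=> k0 HF; apply: differentiable_rV => j.
have [_ + _] := Cg_le k0 HF (`|x| + 1) j; apply.
by apply/ball0E; rewrite ltrDl.
Qed.

Lemma Cg_comp k n m p (F : 'rV[R]_n -> 'rV[R]_m) (G : 'rV[R]_m -> 'rV[R]_p) :
  (0 < k)%N -> Cg k F -> Cg k G -> Cg k (G \o F).
Proof.
move=> k0 HF HG r j; have [C C0 HC] := Cg_bounded r HF.
apply: (@Ck_comp _ _ al01 _ _ (@ball_open _ 'rV[R]_n 0 r) (@segment_closed_ball R 'rV[R]_n 0 r) k _
  (ball 0 (C + 1)) (fun y => G y ord0 j) F).
- exact: Cg_lip HF.
- by move=> x Bx; apply/ball0E; rewrite (le_lt_trans (HC x Bx))// ltrDl.
- exact: HF.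
- exact: HG.
Qed.

Lemma Cg_linear k n m (F : 'rV[R]_n -> 'rV[R]_m) (A : 'M[R]_(n, m)) b :
  (forall x, F x = x *m A + b) -> Cg k F.
Proof.
move=> FE r j.
have -> : (fun x => F x ord0 j) =
    (fun x => \sum_i cst (A i j) x * x ord0 i + cst (b ord0 j) x).
  apply/funext => x; rewrite FE !mxE; congr (_ + _).
  by apply: eq_bigr => i _; rewrite mulrC.
have oB := @ball_open _ 'rV[R]_n 0 r; have cB := @segment_closed_ball R 'rV[R]_n 0 r.
apply: CkD => //; last exact: Ck_cst.
apply: Ck_sum => // i _; apply: CkM => //; first exact: Ck_cst.
by apply: Ck_coord => //; exact: ball_bounded.
Qed.

Lemma Cg_id k n : Cg k (@id 'rV[R]_n).
Proof. by apply: (@Cg_linear _ _ _ _ 1%:M 0) => x; rewrite mulmx1 addr0. Qed.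

Lemma Cg_lsubmx k n1 n2 : Cg k (@lsubmx R 1 n1 n2).
Proof.
apply: (@Cg_linear _ _ _ _ (lsubmx 1%:M) 0) => x.
by rewrite addr0 mulmx_lsub mulmx1.
Qed.

Lemma Cg_rsubmx k n1 n2 : Cg k (@rsubmx R 1 n1 n2).
Proof.
apply: (@Cg_linear _ _ _ _ (rsubmx 1%:M) 0) => x.
by rewrite addr0 mulmx_rsub mulmx1.
Qed.

Lemma Cg_row_mx k n m1 m2 (F : 'rV[R]_n -> 'rV[R]_m1) (G : 'rV[R]_n -> 'rV[R]_m2) :
  Cg k F -> Cg k G -> Cg k (fun x => row_mx (F x) (G x)).
Proof.
move=> HF HG r j; case: (splitP j) => i ji.
  rewrite (_ : (fun _ => _) = (fun x => F x ord0 i)); first exact: HF.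
  by apply/funext => x; rewrite (_ : j = lshift m2 i) ?row_mxEl//; exact: val_inj.
rewrite (_ : (fun _ => _) = (fun x => G x ord0 i)); first exact: HG.
by apply/funext => x; rewrite (_ : j = rshift m1 i) ?row_mxEr//; exact: val_inj.
Qed.

Lemma diff_coord_basis n m (F : 'rV[R]_n -> 'rV[R]_m) x w j : differentiable F x ->
  'd F x w ord0 j = \sum_i w ord0 i * 'D_(delta_mx ord0 i) (fun x => F x ord0 j) x.
Proof.
move=> dF; have dFj := differentiable_rV_coord j dF.
by rewrite diff_rV_coord// -deriveE// derive_rV_basis.
Qed.

(** dF(x)(w) is the sum of the products w_i D_i F(x): linear in w, one degree less regular in x,
    hence jointly of class k over each ball. This is the second component of the tangent field. *)
Lemma Cg_diff k n m (F : 'rV[R]_n -> 'rV[R]_m) : (0 < k)%N -> Cg k.+1 F ->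
  Cg k (fun z : 'rV[R]_(n + n) => 'd F (lsubmx z) (rsubmx z)).
Proof.
move=> k0 HF r j.
have -> : (fun z : 'rV[R]_(n + n) => 'd F (lsubmx z) (rsubmx z) ord0 j) =
  (fun z => \sum_i rsubmx z ord0 i *
    ((fun y => 'D_(delta_mx ord0 i) (fun x => F x ord0 j) y) \o lsubmx) z).
  apply/funext => z.
  have dF := Cg_differentiable (lsubmx z) (ltn0Sn _) HF.
  exact: diff_coord_basis.
have oB := @ball_open _ 'rV[R]_(n + n) 0 r; have cB := @segment_closed_ball R 'rV[R]_(n + n) 0 r.
apply: Ck_sum => // i _; apply: CkM => //; first exact: Cg_rsubmx.
have [C C0 HC] := Cg_bounded r (@Cg_lsubmx 1 n n).
apply: (@Ck_comp _ _ al01 _ _ oB cB k _ (ball 0 (C + 1)) _ lsubmx).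
- exact: (Cg_lip _ (ltn0Sn 0) (@Cg_lsubmx 1 n n)).
- by move=> x Bx; apply/ball0E; rewrite (le_lt_trans (HC x Bx))// ltrDl.
- exact: Cg_lsubmx.
- exact: Ck_derive (HF _ _).
Qed.

Lemma diff_bound k n m (F : 'rV[R]_n -> 'rV[R]_m) r : (0 < k)%N -> Cg k F ->
  exists2 C : R, 0 <= C & forall x w, ball 0 r x -> `|'d F x w| <= C * `|w|.
Proof.
move=> k0 HF; pose C j i := projT1 (cid2 (Ck_bounded
  (Ck_derive (delta_mx ord0 i) (Cg_le k0 HF r j)))).
have C0 j i : 0 <= C j i by rewrite /C; case: cid2.
have HC j i x : ball 0 r x -> `|'D_(delta_mx ord0 i) (fun x => F x ord0 j) x| <= C j i.
  by rewrite /C; case: cid2 => //= c _; exact.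
exists (\sum_j \sum_i C j i) => [|x w Bx].
  by rewrite sumr_ge0// => j _; rewrite sumr_ge0.
rewrite (le_trans (rV_norm_sum _))// mulr_suml ler_sum// => j _.
rewrite (diff_coord_basis _ _ (Cg_differentiable x k0 HF)).
rewrite (le_trans (ler_norm_sum _ _ _))// mulr_suml ler_sum// => i _.
rewrite normrM mulrC ler_pM//; [exact: HC|exact: mx_norm_coord].
Qed.

(** The exponent b is free because two values occur: al for fields of class C^{1,al}, and 1 for
    fields of higher order, whose differential is locally Lipschitz. *)
Lemma diff_hoelder (b : R) n m (F : 'rV[R]_n -> 'rV[R]_m) r : Cg 1 F ->
  (forall i j, exists2 C, 0 <= C & forall x y, ball 0 r x -> ball 0 r y ->
    `|'D_(delta_mx ord0 i) (fun x => F x ord0 j) x -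
      'D_(delta_mx ord0 i) (fun x => F x ord0 j) y| <= C * `|x - y| `^ b) ->
  exists2 C : R, 0 <= C & forall x y w, ball 0 r x -> ball 0 r y ->
    `|'d F x w - 'd F y w| <= C * `|x - y| `^ b * `|w|.
Proof.
move=> HF H; pose C j i := projT1 (cid2 (H i j)).
have C0 j i : 0 <= C j i by rewrite /C; case: cid2.
have HC j i x y : ball 0 r x -> ball 0 r y ->
    `|'D_(delta_mx ord0 i) (fun x => F x ord0 j) x -
      'D_(delta_mx ord0 i) (fun x => F x ord0 j) y| <= C j i * `|x - y| `^ b.
  by rewrite /C; case: cid2 => //= c _ X; exact: X.
exists (\sum_j \sum_i C j i) => [|x y w Bx By].
  by rewrite sumr_ge0// => j _; rewrite sumr_ge0.
rewrite (le_trans (rV_norm_sum _))// !mulr_suml ler_sum// => j _.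
have dF z := Cg_differentiable z (ltn0Sn 0) HF.
have -> : ('d F x w - 'd F y w) ord0 j = 'd F x w ord0 j - 'd F y w ord0 j by rewrite !mxE.
have E : _ - _ = _ - _ := congr2 (fun a b : R => a - b)
  (diff_coord_basis w j (dF x)) (diff_coord_basis w j (dF y)).
rewrite E -sumrB (le_trans (ler_norm_sum _ _ _))// !mulr_suml ler_sum// => i _.
rewrite -mulrBr normrM mulrC ler_pM//; [exact: HC|exact: mx_norm_coord].
Qed.

Lemma Cg1_taylor n m (F : 'rV[R]_n -> 'rV[R]_m) r : Cg 1 F ->
  exists2 C : R, 0 <= C & forall x y, ball 0 r x -> ball 0 r y ->
    `|F x - F y - 'd F y (x - y)| <= C * `|x - y| `^ (1 + al).
Proof.
move=> HF.
have oB := @ball_open _ 'rV[R]_n 0 r; have cB := @segment_closed_ball R 'rV[R]_n 0 r.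
pose C j := projT1 (cid2 (taylor_bound al01 oB cB (HF r j))).
have C0 j : 0 <= C j by rewrite /C; case: cid2.
have HC j x y : ball 0 r x -> ball 0 r y ->
    `|taylor_rem 1 x y (fun x => F x ord0 j)| <= C j * `|x - y| `^ (1 + al).
  by rewrite /C; case: cid2 => //= c _ X; exact: X.
exists (\sum_j C j) => [|x y Bx By]; first by rewrite sumr_ge0.
rewrite (le_trans (rV_norm_sum _))// mulr_suml ler_sum// => j _.
have := HC j x y Bx By; rewrite /taylor_rem big_nat_recr//= big_nat1 /=.
rewrite DseqS !Dseq0 !invr1 !mul1r !mxE opprD addrA.
have dF := Cg_differentiable y (ltn0Sn 0) HF.
have dFj := differentiable_rV_coord j dF.
by rewrite diff_rV_coord// -deriveE.
Qed.

End global_class.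

(** * Regularity of flows *)

Section flows.
Context {R : realType}.

Lemma subr_split (V : zmodType) (a b d e : V) : e = a - b -> a - d = e + (b - d).
Proof. by move=> ->; rewrite addrA subrK. Qed.

Lemma subr_insert_sub (V : zmodType) (a b d e : V) : e = a - b -> d - b = e + (d - a).
Proof. by move=> ->; rewrite [RHS]addrC addrA subrK. Qed.

Lemma curve_bounded n (c : R -> 'rV[R]_n) (T : R) : continuous c ->
  exists2 r, 0 < r & forall t, `|t| <= T -> ball 0 r (c t).
Proof.
move=> cc; have [T0|T0] := leP 0 T; last first.
  by exists 1 => // t tT; have := le_lt_trans tT T0; rewrite ltNge normr_ge0.
have [||s] := @EVT_max R (fun t => `|c t|) (- T) T.
- by lra.
- apply: continuous_subspaceT => t.
  apply: (@continuous_comp _ _ _ c Num.norm); [exact: cc|exact: norm_continuous].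
rewrite in_itv /= -ler_norml => sT smax.
exists (`|c s| + 1) => [|t tT]; first by rewrite ltr_wpDl.
by apply/ball0E; rewrite (le_lt_trans (smax t _)) ?ltrDl// in_itv /= -ler_norml.
Qed.

Definition loc_lip n (F : R -> 'rV[R]_n -> 'rV[R]_n) := forall T r : R,
  exists2 C : R, 0 <= C & forall t x y, `|t| <= T -> ball 0 r x -> ball 0 r y ->
    `|F t x - F t y| <= C * `|x - y|.

Lemma ode_unique n (F : R -> 'rV[R]_n -> 'rV[R]_n) (c c' : R -> 'rV[R]_n) :
  loc_lip F -> (forall t : R, is_derive t 1 c (F t (c t))) ->
  (forall t : R, is_derive t 1 c' (F t (c' t))) -> c 0 = c' 0 -> forall t, c t = c' t.
Proof.
move=> lF dc dc' E t.
have cc : continuous c by move=> s; exact: is_derive_continuous (dc s).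
have cc' : continuous c' by move=> s; exact: is_derive_continuous (dc' s).
have [r r0 Hr] := curve_bounded `|t| cc; have [r' r'0 Hr'] := curve_bounded `|t| cc'.
have [C C0 HC] := lF `|t| (Num.max r r').
have D1 (s : R) : `|s| <= `|t| -> is_derive s 1 (fun s => c s - c' s) (F s (c s) - F s (c' s)).
  by move=> _; exact: is_deriveB.
have D2 (s : R) : `|s| <= `|t| -> `|F s (c s) - F s (c' s)| <= (C + 1) * `|c s - c' s| + 0.
  move=> st; rewrite addr0 (le_trans (HC s _ _ st _ _))//.
  - by apply/ball0E; rewrite lt_max; apply/orP; left; apply/ball0E/Hr.
  - by apply/ball0E; rewrite lt_max; apply/orP; right; apply/ball0E/Hr'.
  - by rewrite ler_wpM2r// lerDl.
have C1 : 0 < C + 1 by rewrite ltr_wpDl.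
have := gronwall C1 (lexx _) D1 D2 (lexx _).
rewrite E subrr normr0 mul0r addr0 mulr0 mul0r normr_le0 => /eqP.
by move=> /subr0_eq.
Qed.

(** * The variational equation along a flow *)

Section tangent.
Context (al : R) (n : nat) (X : 'rV[R]_n -> 'rV[R]_n) (phi : R -> 'rV[R]_n -> 'rV[R]_n).
Hypotheses (al01 : 0 < al <= 1) (HX : Cg al 1 X) (Hphi : is_flow X phi).

(** This is kept as a hypothesis on the flow because the results are also applied to tangent fields
    and to fields with time as a coordinate, which need not be globally Lipschitz; for those it is
    verified directly. *)
Definition flow_lip := forall T r : R, exists2 C : R, 0 <= C &
  forall t x y, `|t| <= T -> ball 0 r x -> ball 0 r y ->
    `|phi t x| <= C /\ `|phi t x - phi t y| <= C * `|x - y|.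

Hypothesis lphi : flow_lip.

Lemma flow_continuous x : continuous (phi^~ x).
Proof. by move=> t; have [_ H] := Hphi x; exact: is_derive_continuous (H t). Qed.

Lemma hoelder_continuous m (U : set 'rV[R]_m) (f : 'rV[R]_m -> R) x :
  open U -> U x -> hoelder al U f -> {for x, continuous f}.
Proof.
move=> oU Ux [C C0 [_ HC]]; apply: continuous_of_dist => e e0.
have [q q0 Hq] : exists2 q, 0 < q & forall z, 0 <= z -> z < q -> z `^ al <= e / (C + 1).
  by apply: powR_small; [case/andP: al01|rewrite divr_gt0// ltr_wpDl].
have /nbhs_ballP[r /= r0 rU] := open_nbhs_nbhs (conj oU Ux).
exists (Num.min q r) => [|y]; first by rewrite lt_min q0.
rewrite lt_min => /andP[yq yr].
have Uy : U y by apply: rU; rewrite -ball_normE.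
rewrite (le_trans (HC _ _ Ux Uy))//.
apply: (@le_trans _ _ (C * (e / (C + 1)))); first by rewrite ler_wpM2l// Hq.
by apply: mul_divr_succ_le => //; exact: ltW.
Qed.

Lemma diff_along_flow_continuous x (c : R -> 'rV[R]_n) : continuous c ->
  continuous (fun t => 'd X (phi t x) (c t)).
Proof.
move=> cc t.
suff H j : {for t, continuous (fun t => \sum_i c t ord0 i *
    'D_(delta_mx ord0 i) (fun x => X x ord0 j) (phi t x))}.
  have -> : (fun t => 'd X (phi t x) (c t)) = (fun t => \row_j \sum_i c t ord0 i *
    'D_(delta_mx ord0 i) (fun x => X x ord0 j) (phi t x)).
    apply/funext => s; apply/rowP => j; rewrite mxE.
    by apply: diff_coord_basis; exact: Cg_differentiable (ltn0Sn 0) HX.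
  apply/cvgrPdist_lt => e e0; near=> s; apply: rV_norm_lt => // j; rewrite !mxE.
  move: j; near: s; apply: filter_forall => j.
  by have /cvgrPdist_lt/(_ e e0) := H j.
have -> : (fun t => \sum_i c t ord0 i *
    'D_(delta_mx ord0 i) (fun x => X x ord0 j) (phi t x)) =
  \sum_i (fun t => c t ord0 i * 'D_(delta_mx ord0 i) (fun x => X x ord0 j) (phi t x)).
  by apply/funext => s; rewrite fct_sumE.
elim/big_ind : _ => [|f g Hf Hg|i _].
- exact: cst_continuous.
- exact: cvgD Hf Hg.
apply: cvgM.
  apply: (@continuous_comp _ _ _ c (fun v => v ord0 i)); first exact: cc.
  exact: coord_continuous.
apply: (@continuous_comp _ _ _ (phi^~ x)
  ('D_(delta_mx ord0 i) (fun x => X x ord0 j))); first exact: flow_continuous.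
apply: (@hoelder_continuous _ (ball 0 (`|phi t x| + 1))).
- exact: ball_open.
- by apply/ball0E; rewrite ltrDl.
- exact: (Ck_derive (delta_mx ord0 i) (HX (`|phi t x| + 1) j)).
Unshelve. all: by end_near. Qed.

Lemma diff_along_flow_bound (T r : R) : exists2 C : R, 0 <= C &
  forall t x w, `|t| <= T -> ball 0 r x -> `|'d X (phi t x) w| <= C * `|w|.
Proof.
have [B B0 HB] := lphi T r.
have [C C0 HC] := diff_bound al01 (B + 1) (ltn0Sn 0) HX.
exists C => // t x w tT xr; apply: HC.
by have [h _] := HB t x x tT xr xr; apply/ball0E; rewrite (le_lt_trans h)// ltrDl.
Qed.

Lemma diff_along_flow_lip x : loc_lip (fun t w => 'd X (phi t x) w).
Proof.
move=> T r; have [C C0 HC] := diff_along_flow_bound T (`|x| + 1).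
exists C => // t u v tT _ _; rewrite -linearB; apply: HC => //.
by apply/ball0E; rewrite ltrDl.
Qed.

(** The equation c' = dX(phi t x) c is linear in c with coefficients continuous in t, so Picard
    iteration applies even when dX is only Hoelder. *)
Lemma tangent_exists x v : exists c : R -> 'rV[R]_n,
  c 0 = v /\ forall t : R, is_derive t 1 c ('d X (phi t x) (c t)).
Proof.
apply: (@picard_exists R n (fun t w => 'd X (phi t x) w) v).
  by move=> c; exact: diff_along_flow_continuous.
move=> T; have [C C0 HC] := diff_along_flow_bound T (`|x| + 1).
exists (C + 1) => [|t u w tT]; first by rewrite ltr_wpDl.
rewrite -linearB (le_trans (HC t x _ tT _))//; first by apply/ball0E; rewrite ltrDl.
by rewrite ler_wpM2r// lerDl.
Qed.

Definition tflow t x v := sval (cid (tangent_exists x v)) t.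

Lemma tflow0 x v : tflow 0 x v = v.
Proof. by rewrite /tflow; case: cid => c []. Qed.

Lemma is_derive_tflow x v (t : R) :
  is_derive t 1 (fun t => tflow t x v) ('d X (phi t x) (tflow t x v)).
Proof. by rewrite /tflow; case: cid => c []. Qed.

Lemma tflow_linear t x : linear (tflow t x).
Proof.
move=> a u v.
apply: (ode_unique (c := fun t => tflow t x (a *: u + v))
  (c' := fun t => a *: tflow t x u + tflow t x v) (@diff_along_flow_lip x)).
- by move=> s; exact: is_derive_tflow.
- move=> s; rewrite linearP; apply: is_deriveD; last exact: is_derive_tflow.
  apply: is_deriveZ; exact: is_derive_tflow.
- by rewrite !tflow0.
Qed.

Lemma tflow_bound (T r : R) : exists2 C : R, 0 <= C &
  forall t x v, `|t| <= T -> ball 0 r x -> `|tflow t x v| <= C * `|v|.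
Proof.
have [C C0 HC] := diff_along_flow_bound T r.
exists (2 * expR (2 * (C + 1) * T)) => [|t x v tT xr].
  by rewrite mulr_ge0// expR_ge0.
have D2 (s : R) : `|s| <= T ->
    `|'d X (phi s x) (tflow s x v)| <= (C + 1) * `|tflow s x v| + 0.
  move=> sT; rewrite addr0 (le_trans (HC _ _ _ sT xr))// ler_wpM2r// lerDl.
  by [].
have C1 : 0 < C + 1 by rewrite ltr_wpDl.
have := gronwall C1 (lexx _) (fun s _ => is_derive_tflow x v s) D2 tT.
by rewrite mul0r addr0 tflow0 mulrAC.
Qed.

(** Gronwall for the difference of the two flow lines minus the variational solution. It vanishes at
    time 0; its derivative is dX applied to itself plus the Taylor error of X between the flow
    lines, which is O(|v|^(1 + al)) since these stay within B |v| of each other. *)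
Lemma tflow_estimate (T r : R) : exists2 C : R, 0 <= C &
  forall t x v, `|t| <= T -> ball 0 r x -> ball 0 r (x + v) ->
    `|phi t (x + v) - phi t x - tflow t x v| <= C * `|v| `^ (1 + al).
Proof.
have [A A0 HA] := diff_along_flow_bound T r.
have [B B0 HB] := lphi T r.
have [C C0 HC] := Cg1_taylor al01 (B + 1) HX.
have a1 : 0 < 1 + al by rewrite ltr_wpDl//; case/andP: al01.
(* The absolute value of T keeps the constant nonnegative when T < 0, a case in which no t
   qualifies. *)
exists (2 * (C * B `^ (1 + al) * `|T|) * expR (2 * (A + 1) * T)) => [|t x v tT xr xvr].
  by rewrite !mulr_ge0 ?powR_ge0 ?expR_ge0.
have T0 : 0 <= T by rewrite (le_trans _ tT).
pose e := C * B `^ (1 + al) * `|v| `^ (1 + al).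
have e0 : 0 <= e by rewrite !mulr_ge0 ?powR_ge0.
have D1 (s : R) : `|s| <= T -> is_derive s 1
   (fun s => phi s (x + v) - phi s x - tflow s x v)
   (X (phi s (x + v)) - X (phi s x) - 'd X (phi s x) (tflow s x v)).
  move=> _; apply: is_deriveB; last exact: is_derive_tflow.
  by apply: is_deriveB; [have [_ H] := Hphi (x + v)|have [_ H] := Hphi x]; exact: H.
have D2 (s : R) : `|s| <= T ->
  `|X (phi s (x + v)) - X (phi s x) - 'd X (phi s x) (tflow s x v)| <=
   (A + 1) * `|phi s (x + v) - phi s x - tflow s x v| + e.
  move=> sT.
  rewrite (_ : _ - _ = 'd X (phi s x) (phi s (x + v) - phi s x - tflow s x v) +
    (X (phi s (x + v)) - X (phi s x) - 'd X (phi s x) (phi s (x + v) - phi s x))); last first.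
    by apply: subr_insert_sub; exact: linearB.
  rewrite (le_trans (ler_normD _ _))// lerD//.
    by rewrite (le_trans (HA _ _ _ sT xr))// ler_wpM2r// lerDl.
  have [b1 b2] := HB s (x + v) x sT xvr xr.
  have [b3 _] := HB s x x sT xr xr.
  have I1 : ball 0 (B + 1) (phi s (x + v)) by apply/ball0E; rewrite (le_lt_trans b1)// ltrDl.
  have I2 : ball 0 (B + 1) (phi s x) by apply/ball0E; rewrite (le_lt_trans b3)// ltrDl.
  rewrite (le_trans (HC _ _ I1 I2))// /e -mulrA ler_wpM2l// -powRM//.
  apply: ge0_ler_powR; rewrite ?nnegrE ?mulr_ge0 ?(ltW a1)//.
  have vE : x + v - x = v by rewrite addrAC subrr add0r.
  by rewrite vE in b2.
have A1 : 0 < A + 1 by rewrite ltr_wpDl.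
have := gronwall A1 e0 D1 D2 tT.
have [p0 _] := Hphi (x + v); have [p0' _] := Hphi x.
have -> : phi 0 (x + v) - phi 0 x - tflow 0 x v = 0.
  by rewrite p0 p0' tflow0 [x + v - x]addrAC subrr add0r subrr.
rewrite normr0 add0r.
by rewrite /e (ger0_norm T0); congr (_ <= _); ring.
Qed.

Lemma flow_diff t x : differentiable (phi t) x /\ forall v, 'd (phi t) x v = tflow t x v.
Proof.
have [B B0 HB] := tflow_bound `|t| (`|x| + 1).
have [C C0 HC] := tflow_estimate `|t| (`|x| + 1).
have xr : ball 0 (`|x| + 1) x by apply/ball0E; rewrite ltrDl.
apply: (@diff_of_estimate _ _ _ (phi t) x (tflow t x) B).
- exact: tflow_linear.
- by move=> h; exact: HB.
move=> e e0.
have [q q0 Hq] : exists2 q, 0 < q & forall z, 0 <= z -> z < q -> z `^ al <= e / (C + 1).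
  by apply: powR_small; [case/andP: al01|rewrite divr_gt0// ltr_wpDl].
exists (Num.min q 1) => [|h]; first by rewrite lt_min q0 ltr01.
rewrite lt_min => /andP[hq h1].
have xhr : ball 0 (`|x| + 1) (x + h).
  by apply/ball0E; rewrite (le_lt_trans (ler_normD _ _))// ltrD2l.
rewrite (le_trans (HC t x h (lexx _) xr xhr))//.
have a1 : 0 < 1 + al by rewrite ltr_wpDl//; case/andP: al01.
rewrite powRD; last by rewrite gt_eqF.
rewrite powRr1// mulrCA mulrC ler_wpM2r//.
apply: (@le_trans _ _ (C * (e / (C + 1)))); first by rewrite ler_wpM2l// Hq.
by apply: mul_divr_succ_le => //; exact: ltW.
Qed.

(** Gronwall for the difference of two variational solutions. The forcing term is the difference of
    dX at the two flow lines applied to one solution, of size |x - y|^b. *)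
Lemma tflow_hoelder (b T r : R) : 0 < b ->
  (forall r, exists2 C : R, 0 <= C & forall x y w, ball 0 r x -> ball 0 r y ->
    `|'d X x w - 'd X y w| <= C * `|x - y| `^ b * `|w|) ->
  exists2 C : R, 0 <= C & forall t x y u v, `|t| <= T -> ball 0 r x -> ball 0 r y ->
    ball 0 r u -> ball 0 r v ->
    `|tflow t x u - tflow t y v| <= C * (`|u - v| + `|x - y| `^ b).
Proof.
move=> b0 HdX.
have [A A0 HA] := diff_along_flow_bound T r.
have [B B0 HB] := lphi T r.
have [C C0 HC] := HdX (B + 1).
have [D D0 HD] := tflow_bound T r.
pose K := C * B `^ b * (D * `|r|).
have K0 : 0 <= K by rewrite !mulr_ge0 ?powR_ge0.
exists (2 * (1 + K * `|T|) * expR (2 * (A + 1) * T)) => [|t x y u v tT xr yr ur vr].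
  by rewrite mulr_ge0 ?expR_ge0// mulr_ge0// addr_ge0// mulr_ge0.
have T0 : 0 <= T by rewrite (le_trans _ tT).
have D1 (s : R) : `|s| <= T -> is_derive s 1 (fun s => tflow s x u - tflow s y v)
   ('d X (phi s x) (tflow s x u) - 'd X (phi s y) (tflow s y v)).
  by move=> _; apply: is_deriveB; exact: is_derive_tflow.
pose e := K * `|x - y| `^ b.
have e0 : 0 <= e by rewrite mulr_ge0 ?powR_ge0.
have D2 (s : R) : `|s| <= T ->
  `|'d X (phi s x) (tflow s x u) - 'd X (phi s y) (tflow s y v)| <=
   (A + 1) * `|tflow s x u - tflow s y v| + e.
  move=> sT.
  rewrite (_ : _ - _ = 'd X (phi s x) (tflow s x u - tflow s y v) +
    ('d X (phi s x) (tflow s y v) - 'd X (phi s y) (tflow s y v))); last first.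
    by apply: subr_split; exact: linearB.
  rewrite (le_trans (ler_normD _ _))// lerD//.
    by rewrite (le_trans (HA _ _ _ sT xr))// ler_wpM2r// lerDl.
  have [b1 b2] := HB s x y sT xr yr; have [b3 _] := HB s y y sT yr yr.
  have I1 : ball 0 (B + 1) (phi s x) by apply/ball0E; rewrite (le_lt_trans b1)// ltrDl.
  have I2 : ball 0 (B + 1) (phi s y) by apply/ball0E; rewrite (le_lt_trans b3)// ltrDl.
  rewrite (le_trans (HC _ _ _ I1 I2))// /e /K.
  rewrite (_ : C * B `^ b * (D * `|r|) * `|x - y| `^ b =
    C * (B `^ b * `|x - y| `^ b) * (D * `|r|)); last by ring.
  have vr' : `|v| <= `|r| by move/ball0E: vr => /ltW/le_trans; apply; exact: ler_norm.
  apply: ler_pM; [|exact: normr_ge0| |].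
  - by rewrite mulr_ge0 ?powR_ge0.
  - apply: ler_wpM2l => //; rewrite -powRM//.
    by apply: ge0_ler_powR; rewrite ?nnegrE ?mulr_ge0 ?(ltW b0).
  - exact: le_trans (HD s y v sT yr) (ler_wpM2l D0 vr').
have A1 : 0 < A + 1 by rewrite ltr_wpDl.
have := gronwall A1 e0 D1 D2 tT; rewrite !tflow0 => /le_trans; apply.
rewrite (ger0_norm T0) /e.
have := powR_ge0 `|x - y| b; have := normr_ge0 (u - v).
move: (`|x - y| `^ b) `|u - v| (expR _) (expR_ge0 (2 * (A + 1) * T)) => p q E E0 q0 p0.
rewrite (_ : 2 * (1 + K * T) * E * (q + p) = 2 * ((1 + K * T) * (q + p)) * E); last by ring.
rewrite ler_wpM2r// ler_wpM2l// -subr_ge0.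
rewrite (_ : _ - _ = p + K * T * q); last by ring.
by rewrite addr_ge0//; apply: mulr_ge0 => //; exact: mulr_ge0.
Qed.

End tangent.
End flows.

(** * Higher regularity of flows, in space and then jointly with time *)

Section flow_regularity.
Context {R : realType} (al : R).
Hypothesis al01 : 0 < al <= 1.

Lemma norm_lsubmx n1 n2 (z : 'rV[R]_(n1 + n2)) : `|lsubmx z| <= `|z|.
Proof. by apply: rV_norm_le => // i; rewrite mxE mx_norm_coord. Qed.

Lemma norm_rsubmx n1 n2 (z : 'rV[R]_(n1 + n2)) : `|rsubmx z| <= `|z|.
Proof. by apply: rV_norm_le => // i; rewrite mxE mx_norm_coord. Qed.

Lemma norm_row_mx n1 n2 (x : 'rV[R]_n1) (y : 'rV[R]_n2) : `|row_mx x y| <= `|x| + `|y|.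
Proof.
apply: rV_norm_le => [|i]; first exact: addr_ge0.
rewrite -[i]splitK; case: (fintype.split i) => j /=.
  by rewrite row_mxEl (le_trans (mx_norm_coord _ _ _))// lerDl.
by rewrite row_mxEr (le_trans (mx_norm_coord _ _ _))// lerDr.
Qed.

Lemma is_derive_row_mx n1 n2 (c : R -> 'rV[R]_n1) (c' : R -> 'rV[R]_n2) d d' (t : R) :
  is_derive t 1 c d -> is_derive t 1 c' d' ->
  is_derive t 1 (fun s => row_mx (c s) (c' s)) (row_mx d d').
Proof.
move=> H H'; apply/(is_derive1_rV _ (fun _ => row_mx d d')) => j.
rewrite -[j]splitK; case: (fintype.split j) => i /=.
  under eq_fun do rewrite row_mxEl; rewrite row_mxEl.
  exact: (is_derive1_rV c (fun _ => d) t).1.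
under eq_fun do rewrite row_mxEr; rewrite row_mxEr.
exact: (is_derive1_rV c' (fun _ => d') t).1.
Qed.

(* The derivative of a flow in its initial condition is the second component of
   the flow of the tangent field (x, w) |-> (X x, dX x w), which is one degree
   less regular: this is the induction step. *)
Theorem flow_Cg k n (X : 'rV[R]_n -> 'rV[R]_n) (phi : R -> 'rV[R]_n -> 'rV[R]_n) :
  Cg al k.+1 X -> is_flow X phi -> flow_lip phi -> forall t, Cg al k.+1 (phi t).
Proof.
elim: k n X phi => [|k IH] n X phi HX Hphi lphi t r j.
  have [B B0 HB] := lphi `|t| r.
  have dphi x := flow_diff al01 HX Hphi lphi t x.
  split.
  - exists B => // x xr; rewrite (le_trans (mx_norm_coord _ _ _))//.
    by have [] := HB t x x (lexx _) xr xr.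
  - by move=> x _; apply: differentiable_rV_coord; have [] := dphi x.
  move=> v.
  have -> : 'D_v (fun x => phi t x ord0 j) =
      fun x => tflow al01 HX Hphi lphi t x v ord0 j.
    apply/funext => x; have [d dE] := dphi x.
    rewrite deriveE; last exact: differentiable_rV_coord.
    by rewrite -diff_rV_coord// dE.
  have HdX s : exists2 C : R, 0 <= C & forall x y w, ball 0 s x -> ball 0 s y ->
      `|'d X x w - 'd X y w| <= C * `|x - y| `^ al * `|w|.
    apply: (diff_hoelder al01 HX) => i l.
    have [C C0 [_ HC]] := Ck_derive (delta_mx ord0 i) (HX s l).
    by exists C.
  have [a0 _] := andP al01.
  have [C C0 HC] := tflow_hoelder al01 HX Hphi lphi `|t| (Num.max r (`|v| + 1)) a0 HdX.
  have [D D0 HD] := tflow_bound al01 HX Hphi lphi `|t| r.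
  apply: hoelderW.
    exists (D * `|v|) => [|x xr]; first exact: mulr_ge0.
    by rewrite (le_trans (mx_norm_coord _ _ _))// HD.
  exists C => // x y xr yr.
  have vr : ball 0 (Num.max r (`|v| + 1)) v.
    by apply/ball0E; rewrite lt_max ltrDl ltr01 orbT.
  have in_max (x' : 'rV[R]_n) : ball 0 r x' -> ball 0 (Num.max r (`|v| + 1)) x'.
    by move=> /ball0E x'r; apply/ball0E; rewrite lt_max x'r.
  have := HC t x y v v (lexx _) (in_max _ xr) (in_max _ yr) vr vr.
  rewrite (subrr v) normr0 add0r => E.
  exact: le_trans (mx_norm_coordB _ _ _) E.
have HX1 : Cg al 1 X by apply: Cg_le HX.
have dphi x := flow_diff al01 HX1 Hphi lphi t x.
pose W := tflow al01 HX1 Hphi lphi.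
pose TX (z : 'rV[R]_(n + n)) := row_mx (X (lsubmx z)) ('d X (lsubmx z) (rsubmx z)).
pose Tphi s (z : 'rV[R]_(n + n)) := row_mx (phi s (lsubmx z)) (W s (lsubmx z) (rsubmx z)).
have HTX : Cg al k.+1 TX.
  apply: Cg_row_mx; last exact: Cg_diff.
  by apply: (Cg_comp al01 (ltn0Sn _)); [exact: Cg_lsubmx|exact: Cg_le HX].
have HTphi : is_flow TX Tphi.
  move=> z; split; first by rewrite /Tphi /W tflow0; have [-> _] := Hphi (lsubmx z); rewrite hsubmxK.
  move=> s; rewrite /TX row_mxKl row_mxKr; apply: is_derive_row_mx.
    by have [_ H] := Hphi (lsubmx z); exact: H.
  exact: is_derive_tflow.
(* In the induction step X has at least two orders, so dX is locally Lipschitz. The exponent 1 makes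
   the tangent flow locally Lipschitz, as [flow_lip] demands of it. *)
have HdX s : exists2 C : R, 0 <= C & forall x y w, ball 0 s x -> ball 0 s y ->
    `|'d X x w - 'd X y w| <= C * `|x - y| `^ 1 * `|w|.
  apply: (diff_hoelder al01 HX1) => i l.
  have H1 : Ck al (ball 0 s) 1 ('D_(delta_mx ord0 i) (fun x => X x ord0 l)).
    apply: (Ck_le al01 _ _ (Ck_derive (delta_mx ord0 i) (HX s l))) => //.
    exact: segment_closed_ball.
  have [C C0 HC] := Ck1_lip (@segment_closed_ball _ _ _ _) H1.
  by exists C => // x y xr yr; rewrite powRr1// HC.
have lTphi : flow_lip Tphi.
  move=> T s; have [B B0 HB] := lphi T s.
  have [D D0 HD] := tflow_bound al01 HX1 Hphi lphi T s.
  have [C C0 HC] := tflow_hoelder al01 HX1 Hphi lphi T s ltr01 HdX.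
  exists (B + D * `|s| + 2 * C) => [|u x y uT xs ys].
    by rewrite !addr_ge0// mulr_ge0.
  have in_l (z : 'rV[R]_(n + n)) : ball 0 s z -> ball 0 s (lsubmx z : 'rV[R]_n).
    by move=> /ball0E zs; apply/ball0E; rewrite (le_lt_trans (norm_lsubmx z)).
  have in_r (z : 'rV[R]_(n + n)) : ball 0 s z -> ball 0 s (rsubmx z : 'rV[R]_n).
    by move=> /ball0E zs; apply/ball0E; rewrite (le_lt_trans (norm_rsubmx z)).
  have [b1 b2] := HB u _ _ uT (in_l _ xs) (in_l _ ys); split.
    rewrite (le_trans (norm_row_mx _ _))// -[leLHS]addr0 lerD ?mulr_ge0// lerD//.
    rewrite (le_trans (HD _ _ _ uT (in_l _ xs)))// ler_wpM2l//.
    have /ball0E/ltW/le_trans := in_r _ xs; apply; exact: ler_norm.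
  rewrite /Tphi opp_row_mx add_row_mx (le_trans (norm_row_mx _ _))//.
  have b3 := HC u _ _ _ _ uT (in_l _ xs) (in_l _ ys) (in_r _ xs) (in_r _ ys).
  rewrite powRr1// in b3; rewrite (le_trans (lerD b2 b3))//.
  have b4 : `|lsubmx x - lsubmx y| <= `|x - y| by rewrite -linearB; exact: norm_lsubmx.
  have b5 : `|rsubmx x - rsubmx y| <= `|x - y| by rewrite -linearB; exact: norm_rsubmx.
  apply: (@le_trans _ _ (B * `|x - y| + C * (`|x - y| + `|x - y|))).
    by rewrite lerD// ler_wpM2l// lerD.
  rewrite (_ : (B + D * `|s| + 2 * C) * `|x - y| =
    B * `|x - y| + C * (`|x - y| + `|x - y|) + D * `|s| * `|x - y|); last by ring.
  by rewrite lerDl !mulr_ge0.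
have {IH} HI := IH _ TX Tphi HTX HTphi lTphi t.
have [B B0 HB] := lphi `|t| r.
split.
- exists B => // x xr; rewrite (le_trans (mx_norm_coord _ _ _))//.
  by have [] := HB t x x (lexx _) xr xr.
- by move=> x _; apply: differentiable_rV_coord; have [] := dphi x.
move=> v.
have -> : 'D_v (fun x => phi t x ord0 j) =
    fun x => (Tphi t \o (fun x => row_mx x v)) x ord0 (rshift n j).
  apply/funext => x; have [d dE] := dphi x.
  rewrite deriveE; last exact: differentiable_rV_coord.
  by rewrite -diff_rV_coord// dE /= /Tphi row_mxEr row_mxKl row_mxKr.
apply: (Cg_comp al01 (ltn0Sn _) _ HI).
apply: Cg_row_mx; first exact: Cg_id.
by apply: (@Cg_linear _ _ al01 _ _ _ _ 0 v) => x; rewrite mulmx0 add0r.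
Qed.

Section joint.
Context (k d : nat) (g : 'rV[R]_d -> 'rV[R]_d) (phi : R -> 'rV[R]_d -> 'rV[R]_d).
Hypotheses (Hg : Cg al k.+1 g) (lg : lip_on setT g) (Hphi : is_flow g phi).
Hypothesis bg : exists2 C : R, 0 <= C & forall x, `|g x| <= C.

Lemma flow_lip_init (T : R) : exists2 C : R, 0 <= C &
  forall t x y, `|t| <= T -> `|phi t x - phi t y| <= C * `|x - y|.
Proof.
have [L L0 HL] := lg.
exists (2 * expR (2 * (L + 1) * T)) => [|t x y tT]; first by rewrite mulr_ge0 ?expR_ge0.
have D1 (s : R) : `|s| <= T -> is_derive s 1 (fun s => phi s x - phi s y)
    (g (phi s x) - g (phi s y)).
  by move=> _; apply: is_deriveB; [have [_ H] := Hphi x|have [_ H] := Hphi y]; exact: H.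
have D2 (s : R) : `|s| <= T -> `|g (phi s x) - g (phi s y)| <=
    (L + 1) * `|phi s x - phi s y| + 0.
  by move=> _; rewrite addr0 (le_trans (HL _ _ I I))// ler_wpM2r// lerDl.
have L1 : 0 < L + 1 by rewrite ltr_wpDl.
have := gronwall L1 (lexx _) D1 D2 tT.
have [-> _] := Hphi x; have [-> _] := Hphi y.
by rewrite mul0r addr0 mulrAC.
Qed.

Lemma flow_time_lip : exists2 C : R, 0 <= C &
  forall s t x, `|phi s x - phi t x| <= C * `|s - t|.
Proof.
have [C C0 HC] := bg.
exists C => // s t x; apply: rV_norm_le => [|j]; first by rewrite mulr_ge0.
have dphi (u : R) : is_derive u 1 (fun u => phi u x ord0 j) (g (phi u x) ord0 j).
  move: j; apply/(is_derive1_rV (phi^~ x) (fun u => g (phi u x)) u).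
  by have [_ H] := Hphi x; exact: H.
have cT : segment_closed [set: R^o] by [].
have [u _] := @mean_value_segment _ _ _ (fun u => phi u x ord0 j) t s cT
  (fun u _ => (derivable1_diffP _ _).1 (@ex_derive _ _ _ _ _ _ _ (dphi u))) I I.
rewrite !mxE => ->.
have E1 : s - t = (s - t) *: (1 : R^o) by rewrite /GRing.scale /= mulr1.
rewrite [X in 'D_X _ _]E1 derive_scale; last first.
  by apply/derivable1_diffP; have [] := dphi u.
have [_ ->] := dphi u.
by rewrite normrM mulrC ler_wpM2r// (le_trans (mx_norm_coord _ _ _)).
Qed.

(* Regularity in (t, x) jointly is that of the time-one map of the flow of the
   field (s, x) |-> (0, s g(x)). *)
Theorem flow_joint_Cg :
  Cg al k.+1 (fun z : 'rV[R]_(1 + d) => phi (z ord0 (lshift d ord0)) (rsubmx z)).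
Proof.
pose t0 (z : 'rV[R]_(1 + d)) : R := z ord0 (lshift d ord0).
pose Y (z : 'rV[R]_(1 + d)) : 'rV[R]_(1 + d) := row_mx 0 (t0 z *: g (rsubmx z)).
pose Yphi (s : R) (z : 'rV[R]_(1 + d)) : 'rV[R]_(1 + d) :=
  row_mx (lsubmx z) (phi (s * t0 z) (rsubmx z)).
have HY : Cg al k.+1 Y.
  apply: Cg_row_mx.
    by apply: (@Cg_linear _ _ al01 _ _ _ _ 0 0) => x; rewrite mulmx0 addr0.
  move=> r j.
  have oB := @ball_open _ 'rV[R]_(1 + d) 0 r.
  have cB := @segment_closed_ball R 'rV[R]_(1 + d) 0 r.
  rewrite (_ : (fun _ => _) = fun z => t0 z * (g \o rsubmx) z ord0 j).
    apply: CkM => //; first by apply: Ck_coord => //; exact: ball_bounded.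
    by apply: (Cg_comp al01 (ltn0Sn _)) => //; exact: Cg_rsubmx.
  by apply/funext => z; rewrite mxE.
have HYphi : is_flow Y Yphi.
  move=> z; split.
    by rewrite /Yphi mul0r; have [-> _] := Hphi (rsubmx z); rewrite hsubmxK.
  move=> s; rewrite /Y /Yphi; apply: is_derive_row_mx.
  have -> : t0 (row_mx (lsubmx z) (phi (s * t0 z) (rsubmx z))) = t0 z.
    by rewrite /t0 row_mxEl mxE.
  rewrite row_mxKr.
  apply/(is_derive1_rV (fun s => phi (s * t0 z) (rsubmx z))
    (fun _ => t0 z *: g (phi (s * t0 z) (rsubmx z)))) => j.
  have dphi (u : R) : is_derive u 1 (fun u => phi u (rsubmx z) ord0 j) (g (phi u (rsubmx z)) ord0 j).
    move: j; apply/(is_derive1_rV (phi^~ (rsubmx z)) (fun u => g (phi u (rsubmx z))) u).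
    by have [_ H] := Hphi (rsubmx z); exact: H.
  have dm : is_derive s 1 (fun s : R => s * t0 z) (t0 z).
    have := @is_deriveZ R R R id (t0 z) s 1 1 (is_derive_id _ _).
    rewrite [t0 z *: 1]mulr1; congr (is_derive _ _ _ _).
    by apply/funext => u; rewrite mulrC.
  have := @is_derive1_comp R (fun u => phi u (rsubmx z) ord0 j) (fun s => s * t0 z) s _ _
    (dphi _) dm.
  by rewrite !mxE mulrC.
have lYphi : flow_lip Yphi.
  move=> T r; have [A A0 HA] := flow_lip_init (`|T| * `|r|).
  have [B B0 HB] := flow_time_lip.
  exists (`|r| + (`|r| + B * (`|T| * `|r|)) + (1 + A + B * `|T|)) => [|t x y tT xr yr].
    by rewrite !addr_ge0// !mulr_ge0.
  have tT' : `|t| <= `|T| by rewrite (le_trans tT)// ler_norm.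
  have nr (z : 'rV[R]_(1 + d)) : ball 0 r z -> `|z| <= `|r|.
    by move=> /ball0E/ltW/le_trans; apply; exact: ler_norm.
  have nt (z : 'rV[R]_(1 + d)) : ball 0 r z -> `|t0 z| <= `|r|.
    by move=> /nr; apply: le_trans; exact: mx_norm_coord.
  have ntt (z : 'rV[R]_(1 + d)) : ball 0 r z -> `|t * t0 z| <= `|T| * `|r|.
    by move=> zr; rewrite normrM ler_pM// nt.
  split.
    rewrite (le_trans (norm_row_mx _ _))// -[leLHS]addr0 lerD//; last first.
      by rewrite !addr_ge0// mulr_ge0.
    rewrite lerD// ?(le_trans (norm_lsubmx _))// ?nr//.
    rewrite -[phi _ _](subrK (phi 0 (rsubmx x))) (le_trans (ler_normD _ _))// addrC lerD//.
      by have [-> _] := Hphi (rsubmx x); rewrite (le_trans (norm_rsubmx _))// nr.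
    by rewrite (le_trans (HB _ _ _))// subr0 ler_wpM2l// ntt.
  rewrite /Yphi opp_row_mx add_row_mx (le_trans (norm_row_mx _ _))//.
  have b4 : `|lsubmx x - lsubmx y| <= `|x - y| by rewrite -linearB; exact: norm_lsubmx.
  have b5 : `|rsubmx x - rsubmx y| <= `|x - y| by rewrite -linearB; exact: norm_rsubmx.
  have b6 : `|phi (t * t0 x) (rsubmx x) - phi (t * t0 x) (rsubmx y)| <= A * `|x - y|.
    by rewrite (le_trans (HA _ _ _ (ntt _ xr)))// ler_wpM2l.
  have b7 : `|phi (t * t0 x) (rsubmx y) - phi (t * t0 y) (rsubmx y)| <= B * `|T| * `|x - y|.
    rewrite (le_trans (HB _ _ _))// -mulrA ler_wpM2l// -mulrBr normrM ler_pM//.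
    by have := mx_norm_coord (x - y) ord0 (lshift d ord0); rewrite !mxE.
  apply: (@le_trans _ _ (`|x - y| + (A * `|x - y| + B * `|T| * `|x - y|))).
    rewrite lerD// -[phi (t * t0 x) (rsubmx x)](subrK (phi (t * t0 x) (rsubmx y))) -addrA.
    by rewrite (le_trans (ler_normD _ _))// lerD.
  rewrite addrA -{1}[`|x - y|]mul1r -!mulrDl ler_wpM2r// lerDr.
  by rewrite !addr_ge0// !mulr_ge0.
have H := flow_Cg HY HYphi lYphi 1.
have -> : (fun z : 'rV[R]_(1 + d) => phi (z ord0 (lshift d ord0)) (rsubmx z)) =
   rsubmx \o Yphi 1.
  by apply/funext => z; rewrite /= /Yphi row_mxKr mul1r.
by apply: (Cg_comp al01 (ltn0Sn _) H); exact: Cg_rsubmx.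
Qed.

Lemma flow_fixed_time_Cg t : Cg al k.+1 (phi t).
Proof.
have -> : phi t = (fun z : 'rV[R]_(1 + d) => phi (z ord0 (lshift d ord0)) (rsubmx z)) \o
   (fun x => row_mx (const_mx t) x).
  by apply/funext => x /=; rewrite row_mxEl mxE row_mxKr.
apply: (Cg_comp al01 (ltn0Sn _) _ flow_joint_Cg).
apply: Cg_row_mx; last exact: Cg_id.
by apply: (@Cg_linear _ _ al01 _ _ _ _ 0 (const_mx t)) => x; rewrite mulmx0 add0r.
Qed.

End joint.

Lemma flow_exists d (g : 'rV[R]_d -> 'rV[R]_d) : lip_on setT g ->
  exists phi, is_flow g phi.
Proof.
move=> [L L0 HL].
have H x : exists c : R -> 'rV[R]_d, c 0 = x /\ forall t : R, is_derive t 1 c (g (c t)).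
  apply: (@picard_exists R d (fun _ => g) x).
    move=> c cc t; apply: (@continuous_comp _ _ _ c g); first exact: cc.
    apply: continuous_of_dist => e e0; exists (e / (L + 1)).
      by rewrite divr_gt0// ltr_wpDl.
    move=> y xy; rewrite (le_trans (HL _ _ I I))//.
    apply: (@le_trans _ _ (L * (e / (L + 1)))); first by rewrite ler_wpM2l// ltW.
    by apply: mul_divr_succ_le => //; exact: ltW.
  move=> T; exists (L + 1) => [|t x' y _]; first by rewrite ltr_wpDl.
  by rewrite (le_trans (HL _ _ I I))// ler_wpM2r// lerDl.
exists (fun t x => sval (cid (H x)) t) => x.
by case: cid => c [].
Qed.

End flow_regularity.

(** * The distribution P_D *)

Section spans.
Context {R : realType} (d : nat).
Implicit Types (S P : set 'rV[R]_d) (u v : 'rV[R]_d).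

Lemma lspan_sub S u : S u -> lspan S u.
Proof.
move=> Su; exists [:: u]; split=> [v|]; first by rewrite inE => /eqP ->.
by rewrite memv_span// mem_head.
Qed.

Lemma lspan0 S : lspan S 0.
Proof. by exists [::]; split => //; exact: mem0v. Qed.

Lemma lspan_lin S a u v : lspan S u -> lspan S v -> lspan S (a *: u + v).
Proof.
move=> [s [Hs us]] [t [Ht vt]]; exists (s ++ t); split.
  by move=> w; rewrite mem_cat => /orP[/Hs|/Ht].
by rewrite span_cat memv_add// memvZ.
Qed.

Lemma lspan_ind S P : P 0 -> (forall a u v, P u -> P v -> P (a *: u + v)) ->
  S `<=` P -> lspan S `<=` P.
Proof.
move=> P0 Plin SP v [s [Hs]].
elim: s v Hs => [|w s IH] v Hs; first by rewrite span_nil memv0 => /eqP ->.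
rewrite span_cons => /memv_addP[u /vlineP[a ->] [w' w's ->]].
apply: Plin; first by apply/SP/Hs; rewrite mem_head.
by apply: IH => // z zs; apply: Hs; rewrite inE zs orbT.
Qed.

Lemma extract_free (l : seq 'rV[R]_d) : exists l', {subset l' <= l} /\ free l' /\
  (vector.span l' = vector.span l).
Proof.
elim: l => [|w l [l' [H1 [H2 H3]]]]; first by exists [::]; rewrite nil_free.
have [wl|wl] := boolP (w \in (vector.span l')).
  exists l'; split; first by move=> z /H1; rewrite inE => ->; rewrite orbT.
  split=> //; rewrite span_cons -H3; apply/esym/addv_idPr.
  by rewrite -memvE.
exists (w :: l'); split.
  by move=> z; rewrite !inE => /orP[->//|/H1 ->]; rewrite orbT.
by split; [rewrite free_cons wl|rewrite !span_cons H3].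
Qed.

Lemma injective_onto p (L : 'rV[R]_p -> 'rV[R]_d) (s : seq 'rV[R]_d) :
  linear L -> injective L -> (forall t, L t \in (vector.span s)) -> (\dim (vector.span s) = p)%N ->
  forall v, v \in (vector.span s) -> exists t, v = L t.
Proof.
move=> linL injL Ls dimp v vs.
pose L' : {linear 'rV[R]_p -> 'rV[R]_d} := HB.pack L (GRing.isLinear.Build _ _ _ _ L linL).
pose f : 'Hom('rV[R]_p, 'rV[R]_d) := linfun L'.
have fE t : f t = L t by rewrite lfunE.
have kf : lker f == 0%VS by apply/lker0P => a b; rewrite !fE; exact: injL.
have lf : limg f = (vector.span s).
  apply/eqP; rewrite eqEdim limg_dim_eq; last by rewrite (eqP kf) capv0.
  rewrite dimp dimvf /dim /= mul1n leqnn andbT.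
  by apply/subvP => w /memv_imgP[t _ ->]; rewrite fE.
by move: vs; rewrite -lf => /memv_imgP[t _ ->]; exists t; rewrite fE.
Qed.

End spans.

(** * D-diffeomorphisms, invariance of P_D, and parametrization of the orbit *)

Section diffeos.
Context {R : realType} (al : R) (k d : nat) (D : set ('rV[R]_d -> 'rV[R]_d)).
Hypothesis al01 : 0 < al <= 1.
Hypothesis HD : forall g, D g -> [/\ Cg al k.+1 g, lip_on setT g &
  exists2 C : R, 0 <= C & forall x, `|g x| <= C].

Lemma flow_add (g : 'rV[R]_d -> 'rV[R]_d) phi s t x : lip_on setT g -> is_flow g phi ->
  phi (s + t) x = phi s (phi t x).
Proof.
move=> [L L0 HL] Hphi.
have lg : loc_lip (fun _ : R => g) by move=> T r; exists L => // *; exact: HL.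
apply: (ode_unique (c := fun s => phi (s + t) x) (c' := phi^~ (phi t x)) lg).
- move=> u; apply/(is_derive1_rV (fun s => phi (s + t) x) (fun s => g (phi (s + t) x)) u) => j.
  have d1 : is_derive (u + t) 1 (fun s => phi s x ord0 j) (g (phi (u + t) x) ord0 j).
    move: j; apply/(is_derive1_rV (phi^~ x) (fun s => g (phi s x)) (u + t)).
    by have [_ H] := Hphi x; exact: H.
  have d2 : is_derive u 1 (fun s : R => s + t) 1.
    have := @is_deriveD R R R id (cst t) u 1 1 0 (is_derive_id _ _) (is_derive_cst _ _ _).
    by rewrite addr0.
  have := @is_derive1_comp R (fun s => phi s x ord0 j) (fun s => s + t) u _ _ d1 d2.
  by rewrite mulr1.
- by move=> u; have [_ H] := Hphi (phi t x); exact: H.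
- by rewrite add0r; have [-> _] := Hphi (phi t x).
Qed.

Lemma flow_inv (g : 'rV[R]_d -> 'rV[R]_d) phi t x : lip_on setT g -> is_flow g phi ->
  phi (- t) (phi t x) = x.
Proof. by move=> lg Hphi; rewrite -(flow_add _ _ _ lg)// addNr; have [-> _] := Hphi x. Qed.

Lemma D_diffeo_trans h h' : D_diffeo D h -> D_diffeo D h' -> D_diffeo D (h \o h').
Proof.
move=> H H'; elim: H => [//|g Phi t h0 Dg HPhi _ IH].
exact: (D_diffeo_comp t Dg HPhi IH).
Qed.

Lemma D_diffeo_flow g phi t : D g -> is_flow g phi -> D_diffeo D (phi t).
Proof. by move=> Dg Hphi; exact: (D_diffeo_comp t Dg Hphi (D_diffeo_id D)). Qed.

Lemma D_diffeo_inv h : D_diffeo D h ->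
  exists h', [/\ D_diffeo D h', forall x, h' (h x) = x & forall x, h (h' x) = x].
Proof.
elim=> [|g Phi t h0 Dg HPhi _ [h' [Dh' h'K hK]]].
  by exists id; split => //; exact: D_diffeo_id.
have [_ lg _] := HD Dg.
exists (h' \o Phi (- t)); split.
- by apply: D_diffeo_trans => //; exact: D_diffeo_flow HPhi.
- by move=> x /=; rewrite (flow_inv _ _ lg).
- by move=> x /=; rewrite hK -{1}[t]opprK (flow_inv _ _ lg).
Qed.

Lemma D_diffeo_Cg h : D_diffeo D h -> Cg al k.+1 h.
Proof.
elim=> [|g Phi t h0 Dg HPhi _ IH]; first exact: Cg_id.
have [Hg lg bg] := HD Dg.
apply: (Cg_comp al01 (ltn0Sn _) IH).
exact: (flow_fixed_time_Cg al01 Hg lg HPhi bg).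
Qed.

Lemma D_diffeo_differentiable h x : D_diffeo D h -> differentiable h x.
Proof. by move=> /D_diffeo_Cg; exact: Cg_differentiable. Qed.

Lemma diff_comp_at (V1 V2 V3 : normedModType R) (f1 : V1 -> V2) (f2 : V2 -> V3) x v :
  differentiable f1 x -> differentiable f2 (f1 x) ->
  'd (f2 \o f1) x v = 'd f2 (f1 x) ('d f1 x v).
Proof. by move=> d1 d2; rewrite diff_comp. Qed.

Lemma PD_generator h g w : D_diffeo D h -> D g -> PD D (h w) ('d h w (g w)).
Proof.
move=> Dh Dg; apply: lspan_sub; exists h, w, (g w); split => //; split => //; split => //.
by apply: lspan_sub; exists g.
Qed.

Lemma PD_lin z a u v : PD D z u -> PD D z v -> PD D z (a *: u + v).
Proof. exact: lspan_lin. Qed.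

Lemma PD0 z : PD D z 0. Proof. exact: lspan0. Qed.

Lemma PD_invariant h z v : D_diffeo D h -> PD D z v -> PD D (h z) ('d h z v).
Proof.
move=> Dh; apply: (@lspan_ind R d _ (fun v => PD D (h z) ('d h z v))).
- by rewrite linear0; exact: PD0.
- by move=> a u u' Hu Hu'; rewrite linearP; exact: PD_lin.
move=> u [h1 [w [v1 [Dh1 [h1w [Hv1 ->]]]]]].
subst z; apply: lspan_sub; exists (h \o h1), w, v1; split; first exact: D_diffeo_trans.
split => //; split=> //; apply/esym/diff_comp_at; exact: D_diffeo_differentiable.
Qed.

Lemma diff_cancel (h h' : 'rV[R]_d -> 'rV[R]_d) x v : (forall x, h' (h x) = x) ->
  differentiable h x -> differentiable h' (h x) -> 'd h' (h x) ('d h x v) = v.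
Proof.
move=> hK dh dh'.
have h'h : h' \o h = id by apply/funext.
have E := diff_comp_at v dh dh'; rewrite h'h in E.
by apply: etrans (esym E) _; rewrite diff_val.
Qed.

(** [PD] is spanned by images of linear combinations of field values. The parametrization needs
    basis vectors that come from a single field each, so that each is the velocity of a conjugated
    flow. *)
Definition PD_generators (z : 'rV[R]_d) : set 'rV[R]_d :=
  [set u | exists h w g, [/\ D_diffeo D h, h w = z, D g & u = 'd h w (g w)]].

Lemma PD_lspan_generators z v : PD D z v -> lspan (PD_generators z) v.
Proof.
apply: lspan_ind => [|a u u'|]; [exact: lspan0|exact: lspan_lin|].
move=> u [h [w [v1 [Dh [hw [Hv1 ->]]]]]]; move: v1 Hv1.
apply: (@lspan_ind R d _ (fun v1 => lspan (PD_generators z) ('d h w v1))).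
- by rewrite linear0; exact: lspan0.
- by move=> a u0 u1 H0 H1; rewrite linearP; exact: lspan_lin.
move=> _ [g Dg <-]; apply: lspan_sub; by exists h, w, g.
Qed.

(** Every vector of a finite spanning list is expanded in generators, and a free family with the
    same span is extracted from all the generators used. *)
Lemma PD_basis z p : vdim (PD D z) p -> exists b : seq 'rV[R]_d,
  [/\ size b = p, free b, forall u, u \in b -> PD_generators z u,
    forall v, PD D z v <-> v \in (vector.span b) & (\dim (vector.span b) = p)%N].
Proof.
move=> [s [Hs [sE dimp]]].
have [l [Hl sl]] : exists l : seq 'rV[R]_d, (forall u, u \in l -> PD_generators z u) /\
    forall u, u \in s -> u \in (vector.span l).
  elim: s Hs {sE dimp} => [|w s IH] Hs; first by exists [::].
  have [|l [Hl Hl']] := IH; first by move=> u us; apply: Hs; rewrite inE us orbT.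
  have [l1 [H1 H2]] := PD_lspan_generators (Hs w (mem_head _ _)).
  exists (l1 ++ l); split; first by move=> u; rewrite mem_cat => /orP[/H1|/Hl].
  move=> u; rewrite inE span_cat => /orP[/eqP ->|/Hl' ul].
    by rewrite -[w]addr0 memv_add// mem0v.
  by rewrite -[u]add0r memv_add// mem0v.
have [b [bl [fb bE]]] := extract_free l.
have gen_PD u : PD_generators z u -> PD D z u.
  by move=> [h [w [g [Dh <- Dg ->]]]]; exact: PD_generator.
have sb : (vector.span s = vector.span b).
  apply/eqP; rewrite eqEsubv; apply/andP; split.
    by rewrite bE; apply/span_subvP.
  by apply/span_subvP => u ub; apply/sE/gen_PD/Hl/bl.
exists b; rewrite -sb; split => //.
  by move: fb; rewrite /free -sb dimp => /eqP.
by move=> u ub; apply/Hl/bl.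
Qed.

(** This is where constancy of the rank along the orbit is used. The inverse of h pulls P_D at h y
    injectively into P_D at y, of dimension p. Preceded by A it is injective from a p-dimensional
    space, hence onto; every vector of P_D at h y therefore has the same pullback as some A t, and
    equals it. *)
Lemma PD_range h y p (b : seq 'rV[R]_d) (A : 'rV[R]_p -> 'rV[R]_d) : D_diffeo D h ->
  (forall v, PD D y v <-> v \in (vector.span b)) -> (\dim (vector.span b) = p)%N ->
  linear A -> injective A -> (forall t, PD D (h y) (A t)) -> range A = PD D (h y).
Proof.
move=> Dh bE dimp linA injA HA.
have [h' [Dh' h'K hK]] := D_diffeo_inv Dh.
have dh := D_diffeo_differentiable y Dh; have dh' := D_diffeo_differentiable (h y) Dh'.
have pull v : PD D (h y) v -> PD D y ('d h' (h y) v).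
  by move=> Hv; have := PD_invariant Dh' Hv; rewrite h'K.
have inj_h' : injective ('d h' (h y)).
  apply: (can_inj (g := 'd h y)) => v.
  have := @diff_cancel h' h (h y) v hK; rewrite h'K; exact.
apply/seteqP; split => [_ [t _ <-]//|v Hv].
have [||||t Et] := @injective_onto R d p ('d h' (h y) \o A) b _ _ _ dimp ('d h' (h y) v).
- by move=> a t t' /=; rewrite linA linearP.
- by move=> t t' /= /inj_h'/injA.
- by move=> t; apply/bE/pull.
- exact/bE/pull.
by exists t => //; apply/esym/inj_h'.
Qed.

Lemma diff_row_mx (V : normedModType R) n1 n2 (F1 : V -> 'rV[R]_n1) (F2 : V -> 'rV[R]_n2) x v :
  differentiable F1 x -> differentiable F2 x ->
  differentiable (fun y => row_mx (F1 y) (F2 y)) x /\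
  'd (fun y => row_mx (F1 y) (F2 y)) x v = row_mx ('d F1 x v) ('d F2 x v).
Proof.
move=> d1 d2.
have dF : differentiable (fun y => row_mx (F1 y) (F2 y)) x.
  apply: differentiable_rV => j; rewrite -[j]splitK; case: (fintype.split j) => i /=.
    by under eq_fun do rewrite row_mxEl; exact: differentiable_rV_coord.
  by under eq_fun do rewrite row_mxEr; exact: differentiable_rV_coord.
split=> //; apply/rowP => j; apply: (etrans (diff_rV_coord v j dF)).
rewrite -[j]splitK; case: (fintype.split j) => i /=.
  under eq_fun do rewrite row_mxEl; rewrite row_mxEl.
  by apply/esym; apply: diff_rV_coord.
under eq_fun do rewrite row_mxEr; rewrite row_mxEr.
by apply/esym; apply: diff_rV_coord.
Qed.

Lemma diff_partial (W : normedModType R) n1 n2 (M : 'rV[R]_(n1 + n2) -> W) a x u w :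
  differentiable M (row_mx a x) ->
  'd M (row_mx a x) (row_mx u w) =
  'd (fun a' => M (row_mx a' x)) a u + 'd (fun x' => M (row_mx a x')) x w.
Proof.
move=> dM.
have da : differentiable (@id 'rV[R]_n1) a by exact: ex_diff.
have dx : differentiable (@id 'rV[R]_n2) x by exact: ex_diff.
have [d1 E1] := @diff_row_mx _ _ _ (@id 'rV[R]_n1) (cst x) a u da (differentiable_cst _ _).
have [d2 E2] := @diff_row_mx _ _ _ (cst a) (@id 'rV[R]_n2) x w (differentiable_cst _ _) dx.
rewrite !diff_val in E1 E2.
have F1 := diff_comp_at u d1 dM; have F2 := diff_comp_at w d2 dM.
rewrite E1 in F1; rewrite E2 in F2.
apply: etrans (congr2 +%R (esym F1) (esym F2)); rewrite -linearD add_row_mx.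
by rewrite addr0 add0r.
Qed.

Lemma is_derive_flow_affine (g : 'rV[R]_d -> 'rV[R]_d) phi x (t b : R) : is_flow g phi ->
  is_derive (0 : R) 1 (fun s => phi (t + s * b) x) (b *: g (phi t x)).
Proof.
move=> Hphi.
apply/(is_derive1_rV (fun s => phi (t + s * b) x) (fun _ => b *: g (phi t x))) => j.
have dphi (u : R) : is_derive u 1 (fun u => phi u x ord0 j) (g (phi u x) ord0 j).
  move: j; apply/(is_derive1_rV (phi^~ x) (fun u => g (phi u x)) u).
  by have [_ H] := Hphi x; exact: H.
have dm : is_derive (0 : R) 1 (fun s : R => t + s * b) b.
  have := @is_deriveD R R R (cst t) (b \*: id) 0 1 0 (b *: 1) (is_derive_cst _ _ _)
     (@is_deriveZ R R R id b 0 1 1 (is_derive_id _ _)).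
  rewrite add0r [b *: 1]mulr1; congr (is_derive _ _ _ _).
  by apply/funext => u /=; rewrite mulrC.
have := @is_derive1_comp R (fun u => phi u x ord0 j) (fun s => t + s * b) 0 _ _ (dphi _) dm.
by rewrite mul0r addr0 !mxE mulrC.
Qed.

Section orbit_step.
Context (p : nat) (i : 'I_p) (g h h' : 'rV[R]_d -> 'rV[R]_d) (phi : R -> 'rV[R]_d -> 'rV[R]_d).
Hypotheses (Dg : D g) (Dh : D_diffeo D h) (Dh' : D_diffeo D h').
Hypotheses (Hphi : is_flow g phi).
Context (F : 'rV[R]_p -> 'rV[R]_d).
Hypothesis HF : Cg al k.+1 F.

(** The conjugated flow as one map of (time, point): a step of the parametrization is M composed
    with the pair formed by the i-th coordinate and the map built so far. *)
Let M (z : 'rV[R]_(1 + d)) := h (phi (z ord0 (lshift d ord0)) (h' (rsubmx z))).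
Definition orbit_step (t : 'rV[R]_p) : 'rV[R]_d := h (phi (t ord0 i) (h' (F t))).

Lemma orbit_step_mixed_Cg : Cg al k.+1 M.
Proof.
have [Hg lg bg] := HD Dg.
have HJ := flow_joint_Cg al01 Hg lg Hphi bg.
have H1 : Cg al k.+1 (fun z : 'rV[R]_(1 + d) => row_mx (lsubmx z) (h' (rsubmx z))).
  apply: Cg_row_mx; first exact: Cg_lsubmx.
  have Hr := @Cg_rsubmx R al al01 k.+1 1 d.
  have Hc := Cg_comp al01 (ltn0Sn k) Hr (D_diffeo_Cg Dh').
  exact: Hc.
have := Cg_comp al01 (ltn0Sn _) (Cg_comp al01 (ltn0Sn _) H1 HJ) (D_diffeo_Cg Dh).
congr (Cg _ _ _); apply/funext => z /=.
by rewrite /M row_mxEl row_mxKr mxE.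
Qed.

Let N (t : 'rV[R]_p) : 'rV[R]_1 := t *m delta_mx i ord0.

Lemma orbit_step_proj t : N t ord0 ord0 = t ord0 i.
Proof.
rewrite mxE (bigD1 i)//= big1 ?addr0; first by rewrite mxE !eqxx mulr1.
by move=> j ji; rewrite mxE (negbTE ji) mulr0.
Qed.

Lemma orbit_step_decomp : orbit_step = M \o (fun t => row_mx (N t) (F t)).
Proof.
apply/funext => t; rewrite /orbit_step /M /=.
by rewrite row_mxEl row_mxKr orbit_step_proj.
Qed.

Lemma Cg_orbit_step : Cg al k.+1 orbit_step.
Proof.
rewrite orbit_step_decomp.
have HN : Cg al k.+1 (fun t => row_mx (N t) (F t)).
  apply: Cg_row_mx => //.
  by apply: (@Cg_linear _ _ al01 _ _ _ _ (delta_mx i ord0) 0) => t; rewrite addr0.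
exact: (Cg_comp al01 (ltn0Sn _) HN orbit_step_mixed_Cg).
Qed.

(** The time derivative of the flow is g at the end point, so the first term has the shape of a
    generator of P_D at the new point. The second is the image of dF by the differential of a
    D-diffeomorphism when h' is the inverse factor. Both thus lie in P_D. *)
Lemma diff_orbit_step t v : 'd orbit_step t v =
  v ord0 i *: 'd h (phi (t ord0 i) (h' (F t))) (g (phi (t ord0 i) (h' (F t)))) +
  'd (h \o (phi (t ord0 i) \o h')) (F t) ('d F t v).
Proof.
have dF := Cg_differentiable al01 t (ltn0Sn _) HF.
have HN : Cg al k.+1 N.
  by apply: (@Cg_linear _ _ al01 _ _ _ _ (delta_mx i ord0) 0) => u; rewrite addr0.
have dN := Cg_differentiable al01 t (ltn0Sn _) HN.
have dM z := Cg_differentiable al01 z (ltn0Sn _) orbit_step_mixed_Cg.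
have [dNF ENF] := diff_row_mx v dN dF.
have E1 := diff_comp_at v dNF (dM _); rewrite ENF in E1.
rewrite orbit_step_decomp; apply: (etrans E1).
set m := fun a : 'rV[R]_1 => M (row_mx a (F t)); set a := N t; set u := 'd N t v.
have Nv : u = N v.
  have LN : linear N by move=> c x y; rewrite /N mulmxDl scalemxAl.
  pose N' : {linear 'rV[R]_p -> 'rV[R]_1} := HB.pack N (GRing.isLinear.Build _ _ _ _ N LN).
  have cN : continuous N'.
    by move=> x; apply: differentiable_continuous; exact: (Cg_differentiable al01 x (ltn0Sn _) HN).
  exact: (congr1 (fun f : 'rV[R]_p -> 'rV[R]_1 => f v) (diff_lin t cN)).
(* The curve s |-> m(a + s u) is also h applied to the flow at time t_i + s v_i; its derivative at s
   = 0 is computed both ways and compared. *)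
have T1 : 'd m a u =
    v ord0 i *: 'd h (phi (t ord0 i) (h' (F t))) (g (phi (t ord0 i) (h' (F t)))).
  have dm : differentiable m a.
    have da : differentiable (@id 'rV[R]_1) a by exact: ex_diff.
    have [d1 _] := @diff_row_mx _ _ _ (@id 'rV[R]_1) (cst (F t)) a u da (differentiable_cst _ _).
    exact: (differentiable_comp d1 (dM _)).
  have L1 : is_derive (0 : R) 1 (fun s => m (a + s *: u)) ('D_u m (a + 0 *: u)).
    by apply: is_derive_line; rewrite scale0r addr0.
  have c0 : phi (t ord0 i + 0 * v ord0 i) (h' (F t)) = phi (t ord0 i) (h' (F t)).
    by rewrite mul0r addr0.
  have L2 := @is_derive_curve _ _ _ h (fun s => phi (t ord0 i + s * v ord0 i) (h' (F t))) _ 0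
    (D_diffeo_differentiable _ Dh) (is_derive_flow_affine (h' (F t)) (t ord0 i) (v ord0 i) Hphi).
  rewrite c0 in L2.
  have mE : (fun s : R => m (a + s *: u)) =
      (fun s => h (phi (t ord0 i + s * v ord0 i) (h' (F t)))).
    apply/funext => s; rewrite /m /M row_mxEl row_mxKr Nv [in LHS]mxE [in X in _ + X]mxE.
    by rewrite !orbit_step_proj.
  rewrite mE in L1.
  have E := etrans (esym (@derive_val _ _ _ _ _ _ _ L1)) (@derive_val _ _ _ _ _ _ _ L2).
  rewrite scale0r addr0 linearZ in E.
  exact: (etrans (esym (deriveE _ dm)) E).
have T2 : (fun x => M (row_mx (N t) x)) = h \o (phi (t ord0 i) \o h').
  by apply/funext => x; rewrite /M row_mxEl row_mxKr orbit_step_proj.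
have E2 := diff_partial u ('d F t v) (dM (row_mx (N t) (F t))).
rewrite T2 in E2; apply: (etrans E2).
by rewrite -/m -/a T1.
Qed.

End orbit_step.

(* Sussmann's parametrization of the orbit (see the header). *)
Lemma orbit_parametrization p y (b : 'I_p -> 'rV[R]_d) :
  (forall i, PD_generators y (b i)) -> exists F : 'rV[R]_p -> 'rV[R]_d,
  [/\ Cg al k.+1 F, F 0 = y,
    forall t, exists2 h, D_diffeo D h & F t = h y,
    forall t v, PD D (F t) ('d F t v) &
    forall v, 'd F 0 v = \sum_i v ord0 i *: b i].
Proof.
move=> Hb.
(* The statement is generalized to a list of indices, F remaining a function of all p coordinates,
   so that the flows can be composed one at a time. *)
suff H (l : seq 'I_p) : exists F : 'rV[R]_p -> 'rV[R]_d,
  [/\ Cg al k.+1 F, F 0 = y,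
    forall t, exists2 h, D_diffeo D h & F t = h y,
    forall t v, PD D (F t) ('d F t v) &
    forall v, 'd F 0 v = \sum_(i <- l) v ord0 i *: b i].
  exact: H.
elim: l => [|i l [F [HF F0 FD FP Fb]]].
  exists (cst y); split => //.
  - by apply: (@Cg_linear _ _ al01 _ _ _ _ 0 y) => t; rewrite mulmx0 add0r.
  - by exists id; first exact: D_diffeo_id.
  - by move=> t v; rewrite diff_val; exact: PD0.
  - by move=> v; rewrite diff_val big_nil.
have [h [w [g [Dh hw Dg bE]]]] := Hb i.
have [h' [Dh' h'K hK]] := D_diffeo_inv Dh.
have [Hg lg bg] := HD Dg.
have [phi Hphi] := flow_exists lg.
have dE := diff_orbit_step i Dg Dh Dh' Hphi HF.
have DX s : D_diffeo D (h \o (phi s \o h')).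
  by apply/D_diffeo_trans/D_diffeo_trans => //; exact: D_diffeo_flow Hphi.
exists (orbit_step i h h' phi F); split.
- exact: (Cg_orbit_step i Dg Dh Dh' Hphi HF).
- by rewrite /orbit_step mxE F0; have [-> _] := Hphi (h' y).
- move=> t; have [h1 Dh1 E] := FD t.
  exists ((h \o (phi (t ord0 i) \o h')) \o h1); first exact: D_diffeo_trans.
  by rewrite /orbit_step E.
- move=> t v; rewrite dE; apply: PD_lin; first exact: PD_generator.
  by have := PD_invariant (DX (t ord0 i)) (FP t v).
- move=> v; rewrite dE big_cons Fb mxE F0.
  have phi0 x : phi 0 x = x by have [-> _] := Hphi x.
  have -> : h \o (phi 0 \o h') = id by apply/funext => x /=; rewrite phi0.
  have hy : h' y = w by rewrite -hw h'K.
  have did u : 'd (@id 'rV[R]_d) y u = u by rewrite diff_val.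
  by apply: congr2 (did _); rewrite (phi0 (h' y)) hy bE.
Qed.

End diffeos.

(** * Local inversion *)

Section local_inverse.
Context {R : realType} (al : R).
Hypothesis al01 : 0 < al <= 1.

Definition jacobian n m (f : 'rV[R]_n -> 'rV[R]_m) (x : 'rV[R]_n) : 'M[R]_(n, m) :=
  \matrix_(i, j) 'D_(delta_mx ord0 i) (fun x => f x ord0 j) x.

Lemma diff_jacobian n m (f : 'rV[R]_n -> 'rV[R]_m) x w : differentiable f x ->
  'd f x w = w *m jacobian f x.
Proof.
move=> df; apply/rowP => j; apply: (etrans (diff_coord_basis w j df)).
by rewrite [RHS]mxE; apply: eq_bigr => i _; rewrite [in RHS]mxE.
Qed.

Lemma Ck_jacobian k n m (f : 'rV[R]_n -> 'rV[R]_m) r i j : Cg al k.+1 f ->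
  Ck al (ball 0 r) k (fun x => jacobian f x i j).
Proof.
move=> Hf; have := Ck_derive (delta_mx ord0 i) (Hf r j).
by congr (Ck _ _ _ _); apply/funext => x; rewrite mxE.
Qed.

Section contraction.
Context (k p : nat) (f : 'rV[R]_p -> 'rV[R]_p) (J : 'rV[R]_p -> 'M[R]_p) (r C1 : R).
Hypotheses (r0 : 0 < r) (C10 : 0 <= C1).
Hypothesis df : forall x, differentiable f x.
Hypothesis fJ : forall x w, 'd f x w = w *m J x.
Hypothesis J_taylor : forall a b : 'rV[R]_p, ball 0 r a -> ball 0 r b ->
  `|f a - f b - (a - b) *m J b| <= C1 * `|a - b| `^ (1 + al).
Hypothesis J_near1 : forall x w : 'rV[R]_p, ball 0 r x -> `|w *m J x - w| <= `|w| / 2.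
Hypothesis detJ : forall x : 'rV[R]_p, ball 0 r x -> 2^-1 <= `|\det (J x)|.
Hypothesis CkJ : forall i j, Ck al (ball 0 r) k (fun x => J x i j).

(** f minus the identity is a contraction of ratio 1/2. The mean value theorem is used on each
    coordinate in the maximum norm, which costs no dimensional factor. *)
Lemma perturbation_half (a b : 'rV[R]_p) : ball 0 r a -> ball 0 r b ->
  `|(f a - a) - (f b - b)| <= `|a - b| / 2.
Proof.
move=> ra rb; apply: rV_norm_le => [|j]; first by rewrite divr_ge0.
have H (s : R) : 0 <= s <= 1 ->
    is_derive s 1 (fun s => f (b + s *: (a - b)) ord0 j - s * (a - b) ord0 j)
     (((a - b) *m J (b + s *: (a - b)) - (a - b)) ord0 j).
  move=> s01; have dj := differentiable_rV_coord j (df (b + s *: (a - b))).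
  have L1 := is_derive_line dj.
  have E : 'D_(a - b) (fun x => f x ord0 j) (b + s *: (a - b)) =
     ((a - b) *m J (b + s *: (a - b))) ord0 j.
    rewrite -fJ; apply: (etrans (deriveE _ dj)); apply/esym; apply: diff_rV_coord.
    exact: df.
  rewrite E in L1.
  have L2 : is_derive s 1 (fun s : R => s * (a - b) ord0 j) ((a - b) ord0 j).
    have := @is_deriveZ R R R id ((a - b) ord0 j) s 1 1 (is_derive_id _ _).
    rewrite [_ *: 1]mulr1; congr (is_derive _ _ _ _).
    by apply/funext => u; rewrite mulrC.
  have := @is_deriveB R R R _ _ s 1 _ _ L1 L2; congr (is_derive _ _ _ _).
  by rewrite [RHS]mxE [in X in _ = _ + X]mxE.
have [s s01 E] := mean_value01 H.
have -> : (f a - a - (f b - b)) ord0 j =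
    f (b + 1 *: (a - b)) ord0 j - 1 * (a - b) ord0 j -
     (f (b + 0 *: (a - b)) ord0 j - 0 * (a - b) ord0 j).
  rewrite scale1r scale0r addr0 [b + _]addrC subrK !mxE; ring.
rewrite E (le_trans (mx_norm_coord _ _ _))//; apply: J_near1.
exact: segment_closed_ball.
Qed.

Lemma local_expansion (a b : 'rV[R]_p) : ball 0 r a -> ball 0 r b -> `|a - b| <= 2 * `|f a - f b|.
Proof.
move=> ra rb; have H := perturbation_half ra rb.
have := ler_normB (f a - f b) ((f a - a) - (f b - b)).
have -> : f a - f b - (f a - a - (f b - b)) = a - b.
  by apply/rowP => j; rewrite !mxE; ring.
lra.
Qed.

Let u z n := iter n (fun x => x + (z - f x)) 0.

(** The iteration x |-> x + (z - f x) is Newton's method with the derivative frozen at the identity.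
    Steps are halved each time, so the iterates stay within 2 |z - f 0| < r / 4 of the origin,
    inside the ball where the contraction holds. *)
Lemma newton_bound z n : `|z - f 0| < r / 8 ->
  `|u z n| <= 2 * `|z - f 0| * (1 - 2^-1 ^+ n) /\
  `|u z n.+1 - u z n| <= `|z - f 0| / 2 ^+ n.
Proof.
move=> zr; have e0 := normr_ge0 (z - f 0); set e := `|z - f 0| in zr e0 *.
have small (x : 'rV[R]_p) : `|x| <= 2 * e -> ball 0 r x by move=> H; apply/ball0E; lra.
have pw m : 0 <= (2^-1 : R) ^+ m <= 1.
  by rewrite exprn_ge0 ?invr_ge0//= exprn_ile1 ?invr_ge0// invf_le1// ler1n.
have in2 m : 2 * e * (1 - 2^-1 ^+ m) <= 2 * e.
  by rewrite ler_piMr ?mulr_ge0// gerBl; have /andP[] := pw m.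
elim: n => [|n [IH1 IH2]].
  by rewrite /u /= subr0 normr0 expr0 subrr mulr0 divr1 add0r.
have N1 : `|u z n.+1| <= 2 * e * (1 - 2^-1 ^+ n.+1).
  have -> : u z n.+1 = u z n + (u z n.+1 - u z n) by rewrite addrCA subrr addr0.
  rewrite (le_trans (ler_normD _ _))// (le_trans (lerD IH1 IH2))// exprS -exprVn.
  by rewrite le_eqVlt; apply/orP; left; apply/eqP; field.
split=> //.
have -> : u z n.+2 - u z n.+1 = - ((f (u z n.+1) - u z n.+1) - (f (u z n) - u z n)).
  rewrite {1}/u [iter _ _ _]iterS -/(u z n.+1).
  have {2 3}-> : u z n.+1 = u z n + (z - f (u z n)) by [].
  by apply/rowP => j; rewrite !mxE; ring.
rewrite normrN (le_trans (perturbation_half _ _))//.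
- by apply: small; rewrite (le_trans N1)// in2.
- by apply: small; rewrite (le_trans IH1)// in2.
by rewrite exprS invfM mulrCA [leRHS]mulrC ler_pM2r ?invr_gt0.
Qed.

Definition inverse_branch z := rV_lim (u z).

Lemma inverse_branchP z : `|z - f 0| < r / 8 ->
  ball 0 r (inverse_branch z) /\ f (inverse_branch z) = z.
Proof.
move=> zr; have e0 := normr_ge0 (z - f 0).
have H n : `|u z n.+1 - u z n| <= `|z - f 0| / 2 ^+ n by have [] := newton_bound n zr.
have L := geometric_limit H.
have pw m : 0 <= (2^-1 : R) ^+ m by rewrite exprn_ge0 ?invr_ge0.
have rU : ball 0 r (inverse_branch z).
  have := L 0%N; rewrite /u /= sub0r normrN expr0 divr1 => L0.
  apply/ball0E; rewrite /inverse_branch /u; lra.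
split=> //; apply/eqP; rewrite -subr_eq0 -normr_le0.
apply: (@le_half_pow0 R _ (4 * `|z - f 0|)) => n.
have rn : ball 0 r (u z n).
  have [N1 _] := newton_bound n zr; apply/ball0E; apply: (le_lt_trans N1).
  have : 2 * `|z - f 0| * (1 - 2^-1 ^+ n) <= 2 * `|z - f 0|.
    by rewrite ler_piMr ?mulr_ge0// gerBl.
  lra.
have P := perturbation_half rU rn; have Ln := L n; have Hn := H n.
set U := inverse_branch z in rU P *; rewrite distrC -/U in Ln.
(* Each of the three differences is O(2^-n), so f U - z vanishes. *)
have -> : f U - z = ((f U - U) - (f (u z n) - u z n)) + (U - u z n) - (u z n.+1 - u z n).
  have -> : u z n.+1 = u z n + (z - f (u z n)) by [].
  by apply/rowP => j; rewrite !mxE; ring.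
rewrite (le_trans (ler_normB _ _))// (le_trans (lerD (ler_normD _ _) Hn))//.
have -> : 4 * `|z - f 0| / 2 ^+ n = 2 * (2 * `|z - f 0| / 2 ^+ n).
  by rewrite !mulrA; congr (_ * _ * _); ring.
have -> : `|z - f 0| / 2 ^+ n = (2 * `|z - f 0| / 2 ^+ n) / 2 by field; rewrite gt_eqF// exprn_gt0.
lra.
Qed.

Let B := ball (f 0) (r / 8).

Lemma inverse_branch_ball z : B z -> ball 0 r (inverse_branch z) /\ f (inverse_branch z) = z.
Proof.
by move=> Bz; apply: inverse_branchP; move: Bz; rewrite /B -ball_normE /= distrC.
Qed.

Lemma inverse_branch_lip : lip_on B inverse_branch.
Proof.
exists 2 => // a b /inverse_branch_ball[ra fa] /inverse_branch_ball[rb fb].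
by rewrite -{2}fa -{2}fb; exact: local_expansion.
Qed.

Lemma J_expand (x w : 'rV[R]_p) : ball 0 r x -> `|w| <= 2 * `|w *m J x|.
Proof.
move=> rx; have := J_near1 w rx.
have := ler_normB (w *m J x) (w *m J x - w); rewrite opprB addrCA subrr addr0; lra.
Qed.

Lemma J_unit (x : 'rV[R]_p) : ball 0 r x -> J x \in unitmx.
Proof.
by move=> rx; rewrite unitmxE unitfE -normr_gt0 (lt_le_trans _ (detJ rx)).
Qed.

(** Multiplied by J x, the error of the candidate derivative becomes, up to sign, the Taylor
    remainder of f at x. J x shrinks vectors by at most a factor 2, and the displacement y - x is at
    most 2 |h|, so the error is O(|h|^(1 + al)). *)
Lemma diff_inverse_branch z : B z -> differentiable inverse_branch z /\
  forall v, 'd inverse_branch z v = v *m invmx (J (inverse_branch z)).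
Proof.
move=> Bz; have [rx fx] := inverse_branch_ball Bz.
set x := inverse_branch z in rx fx *.
have [a0 a1] := andP al01.
apply: (@diff_of_estimate _ _ _ inverse_branch z (fun v => v *m invmx (J x)) 2).
- by move=> c a b; rewrite mulmxDl scalemxAl.
- move=> h; rewrite (le_trans (J_expand _ rx))// -mulmxA mulVmx ?J_unit//.
  by rewrite mulmx1.
move=> e e0.
have K0 : 0 <= 2 * C1 * 2 `^ (1 + al) by rewrite !mulr_ge0// powR_ge0.
have [s s0 Hs] := @powR_small R al (e / (2 * C1 * 2 `^ (1 + al) + 1)) a0
  (divr_gt0 e0 (ltr_wpDl K0 ltr01)).
have oB : open B by exact: ball_open.
have /nbhs_ballP[s' /= s'0 Hs'] : nbhs z B by exact: open_nbhs_nbhs.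
exists (Num.min s s') => [|h]; first by rewrite lt_min s0.
rewrite lt_min => /andP[hs hs'].
have Bzh : B (z + h).
  by apply: Hs'; rewrite -ball_normE /= opprD addrA subrr sub0r normrN.
have [ry fy] := inverse_branch_ball Bzh; set y := inverse_branch (z + h) in ry fy *.
rewrite (le_trans (J_expand _ rx))//.
have -> : (y - x - h *m invmx (J x)) *m J x = - (f y - f x - (y - x) *m J x).
  rewrite mulmxBl -mulmxA mulVmx ?J_unit// mulmx1 fy fx opprB; congr (_ - _).
  by rewrite addrAC subrr add0r.
rewrite normrN.
have yx : `|y - x| <= 2 * `|h|.
  by have := local_expansion ry rx; rewrite fy fx addrAC subrr add0r.
apply: (@le_trans _ _ (2 * (C1 * (2 * `|h|) `^ (1 + al)))).
  rewrite ler_wpM2l// (le_trans (J_taylor ry rx))// ler_wpM2l//.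
  by apply: ge0_ler_powR; rewrite ?nnegrE// ?mulr_ge0// addr_ge0// ltW.
rewrite powRM// [`|h| `^ _]powRD ?powRr1//; last by apply/implyP; rewrite gt_eqF// ltr_wpDl.
have -> : 2 * (C1 * (2 `^ (1 + al) * (`|h| * `|h| `^ al))) =
   (2 * C1 * 2 `^ (1 + al)) * `|h| `^ al * `|h| by ring.
rewrite ler_wpM2r//.
apply: (le_trans _ (mul_divr_succ_le K0 (ltW e0))).
by rewrite ler_wpM2l// Hs.
Qed.

(** Bootstrap: the derivatives of the inverse are [Q] composed with the inverse, where [Q] is the
    inverse Jacobian written by Cramer's rule, of class k because the determinant stays at least 1/2
    in absolute value. An inverse of class l thus has derivatives of class l, for l <= k. *)
Lemma Ck_inverse_branch j : Ck al B k.+1 (fun z => inverse_branch z ord0 j).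
Proof.
have oB : open B by exact: ball_open.
have cB : segment_closed B by exact: segment_closed_ball.
have or : open (ball (0 : 'rV[R]_p) r) by exact: ball_open.
have cr : segment_closed (ball (0 : 'rV[R]_p) r) by exact: segment_closed_ball.
have bd j0 : exists2 C : R, 0 <= C & forall a, B a -> `|inverse_branch a ord0 j0| <= C.
  exists r; first exact: ltW.
  move=> a /inverse_branch_ball[/ball0E ra _].
  by rewrite (le_trans (mx_norm_coord _ _ _))// ltW.
pose Q (v : 'rV[R]_p) j0 (x : 'rV[R]_p) : R :=
  \sum_i v ord0 i * ((\det (J x))^-1 * cofactor (J x) j0 i).
have CkQ v j0 : Ck al (ball 0 r) k (Q v j0).
  apply: Ck_sum => // i _; apply: (CkZ al01) => //; apply: (CkM al01) => //.
    apply: (@Ck_inv _ _ al01 _ _ or cr _ _ 2^-1) => //; exact: Ck_det.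
  apply: (CkZ al01) => //; apply: (Ck_det al01) => // i1 j1.
  by have := CkJ (lift j0 i1) (lift i j1); congr (Ck _ _ _ _); apply/funext => x; rewrite !mxE.
have DQ v j0 z : B z ->
    Q v j0 (inverse_branch z) = 'D_v (fun z => inverse_branch z ord0 j0) z.
  move=> Bz; have [dz dE] := diff_inverse_branch Bz; have [rx _] := inverse_branch_ball Bz.
  rewrite deriveE; last exact: differentiable_rV_coord.
  apply: (etrans _ (diff_rV_coord v j0 dz)); rewrite dE mxE; apply: eq_bigr => i _.
  by rewrite /invmx J_unit// !mxE.
suff H l : (l <= k.+1)%N -> forall j, Ck al B l (fun z => inverse_branch z ord0 j).
  exact: H.
elim: l => [_ j0|l IH lk j0].
  apply: (lip_hoelder al01) => //.
  have [L L0 HL] := inverse_branch_lip; exists L => // a b Ba Bb.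
  by rewrite (le_trans (mx_norm_coordB _ _ _))// HL.
split=> //.
  by move=> z Bz; apply: differentiable_rV_coord; have [] := diff_inverse_branch Bz.
move=> v; apply: (@Ck_eq _ _ _ _ _ (Q v j0 \o inverse_branch)) => //.
  by move=> z Bz; exact: DQ.
apply: (Ck_comp al01 oB cB inverse_branch_lip (W := ball 0 r)).
- by move=> z /inverse_branch_ball[].
- by move=> j1; apply: IH; exact: ltnW.
- exact: (Ck_le al01 cr _ (CkQ v j0)).
Qed.

End contraction.

Theorem local_inverse k p (f : 'rV[R]_p -> 'rV[R]_p) : Cg al k.+1 f ->
  (forall w, 'd f 0 w = w) ->
  exists r rho (Psi : 'rV[R]_p -> 'rV[R]_p), [/\ 0 < r /\ 0 < rho,
    forall a b, ball 0 r a -> ball 0 r b -> `|a - b| <= 2 * `|f a - f b|,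
    forall a, ball 0 r a -> injective ('d f a),
    forall z, ball (f 0) rho z -> ball 0 r (Psi z) /\ f (Psi z) = z &
    forall j, Ck al (ball (f 0) rho) k.+1 (fun z => Psi z ord0 j)].
Proof.
move=> Hf df0; have Hf1 : Cg al 1 f := Cg_le al01 (ltn0Sn k) Hf.
have df x : differentiable f x := Cg_differentiable al01 x (ltn0Sn k) Hf.
have fJ x w : 'd f x w = w *m jacobian f x by exact: diff_jacobian.
have [a0 _] := andP al01.
have [C C0 HC] : exists2 C : R, 0 <= C & forall x y w, ball 0 1 x -> ball 0 1 y ->
    `|'d f x w - 'd f y w| <= C * `|x - y| `^ al * `|w|.
  apply: (diff_hoelder al01 Hf1) => i l.
  have [C C0 [_ HC]] := Ck_derive (delta_mx ord0 i) (Hf1 1 l).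
  by exists C.
have [C1 C10 HC1] := Cg1_taylor al01 1 Hf1.
have [C2 C20 [_ HC2]] : Ck al (ball 0 1) 0 (fun x => \det (jacobian f x)).
  apply: (Ck_det al01); [exact: ball_open|exact: segment_closed_ball|].
  by move=> i j; exact: Ck_jacobian.
have J0 : jacobian f 0 = 1%:M.
  apply/row_matrixP => i; rewrite !rowE -fJ df0 mulmx1 //.
have h2 : 0 <= (2^-1 : R) by rewrite invr_ge0.
(* For |x| < r1 the Jacobian moves a vector w by at most |w| / 2, and for |x| < r2 its determinant
   differs from 1 by at most 1/2; at 0 it is the identity. *)
have [r1 r10 Hr1] := powR_small a0 (divr_gt0 (divr_gt0 ltr01 (ltr0Sn R 1)) (ltr_wpDl C0 ltr01)).
have [r2 r20 Hr2] := powR_small a0 (divr_gt0 (divr_gt0 ltr01 (ltr0Sn R 1)) (ltr_wpDl C20 ltr01)).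
pose r := Num.min 1 (Num.min r1 r2).
have r0 : 0 < r by rewrite !lt_min ltr01 r10 r20.
have Br (x : 'rV[R]_p) : ball 0 r x -> [/\ ball 0 1 x, `|x| < r1 & `|x| < r2].
  by move=> /ball0E; rewrite !lt_min => /and3P[? ? ?]; split=> //; apply/ball0E.
have b0 : ball (0 : 'rV[R]_p) 1 0 by apply/ball0E; rewrite normr0.
have J_taylor (a b : 'rV[R]_p) : ball 0 r a -> ball 0 r b ->
    `|f a - f b - (a - b) *m jacobian f b| <= C1 * `|a - b| `^ (1 + al).
  by move=> /Br[ra _ _] /Br[rb _ _]; rewrite -fJ; exact: HC1.
have J_near1 (x w : 'rV[R]_p) : ball 0 r x -> `|w *m jacobian f x - w| <= `|w| / 2.
  move=> /Br[rx rx1 _]; have := HC x 0 w rx b0.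
  have E : 'd f x w - 'd f 0 w = w *m jacobian f x - w.
    exact: (congr2 (fun a b => a - b) (fJ x w) (df0 w)).
  rewrite E subr0 => /le_trans; apply.
  rewrite [leRHS]mulrC ler_wpM2r// (le_trans _ (mul_divr_succ_le C0 h2))// ler_wpM2l//.
  by rewrite -[2^-1]mul1r Hr1.
have detJ (x : 'rV[R]_p) : ball 0 r x -> 2^-1 <= `|\det (jacobian f x)|.
  move=> /Br[rx _ rx2]; have := HC2 x 0 rx b0; rewrite J0 det1 subr0 => H.
  have H' : `|\det (jacobian f x) - 1| <= 2^-1.
    rewrite (le_trans H)// (le_trans _ (mul_divr_succ_le C20 h2))// ler_wpM2l//.
    by rewrite -[2^-1]mul1r Hr2.
  have := ler_normB (\det (jacobian f x)) (\det (jacobian f x) - 1).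
  rewrite opprB addrCA subrr addr0 normr1; lra.
have CkJ i j : Ck al (ball 0 r) k (fun x => jacobian f x i j) by exact: Ck_jacobian.
exists r, (r / 8), (inverse_branch f); split=> //.
- by rewrite divr_gt0.
- exact: (local_expansion df fJ J_near1).
- move=> a ra u v Euv; have E := etrans (esym (fJ a u)) (etrans Euv (fJ a v)).
  apply/eqP; rewrite -subr_eq0 -normr_le0.
  by rewrite (le_trans (J_expand J_near1 _ ra))// mulmxBl E subrr normr0 mulr0.
- exact: (inverse_branch_ball df fJ J_near1).
- exact: (Ck_inverse_branch r0 C10 df fJ J_taylor J_near1 detJ CkJ).
Qed.

End local_inverse.

(** * Charts of the orbit *)

Section chart.
Context {R : realType} (al : R) (k d : nat) (D : set ('rV[R]_d -> 'rV[R]_d)).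
Hypothesis al01 : 0 < al <= 1.
Hypothesis HD : forall g, D g -> [/\ Cg al k.+1 g, lip_on setT g &
  exists2 C : R, 0 <= C & forall x, `|g x| <= C].

Lemma free_right_inverse n (b : n.-tuple 'rV[R]_d) : free b ->
  exists A : 'M[R]_(d, n), forall w : 'rV[R]_n, (\sum_i w ord0 i *: tnth b i) *m A = w.
Proof.
move=> fb; pose B : 'M[R]_(n, d) := \matrix_i tnth b i.
have wB (w : 'rV[R]_n) : w *m B = \sum_i w ord0 i *: tnth b i.
  by rewrite mulmx_sum_row; apply: eq_bigr => i _; rewrite rowK.
have /row_freeP[A BA] : row_free B.
  apply: inj_row_free => v; rewrite wB => v0; apply/rowP => i; rewrite mxE.
  have S0 : \sum_(i < n) v ord0 i *: b`_i = 0.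
    by rewrite -[RHS]v0; apply: eq_bigr => j _; rewrite (tnth_nth 0).
  by have := (freeP fb) _ S0 i; rewrite [ord0]ord1.
by exists A => w; rewrite -wB -mulmxA BA mulmx1.
Qed.

Lemma diff_mulmx n m (A : 'M[R]_(n, m)) (x v : 'rV[R]_n) :
  differentiable (fun x : 'rV[R]_n => x *m A) x /\ 'd (fun x : 'rV[R]_n => x *m A) x v = v *m A.
Proof.
have HN : Cg 1 1 (fun x : 'rV[R]_n => x *m A).
  apply: (@Cg_linear _ 1 _ _ _ _ _ A 0); first by rewrite ltr01 lexx.
  by move=> t; rewrite addr0.
have dN x' : differentiable (fun x : 'rV[R]_n => x *m A) x'.
  by apply: Cg_differentiable (ltn0Sn _) HN; rewrite ltr01 lexx.
split; first exact: dN.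
have LN : linear (fun x : 'rV[R]_n => x *m A) by move=> c u w; rewrite mulmxDl scalemxAl.
pose N' : {linear 'rV[R]_n -> 'rV[R]_m} := HB.pack (fun x : 'rV[R]_n => x *m A)
  (GRing.isLinear.Build _ _ _ _ (fun x : 'rV[R]_n => x *m A) LN).
have cN : continuous N' by move=> x'; exact: differentiable_continuous.
exact: (congr1 (fun f : 'rV[R]_n -> 'rV[R]_m => f v) (diff_lin x cN)).
Qed.

(** [Psi] is regular on a whole ball of the ambient space, not just inverse to [Phi] on the image:
    the Lip-gamma estimate on the image will be a restriction from that convex ball. *)
Theorem orbit_chart p y : vdim (PD D y) p ->
  exists (Phi : 'rV[R]_p -> 'rV[R]_d) (Psi : 'rV[R]_d -> 'rV[R]_p) (rho : R),
  [/\ Cg al k.+1 Phi /\ forall j, Ck al (ball y rho) k.+1 (fun z => Psi z ord0 j),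
    forall u, eball u -> ball y rho (Phi u) /\ Psi (Phi u) = u,
    Phi 0 = y,
    forall u, Dorbit D y (Phi u) &
    forall u, eball u -> range ('d Phi u) = PD D (Phi u)].
Proof.
move=> /PD_basis[b [sb fb bP bE bdim]].
have fb' : free (tcast sb (in_tuple b)) by rewrite val_tcast.
have [|F [HF F0 FD FP dF0]] := @orbit_parametrization R al k d D al01 HD p y
    (tnth (tcast sb (in_tuple b))).
  by move=> i; apply: bP; have := mem_tnth i (tcast sb (in_tuple b)); rewrite memtE val_tcast.
have [A HA] := free_right_inverse fb'.
(* [A] undoes t |-> sum_i t_i b_i, so f has the identity as differential at 0, the situation of
   [local_inverse]. *)
pose f t := F t *m A.
have HMA : Cg al k.+1 (fun z : 'rV[R]_d => z *m A).
  by apply: (@Cg_linear _ _ al01 _ _ _ _ A 0) => z; rewrite addr0.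
have Hf : Cg al k.+1 f by exact: (Cg_comp al01 (ltn0Sn k) HF HMA).
have dF t : differentiable F t := Cg_differentiable al01 t (ltn0Sn k) HF.
have dfE t w : 'd f t w = 'd F t w *m A.
  have [dA E] := diff_mulmx A (F t) ('d F t w).
  exact: (etrans (diff_comp_at w (dF t) dA) E).
have df0 w : 'd f 0 w = w.
  by apply: (etrans (dfE 0 w)); apply: (etrans (congr1 (fun x => x *m A) (dF0 w))); exact: HA.
have [r [rho [Psi0 [[r0 rho0] fexp finj fPsi CkPsi]]]] := local_inverse al01 Hf df0.
have [L L0 HL] := Cg_lip al01 (`|y| + 1) (ltn0Sn k) HMA.
(* [A] sends the ball of radius r2 about y into the domain of the local inverse; the cap 1 keeps
   this ball where L is a Lipschitz constant. *)
pose r2 := Num.min 1 (rho / (L + 1)).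
have r20 : 0 < r2 by rewrite lt_min ltr01 divr_gt0// ltr_wpDl.
have sub_r2 : ball y r2 `<=` ball 0 (`|y| + 1).
  move=> z yz; apply/ball0E; move: yz; rewrite -ball_normE /= => yz.
  have /andP[y1 _] : (`|y - z| < 1) && (`|y - z| < rho / (L + 1)) by rewrite -lt_min.
  have := ler_normB y (y - z); rewrite opprB addrCA subrr addr0; lra.
have A_r2 z : ball y r2 z -> ball (f 0) rho (z *m A).
  move=> yz; have z1 := sub_r2 _ yz.
  have y1 : ball 0 (`|y| + 1) y by apply/ball0E; rewrite ltrDl.
  move: yz; rewrite -!ball_normE /= lt_min => /andP[_ yz].
  rewrite /f F0 (le_lt_trans (HL _ _ y1 z1))//.
  apply: (@le_lt_trans _ _ ((L + 1) * `|y - z|)); first by rewrite ler_wpM2r// lerDl.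
  by rewrite mulrC -ltr_pdivlMr// ltr_wpDl.
have [LF LF0 HLF] := Cg_lip al01 1 (ltn0Sn k) HF.
(* Scaling by s brings the unit ball into the ball where f is injective, and its image under F into
   the ball of radius r2 about y. *)
pose s := Num.min 1 (Num.min r (r2 / (LF + 1))).
have s0 : 0 < s by rewrite !lt_min ltr01 r0 divr_gt0// ltr_wpDl.
have s_small (u : 'rV[R]_p) : eball u -> ball 0 r (s *: u) /\ ball y r2 (F (s *: u)).
  rewrite /eball /= => u1; have u1' := le_lt_trans (norm_le_enorm u) u1.
  have su : `|s *: u| < s by rewrite normrZ gtr0_norm// gtr_pMr.
  move: (su); rewrite {2}/s !lt_min => /and3P[su1 sur sur2].
  split; first exact/ball0E.
  have b0 : ball (0 : 'rV[R]_p) 1 0 by apply/ball0E; rewrite normr0.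
  have bs : ball (0 : 'rV[R]_p) 1 (s *: u) by apply/ball0E.
  rewrite -ball_normE /= -F0 (le_lt_trans (HLF _ _ b0 bs))// sub0r normrN.
  apply: (@le_lt_trans _ _ ((LF + 1) * `|s *: u|)); first by rewrite ler_wpM2r// lerDl.
  by rewrite mulrC -ltr_pdivlMr// ltr_wpDl.
(* Both sides lie in the ball of radius r and have the same image under f, which expands distances
   up to a factor 2. *)
have PsiF (u : 'rV[R]_p) : eball u -> Psi0 (F (s *: u) *m A) = s *: u.
  move=> /s_small[ru yu]; have [rP fP] := fPsi _ (A_r2 _ yu).
  apply/eqP; rewrite -subr_eq0 -normr_le0 (le_trans (fexp _ _ rP ru))//.
  by rewrite fP subrr normr0 mulr0.
pose Phi u := F (u *m s%:M); pose Psi z := s^-1 *: Psi0 (z *m A).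
have PhiE u : Phi u = F (s *: u) by rewrite /Phi mul_mx_scalar.
have HMs : Cg al k.+1 (fun u : 'rV[R]_p => u *m s%:M).
  by apply: (@Cg_linear _ _ al01 _ _ _ _ s%:M 0) => z; rewrite addr0.
exists Phi, Psi, r2; split.
- split=> [|j]; first exact: (Cg_comp al01 (ltn0Sn k) HMs HF).
  have -> : (fun z => Psi z ord0 j) =
      (fun z => s^-1 * ((fun x => Psi0 x ord0 j) \o (fun z : 'rV[R]_d => z *m A)) z).
    by apply/funext => z; rewrite /Psi mxE.
  have oB : open (ball y r2) by exact: ball_open.
  have cB : segment_closed (ball y r2) by exact: segment_closed_ball.
  apply: (CkZ al01 oB cB).
  apply: (Ck_comp al01 oB cB (W := ball (f 0) rho)) => //.
    by exists L => // a c /sub_r2 ? /sub_r2 ?; exact: HL.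
  by move=> i; apply: (Ck_sub sub_r2); exact: HMA.
- move=> u u1; rewrite PhiE; split; first by have [] := s_small _ u1.
  by rewrite /Psi PsiF// scalerA mulVf ?scale1r// gt_eqF.
- by rewrite PhiE scaler0.
- by move=> u; rewrite PhiE; have [h Dh ->] := FD (s *: u); exists h.
move=> u u1; have [ru _] := s_small _ u1; have [h Dh Eh] := FD (s *: u).
have dPhi w : 'd Phi u w = 'd F (s *: u) (s *: w).
  have [ds Es] := diff_mulmx s%:M u w.
  have E := diff_comp_at w ds (dF (u *m s%:M)); rewrite Es in E.
  by rewrite !mul_mx_scalar in E.
rewrite PhiE Eh; apply: (PD_range al01 HD Dh bE bdim).
- exact: linearP.
(* Injectivity comes from df = dF followed by [A]: what df separates, dF separates. *)
- move=> w w' Eww; have E := etrans (esym (dPhi w)) (etrans Eww (dPhi w')).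
  have E' := congr1 (fun x => x *m A) E.
  have E2 := etrans (dfE _ _) (etrans E' (esym (dfE _ _))).
  have /(congr1 (fun x => s^-1 *: x)) := finj _ ru _ _ E2.
  by rewrite !scalerA mulVf ?gt_eqF// !scale1r.
- move=> t; rewrite -Eh.
  exact: (eq_ind_r (PD D (F (s *: u))) (FP _ _) (dPhi t)).
Qed.

End chart.

(** * A lattice atlas *)

Section cutoff.
Context {R : realType} (al : R).
Hypothesis al01 : 0 < al <= 1.

Lemma diff_norm_mul (t : R) : differentiable (fun t : R => `|t| * t) t /\
  forall w : R, 'd (fun t : R => `|t| * t) t w = 2 * `|t| * w.
Proof.
apply: (@diff_of_estimate _ _ _ (fun t : R => `|t| * t) t (fun w : R => 2 * `|t| * w) (2 * `|t|)).
- by move=> a u v; rewrite mulrDr [a *: u]mulrC mulrA mulrC.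
- by move=> h; rewrite !normrM normr_id ger0_norm.
move=> e e0; exists (e / 2); first by rewrite divr_gt0.
move=> h he; apply: (@le_trans _ _ (2 * `|h| * `|h|)); last by rewrite ler_wpM2r//; lra.
rewrite -[2 * `|h| * `|h|]mulrA -expr2 real_normK ?num_real// ler_norml.
have [t0|t0] := leP 0 t; have [th|th] := leP 0 (t + h).
- by rewrite !ger0_norm//; apply/andP; split; nra.
- by rewrite (ger0_norm t0) ltr0_norm//; apply/andP; split; nra.
- by rewrite (ltr0_norm t0) ger0_norm//; apply/andP; split; nra.
- by rewrite !ltr0_norm//; apply/andP; split; nra.
Qed.

Lemma derive_norm_exp (V : normedModType R) (f : V -> R) (x v : V) m : differentiable f x ->
  differentiable (fun x => `|f x| * f x ^+ m.+1) x /\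
  'D_v (fun x => `|f x| * f x ^+ m.+1) x = m.+2%:R * (`|f x| * f x ^+ m * 'D_v f x).
Proof.
move=> df; elim: m => [|m [IH1 IH2]].
  have [dh hE] := diff_norm_mul (f x).
  have dP : differentiable ((fun t : R => `|t| * t) \o f) x := differentiable_comp df dh.
  have E : (fun x => `|f x| * f x ^+ 1) = (fun t : R => `|t| * t) \o f.
    by apply/funext => y /=; rewrite expr1.
  rewrite E; split=> //; apply: (etrans (deriveE _ dP)).
  apply: (etrans (diff_comp_at v df dh)); apply: (etrans (hE _)).
  by rewrite (deriveE _ df) expr0 mulr1 mulrA.
have E : (fun x => `|f x| * f x ^+ m.+2) = (fun x => `|f x| * f x ^+ m.+1) * f.
  by apply/funext => y; rewrite [RHS]/(_ * _) [in LHS]exprSr mulrA.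
rewrite E; split; first exact: differentiableM.
rewrite deriveM; [|exact: diff_derivable|exact: diff_derivable].
rewrite IH2 /GRing.scale /= !exprS -[m.+3%:R]natr1; ring.
Qed.

(** Differentiating |f| f^(k+1) gives (k + 2) |f| f^k times the derivative of f: exponent and order
    drop together, down to |f|, which is as Hoelder as f. *)
Lemma Ck_norm_exp n (U : set 'rV[R]_n) k (f : 'rV[R]_n -> R) : open U -> segment_closed U ->
  Ck al U k f -> Ck al U k (fun x => `|f x| * f x ^+ k).
Proof.
move=> oU cU; elim: k => [|k IH] Hf.
  have [C C0 [H1 H2]] := Hf; exists C => //; split=> [a Ua|a b Ua Ub].
    by rewrite mulr1 normr_id H1.
  by rewrite !mulr1 (le_trans (ler_dist_dist _ _))// H2.
have [[C C0 H1] H2 H3] := Hf; split.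
- exists (C * C ^+ k.+1) => [|a Ua]; first by rewrite mulr_ge0// exprn_ge0.
  rewrite normrM normr_id normrX ler_pM//; first exact: H1.
  by rewrite lerXn2r// ?nnegrE// H1.
- by move=> x Ux; have [] := derive_norm_exp 0 k (H2 x Ux).
move=> v; have IHf := IH (CkS al01 cU Hf).
apply: (Ck_eq oU _ (CkZ al01 oU cU k.+2%:R (CkM al01 oU cU IHf (H3 v)))) => x Ux.
by have [_ ->] := derive_norm_exp v k (H2 x Ux).
Qed.

(** Twice the positive part of t raised to the power k + 1, written without case distinction. For
    finite regularity this one-sided power takes the role of exp(-1/t). *)
Definition ramp k (t : R) : R := t ^+ k.+1 + `|t| * t ^+ k.

Lemma ramp_ge0E k t : 0 <= t -> ramp k t = 2 * t ^+ k.+1.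
Proof. by move=> t0; rewrite /ramp ger0_norm// -exprS; ring. Qed.

Lemma ramp_le0 k t : t <= 0 -> ramp k t = 0.
Proof. by move=> t0; rewrite /ramp ler0_norm// mulNr -exprS subrr. Qed.

Lemma ramp_ge0 k t : 0 <= ramp k t.
Proof.
have [t0|/ltW t0] := leP 0 t; last by rewrite ramp_le0.
by rewrite ramp_ge0E// mulr_ge0// exprn_ge0.
Qed.

Lemma ramp_ge1 k t : 1 <= t -> 1 <= ramp k t.
Proof.
move=> t1; rewrite ramp_ge0E ?(le_trans ler01)//.
have := exprn_ege1 k.+1 t1; lra.
Qed.

Definition bump k (t : R) : R :=
  ramp k (4 - t ^+ 2) / (ramp k (4 - t ^+ 2) + ramp k (t ^+ 2 - 1)).

(** One of the arguments 4 - t^2 and t^2 - 1 is always at least 1; the threshold is t^2 = 3. This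
    bound makes the quotient [bump] as regular as the ramps. *)
Lemma bump_denom k t : 1 <= ramp k (4 - t ^+ 2) + ramp k (t ^+ 2 - 1).
Proof.
have [t1|/ltW t1] := leP (t ^+ 2) 3.
  by rewrite (le_trans (ramp_ge1 k (t := 4 - t ^+ 2) _))// ?lerDl ?ramp_ge0//; lra.
by rewrite (le_trans (ramp_ge1 k (t := t ^+ 2 - 1) _))// ?lerDr ?ramp_ge0//; lra.
Qed.

Lemma bump1 k t : `|t| <= 1 -> bump k t = 1.
Proof.
move=> t1; have t2 : t ^+ 2 <= 1 by rewrite -real_normK ?num_real// exprn_ile1.
have := bump_denom k t; rewrite /bump (@ramp_le0 k (t ^+ 2 - 1)) ?subr_le0// addr0 => H.
by rewrite divff// gt_eqF// (lt_le_trans ltr01).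
Qed.

Lemma bump0 k t : 2 <= `|t| -> bump k t = 0.
Proof.
move=> t1; rewrite /bump ramp_le0 ?mul0r//.
rewrite subr_le0 -real_normK ?num_real//; have := normr_ge0 t; nra.
Qed.

(** A product over coordinates, adapted to the maximum norm: the identity where |x| <= 1, zero where
    |x| > 2. *)
Definition cutoff k n (x : 'rV[R]_n) : 'rV[R]_n := (\prod_j bump k (x ord0 j)) *: x.

Lemma cutoff_id k n (x : 'rV[R]_n) : `|x| <= 1 -> cutoff k x = x.
Proof.
move=> x1; rewrite /cutoff big1 ?scale1r// => j _; apply: bump1.
exact: le_trans (mx_norm_coord _ _ _) x1.
Qed.

Lemma cutoff0 k n (x : 'rV[R]_n) : 2 < `|x| -> cutoff k x = 0.
Proof.
move=> x2; have [j xj] : exists j, 2 <= `|x ord0 j|.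
  apply: contrapT => H; suff : `|x| <= 2 by rewrite leNgt x2.
  apply: rV_norm_le => // i; rewrite leNgt; apply/negP => xi.
  by apply: H; exists i; exact: ltW.
by rewrite /cutoff (bigD1 j)//= bump0// mul0r scale0r.
Qed.

Lemma Cg_cutoff k n : Cg al k (@cutoff k n).
Proof.
move=> r j.
have or : open (ball (0 : 'rV[R]_n) r) by exact: ball_open.
have cr : segment_closed (ball (0 : 'rV[R]_n) r) by exact: segment_closed_ball.
have Hc i : Ck al (ball 0 r) k (fun x : 'rV[R]_n => x ord0 i).
  by apply: (Ck_coord al01) => //; exact: ball_bounded.
have Hr (f : 'rV[R]_n -> R) : Ck al (ball 0 r) k f -> Ck al (ball 0 r) k (fun x => ramp k (f x)).
  move=> Hf; apply: (CkD or); first exact: (Ck_exp al01).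
  exact: Ck_norm_exp.
have H1 i : Ck al (ball 0 r) k (fun x : 'rV[R]_n => 4 - x ord0 i ^+ 2).
  apply: (CkD or (Ck_cst al _ _ 4)).
  have := CkZ al01 or cr (-1) (Ck_exp al01 or cr 2 (Hc i)).
  by congr (Ck _ _ _ _); apply/funext => x; rewrite mulN1r.
have H2 i : Ck al (ball 0 r) k (fun x : 'rV[R]_n => x ord0 i ^+ 2 - 1).
  exact: (CkD or (Ck_exp al01 or cr 2 (Hc i)) (Ck_cst al _ _ (-1))).
have -> : (fun x : 'rV[R]_n => cutoff k x ord0 j) =
    (fun x => (\prod_i bump k (x ord0 i)) * x ord0 j).
  by apply/funext => x; rewrite /cutoff mxE.
apply: (CkM al01 or cr) => //; apply: (Ck_prod al01 or cr) => i _.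
apply: (CkM al01 or cr); first exact: Hr.
apply: (@Ck_inv _ _ al01 _ _ or cr _ _ 1) => //.
  by move=> x _; rewrite (le_trans (bump_denom k (x ord0 i)))// ler_norm.
by apply: (CkD or); exact: Hr.
Qed.

End cutoff.

(** * The atlas of unit balls centred at lattice points *)

Section lattice_atlas.
Context {R : realType} (ga : R) (k p : nat) (T : topologicalType) (M : set T).
Context (H : 'rV[R]_p -> T) (G : T -> 'rV[R]_p).
Hypotheses (k0 : (0 < k)%N) (kg : k%:R < ga <= k%:R + 1) (hT : hausdorff_space T).
Hypothesis cH : continuous H.
Hypothesis HM : forall u, M (H u) /\ G (H u) = u.
Hypothesis GM : forall x, M x -> H (G x) = x.
Hypothesis cG : forall x, M x -> {for x, continuous G}.

(** Rounding each coordinate down costs at most p times the step in Euclidean norm, which is below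
    1/4. The balls of radius 1/2 about lattice points thus cover, including for p = 0. *)
Definition lattice_step : R := (4 * (p%:R + 1))^-1.

Definition lattice_point (c : 'rV[int]_p) : 'rV[R]_p :=
  \row_j (lattice_step * (c ord0 j)%:~R).

Definition lattice_dom (c : 'rV[int]_p) : set T :=
  [set x | M x /\ eball (G x - lattice_point c)].

Definition lattice_chart (c : 'rV[int]_p) (x : T) : 'rV[R]_p :=
  cutoff k (G x - lattice_point c).

Let al01 : 0 < ga - k%:R <= 1.
Proof. by have /andP[g1 g2] := kg; rewrite subr_gt0 g1 lerBlDl. Qed.

Lemma lattice_step_gt0 : 0 < lattice_step.
Proof. by rewrite invr_gt0 mulr_gt0// ltr_wpDl. Qed.

(** The closure is taken in T and could leave M. It does not, because the image of K is compact,
    hence closed in the Hausdorff space T, and is contained in M. *)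
Lemma compact_closure_image (K : set 'rV[R]_p) (S : set T) : compact K ->
  S `<=` H @` K -> compact (M `&` closure S).
Proof.
move=> cK SK.
have cHK : compact (H @` K).
  by apply: continuous_compact => //; exact: continuous_subspaceT.
have clHK : closed (H @` K) by exact: compact_closed.
have clS : closure S `<=` H @` K.
  by move=> x /(closureS SK); rewrite -(closure_id _).1.
have -> : M `&` closure S = closure S.
  by apply/setIidr => x /clS[u _ <-]; have [] := HM u.
exact: (subclosed_compact (@closed_closure _ S) cHK).
Qed.

Lemma shift_continuous (c : 'rV[R]_p) : continuous (fun u : 'rV[R]_p => u + c).
Proof.
move=> u; apply: continuous_of_dist => e e0; exists e => // v.
by rewrite opprD addrACA subrr addr0 => /ltW.
Qed.

Lemma compact_cube (c : 'rV[R]_p) (r : R) : compact [set u : 'rV[R]_p | `|u - c| <= r].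
Proof.
apply: bounded_closed_compact.
  exists (`|c| + r); split; first exact: num_real.
  move=> N rN u /= ur; have := ler_normD (u - c) c; rewrite subrK; lra.
rewrite (_ : [set _ | _] = (fun u : 'rV[R]_p => `|u - c|) @^-1` [set x | x <= r])//.
apply: closed_comp; last exact: closed_le.
move=> u _; apply: (@continuous_comp _ _ _ (fun u : 'rV[R]_p => u - c) (@Num.norm _ _)).
  exact: shift_continuous.
exact: norm_continuous.
Qed.

Lemma lattice_chartE c x : lattice_dom c x -> lattice_chart c x = G x - lattice_point c.
Proof.
move=> [_ xc]; apply: cutoff_id; apply: (le_trans (norm_le_enorm _)); exact: ltW.
Qed.

Lemma lattice_near (u : 'rV[R]_p) : exists c, enorm (u - lattice_point c) < 1 - 2^-1.
Proof.
have e0 := lattice_step_gt0.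
exists (\row_j Num.floor (u ord0 j / lattice_step)).
apply: (le_lt_trans (enorm_le_norm _)).
apply: (@le_lt_trans _ _ (p%:R * lattice_step)).
  rewrite ler_wpM2l//; apply: rV_norm_le => [|j]; first exact: ltW.
  rewrite !mxE; have /andP[f1 f2] := floor_itv (u ord0 j / lattice_step).
  set m := Num.floor _ in f1 f2 *.
  have uE : u ord0 j = lattice_step * (u ord0 j / lattice_step).
    by rewrite mulrCA divff ?gt_eqF// mulr1.
  rewrite {1}uE -mulrBr normrM (gtr0_norm e0) ler_piMr ?(ltW e0)//.
  by rewrite ger0_norm ?subr_ge0// lerBlDl ltW// -intrD1.
have p0 : 0 <= p%:R :> R by [].
rewrite /lattice_step ltr_pdivrMr ?mulr_gt0 ?ltr_wpDl//.
lra.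
Qed.

Lemma finite_int_box (N : nat) : finite_set [set c : 'rV[int]_p | forall j, (`|c ord0 j| <= N)%N].
Proof.
pose f (g : {ffun 'I_p -> 'I_(N + N).+1}) : 'rV[int]_p := \row_j ((g j)%:Z - N%:Z).
apply: (@sub_finite_set _ _ (f @` setT)); last by apply: finite_image; exact: finite_finset.
move=> c /= cN; exists [ffun j => inord (absz (c ord0 j + N%:Z))] => //.
apply/rowP => j; rewrite !mxE ffunE inordK.
  by have := cN j; rewrite [ord0]ord1; lia.
by have := cN j; lia.
Qed.

Lemma lattice_locally_finite (a : 'rV[R]_p) :
  finite_set [set c | `|a - lattice_point c| < 2].
Proof.
have e0 := lattice_step_gt0.
pose N := Num.bound ((`|a| + 2) / lattice_step).
apply: (@sub_finite_set _ _ _ _ (finite_int_box N)) => c /= ac j.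
have cj : `|(c ord0 j)%:~R : R| <= (`|a| + 2) / lattice_step.
  rewrite ler_pdivlMr// mulrC -(gtr0_norm e0) -normrM.
  have := mx_norm_coord (lattice_point c) ord0 j; rewrite mxE => /le_trans; apply.
  have := ler_normB a (a - lattice_point c); rewrite opprB addrCA subrr addr0 => /le_trans.
  by apply; rewrite lerD2l ltW.
have NP : (`|a| + 2) / lattice_step < N%:R.
  by apply: archi_boundP; rewrite divr_ge0// ?addr_ge0// ltW.
have := le_lt_trans cj NP.
rewrite -intr_norm -[N%:R]/(N%:Z%:~R) ltr_int; lia.
Qed.

(** For |a| <= 4 the translated unit ball lies in the ball of radius 5, where one constant serves.
    For |a| > 4 it lies outside the ball of radius 3, where the cutoff vanishes. *)
Lemma cutoff_lip_bound : exists L : R, forall a, lip_bound ga (@eball R p)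
  (fun u => cutoff k (u + a)) L.
Proof.
have ob : open (ball (0 : 'rV[R]_p) 5) by exact: ball_open.
have cb : segment_closed (ball (0 : 'rV[R]_p) 5) by exact: segment_closed_ball.
have [L1 L10 H1] := Ck_lip_bound kg ob cb (fun j => @Cg_cutoff R _ al01 k p 5 j).
have [j|L2 L20 H2] := @Ck_lip_bound R ga k p p _ (cst 0) kg ob cb.
  have := Ck_cst (ga - k%:R) k (ball (0 : 'rV[R]_p) 5) 0; congr (Ck _ _ _ _).
  by apply/funext => x; rewrite mxE.
have u1 u : @eball R p u -> `|u| < 1.
  by rewrite /eball /=; exact: le_lt_trans (norm_le_enorm u).
exists (L1 + L2) => a; have [a4|a4] := leP `|a| 4.
  apply: (@lip_bound_le _ _ _ _ _ _ L1); first by rewrite lerDl.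
  apply: (lip_bound_shift _ H1) => u /u1 uu; apply/ball0E.
  have := ler_normD u a; lra.
apply: (@lip_bound_le _ _ _ _ _ _ L2); first by rewrite lerDr.
apply: (@lip_bound_eq _ _ _ _ _ (cst 0)).
  move=> u /u1 uu; rewrite cutoff0//.
  have := ler_normB (u + a) u; rewrite addrAC subrr add0r; lra.
by apply: (lip_bound_sub _ H2) => u /u1 uu; apply/ball0E; lra.
Qed.

(** The change from chart i to chart j is the cutoff composed with the translation by the difference
    of the two lattice points, so a single constant bounds all of them. *)
Theorem lattice_manifold : lip_manifold ga M lattice_dom lattice_chart.
Proof.
exists (fun c u => H (u + lattice_point c)); split; first exact: countableP.
have domP c x : lattice_dom c x -> exists2 u, `|u - lattice_point c| <= 1 & x = H u.
  move=> [Mx xc]; exists (G x); last by rewrite GM.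
  by apply: (le_trans (norm_le_enorm _)); exact: ltW.
have psiP c u : @eball R p u -> lattice_dom c (H (u + lattice_point c)) /\
    lattice_chart c (H (u + lattice_point c)) = u.
  move=> u1; have [Mu Gu] := HM (u + lattice_point c).
  have D : lattice_dom c (H (u + lattice_point c)) by split => //; rewrite Gu addrK.
  by split=> //; rewrite lattice_chartE// Gu addrK.
have cGs c x : M x -> {for x, continuous (fun x => G x - lattice_point c)}.
  move=> Mx; apply: (@continuous_comp _ _ _ G (fun u => u - lattice_point c)); first exact: cG.
  exact: shift_continuous.
(* G is continuous at the points of M only, so its preimages need not be open in T; their interiors
   have the same trace on M. *)
have preim (A : set 'rV[R]_p) : open A -> exists2 O, open O &
    forall x, M x -> O x <-> A (G x).
  move=> oA; exists (interior (G @^-1` A)); first exact: open_interior.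
  move=> x Mx; split; first by move=> /interior_subset.
  by move=> AGx; apply: (cG Mx); exact: open_nbhs_nbhs.
split.
  move=> c; split; first by move=> x [].
  have oA : open [set u | @eball R p (u - lattice_point c)].
    apply: (@open_comp _ _ (fun u : 'rV[R]_p => u - lattice_point c)); last exact: eball_open.
    by move=> u _; exact: shift_continuous.
  have [W oW HW] := preim _ oA; exists W; split=> //.
  apply/seteqP; split=> x; first by move=> [Mx xc]; split=> //; apply/HW.
  by move=> [Wx Mx]; split=> //; apply/HW.
split.
  move=> c; apply: (@compact_closure_image [set u | `|u - lattice_point c| <= 2]).
    exact: compact_cube.
  move=> x [Mx xc]; exists (G x); last exact: GM.
  rewrite /= leNgt; apply/negP => x2; move: xc; rewrite /lattice_chart cutoff0 ?eqxx//.
split.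
  move=> c; split.
    apply: continuous_in_subspaceT => x; rewrite inE => -[Mx _].
    apply: (@continuous_comp _ _ _ (fun x => G x - lattice_point c) (@cutoff R k p)).
      exact: cGs.
    apply: differentiable_continuous.
    have HC := @Cg_cutoff R _ al01 k p.
    exact: (@Cg_differentiable _ _ al01 k p p (@cutoff R k p) (G x - lattice_point c) k0 HC).
  split.
    apply: continuous_subspaceT => u.
    apply: (@continuous_comp _ _ _ (fun u : 'rV[R]_p => u + lattice_point c) H); last exact: cH.
    exact: shift_continuous.
  split; last exact: psiP.
  move=> x xc; rewrite lattice_chartE//; have [Mx x1] := xc.
  by split=> //; rewrite subrK GM.
split.
  move=> c; apply: (@compact_closure_image [set u | `|u - lattice_point c| <= 1]).
    exact: compact_cube.
  by move=> x /domP[u u1 ->]; exists u.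
split.
  move=> x Mx; have [W oW HW] := preim _ (@ball_open _ _ (G x) 1).
  exists W; split=> //; split; first by apply/HW => //; exact: ballxx.
  apply: (sub_finite_set _ (lattice_locally_finite (G x))) => c [z [Wz [Mz zc]]] /=.
  have := (HW z Mz).1 Wz; rewrite -ball_normE /= => xz.
  have zc' := le_lt_trans (norm_le_enorm _) zc.
  have := ler_normD (G x - G z) (G z - lattice_point c); rewrite subrKA; lra.
split.
  exists 2^-1; split; first by lra.
  move=> x Mx; have [c xc] := lattice_near (G x); exists c.
  have D : lattice_dom c x by split=> //; rewrite /eball /=; lra.
  by rewrite lattice_chartE.
have [L HL] := cutoff_lip_bound; exists L => i j.
apply: (lip_bound_eq _ (HL (lattice_point i - lattice_point j))) => u _ /=.
by rewrite /lattice_chart; have [_ ->] := HM (u + lattice_point i); rewrite addrA.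
Qed.

End lattice_atlas.

(** * The radial homeomorphism between the open unit ball and the space *)

Section radial.
Context {R : realType} (p : nat).

Definition ball_to_space (x : 'rV[R]_p) : 'rV[R]_p := (1 - enorm x)^-1 *: x.
Definition space_to_ball (u : 'rV[R]_p) : 'rV[R]_p := (1 + enorm u)^-1 *: u.

Lemma enorm_space_to_ball u : enorm (space_to_ball u) = enorm u / (1 + enorm u).
Proof. by rewrite enormZ ger0_norm ?invr_ge0 ?addr_ge0 ?enorm_ge0// mulrC. Qed.

Lemma space_to_ballP u : eball (space_to_ball u) /\ ball_to_space (space_to_ball u) = u.
Proof.
have u0 := enorm_ge0 u; have u1 : 0 < 1 + enorm u by rewrite ltr_wpDr.
split; first by rewrite /eball /= enorm_space_to_ball ltr_pdivrMr// mul1r ltrDr.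
rewrite /ball_to_space enorm_space_to_ball scalerA -[RHS]scale1r; congr (_ *: _).
by field; rewrite gt_eqF//= addrK oner_eq0.
Qed.

Lemma ball_to_spaceK x : eball x -> space_to_ball (ball_to_space x) = x.
Proof.
rewrite /eball /= => x1; have x0 := enorm_ge0 x; have d0 : 0 < 1 - enorm x by rewrite subr_gt0.
rewrite /space_to_ball enormZ ger0_norm ?invr_ge0 ?ltW// scalerA -[RHS]scale1r.
by congr (_ *: _); field; rewrite gt_eqF//= subrK oner_eq0.
Qed.

Lemma continuous_inv_scale (f : 'rV[R]_p -> R) (x : 'rV[R]_p) : f x != 0 ->
  {for x, continuous f} -> {for x, continuous (fun x => (f x)^-1 *: x)}.
Proof.
move=> fx cf; apply: (@cvgZ _ _ _ (nbhs x) _ (fun x => (f x)^-1) id); last exact: cvg_id.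
exact: (@cvgV _ _ (nbhs x) _ f).
Qed.

Lemma ball_to_space_continuous x : eball x -> {for x, continuous ball_to_space}.
Proof.
rewrite /eball /= => x1; apply: continuous_inv_scale; first by rewrite gt_eqF// subr_gt0.
apply: (@continuousB R R 'rV[R]_p (cst 1) (@enorm R p)); first exact: cst_continuous.
exact: enorm_continuous.
Qed.

Lemma space_to_ball_continuous : continuous space_to_ball.
Proof.
move=> x; apply: continuous_inv_scale; first by rewrite gt_eqF// ltr_wpDr// enorm_ge0.
apply: (@continuousD R R 'rV[R]_p (cst 1) (@enorm R p)); first exact: cst_continuous.
exact: enorm_continuous.
Qed.

End radial.

(** The required integer is the ceiling of gamma minus 1, also when gamma is an integer, in which
    case al = 1. It is at least 1 and is written as a successor, whence the 2. *)
Lemma nat_gap_exists (R : realType) (ga : R) : 1 < ga ->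
  exists k, k.+1%:R < ga <= k.+1%:R + 1.
Proof.
move=> ga1; have /andP[c1 c2] := ceil_itv ga.
have c3 : (1 < Num.ceil ga)%R by rewrite -(@ltr_int R) (lt_le_trans ga1).
exists (absz (Num.ceil ga - 2)).
have -> : (absz (Num.ceil ga - 2)).+1%:R = (Num.ceil ga - 1)%:~R :> R.
  by rewrite -[LHS]/((Posz _)%:~R); congr (_%:~R); lia.
by rewrite c1 intrD subrK.
Qed.

Theorem mainTheorem2 (R : realType) (d : nat) (γ : R)
    (D : set ('rV[R]_d -> 'rV[R]_d)) (y : 'rV[R]_d) (p : nat) :
  (0 < d)%N -> 1 < γ ->
  (forall g, D g -> lipg γ setT g) ->
  vdim (PD D y) p ->
  exists (V : set 'rV[R]_d) (Ψ : 'rV[R]_d -> 'rV[R]_p) (Φ : 'rV[R]_p -> 'rV[R]_d),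
    [/\ V y, V `<=` Dorbit D y, lip_diffeo γ V (@eball R p) Ψ Φ, Ψ y = 0 &
      (exists (I : Type) (U : I -> set 'rV[R]_p) (φ : I -> 'rV[R]_p -> 'rV[R]_p),
          lip_manifold γ (@eball R p) U φ /\
          lip_manifold γ V (fun i => Φ @` U i) (fun i => φ i \o Ψ)) /\
      (forall z, V z -> range ('d Φ (Ψ z)) = PD D z)].

Proof.
move=> _ ga1 HD0 vP.
have [k kg] := nat_gap_exists ga1.
have al01 : 0 < γ - k.+1%:R <= 1.
  by have /andP[g1 g2] := kg; rewrite subr_gt0 g1 lerBlDl.
have HD g : D g -> [/\ Cg (γ - k.+1%:R) k.+1 g, lip_on setT g &
    exists2 C : R, 0 <= C & forall x, `|g x| <= C].
  move=> Dg; have [lg bg] := lipg_setT_lip (ltn0Sn k) kg (HD0 g Dg).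
  split=> // r j; exact: (lipg_setT kg (HD0 g Dg) j (ball 0 r)).
have [Phi [Psi [rho [[CPhi CPsi] PhiP Phi0 PhiO dPhi]]]] := orbit_chart al01 HD vP.
have eb0 : eball (0 : 'rV[R]_p) by rewrite /eball /= enorm0.
pose V := Phi @` @eball R p.
have VP x : V x -> [/\ eball (Psi x), Phi (Psi x) = x & ball y rho x].
  by move=> [u u1 <-]; have [bu ->] := PhiP u u1.
have cPhi : continuous Phi.
  by move=> u; apply: differentiable_continuous; exact: (Cg_differentiable al01 u (ltn0Sn k) CPhi).
have cPsi x : V x -> {for x, continuous Psi}.
  move=> /VP[_ _ bx]; apply: differentiable_continuous; apply: differentiable_rV => j.
  by have [_ + _] := CPsi j; exact.
exists V, Psi, Phi; split.
- by exists 0.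
- by move=> x [u _ <-]; exact: PhiO.
- split; first by move=> x /VP[].
  split; first by move=> u u1; have [_ E] := PhiP u u1; split=> //; exists u.
  split.
    (* V is neither open nor convex in general: the estimate is made on the ball about y and
       restricted. *)
    have [L _ HL] := Ck_lip_bound kg (@ball_open _ _ y rho) (@segment_closed_ball _ _ y rho) CPsi.
    by exists L; apply: (lip_bound_sub _ HL) => x /VP[].
  have [L _ HL] := Ck_lip_bound kg (@ball_open _ 'rV[R]_p 0 1) (@segment_closed_ball _ _ 0 1)
    (CPhi 1).
  exists L; apply: (lip_bound_sub _ HL) => u u1; apply/ball0E.
  exact: le_lt_trans (norm_le_enorm u) u1.
- by rewrite -Phi0; have [_ ->] := PhiP 0 eb0.
split; last by move=> z /VP[z1 Ez _]; rewrite dPhi// Ez.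
(* Both structures are instances of [lattice_manifold]: for the ball through the radial
   homeomorphism, for V through its composite with [Phi]. *)
exists 'rV[int]_p, (lattice_dom (@eball R p) (@ball_to_space R p)),
  (lattice_chart k.+1 (@ball_to_space R p)); split.
  exact: (lattice_manifold (ltn0Sn k) kg (@norm_hausdorff _ 'rV[R]_p)
    (@space_to_ball_continuous R p) (@space_to_ballP R p) (@ball_to_spaceK R p)
    (@ball_to_space_continuous R p)).
(* Only the domains have to be identified; the transported charts are the lattice charts of V by
   computation. *)
have -> : (fun i => Phi @` lattice_dom (@eball R p) (@ball_to_space R p) i) =
    lattice_dom V (@ball_to_space R p \o Psi).
  apply/funext => c; apply/seteqP; split.
    move=> x [u [u1 uc] <-]; have [_ E] := PhiP u u1.
    by split; [exists u|rewrite /= E].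
  by move=> x [Vx xc]; have [x1 Ex _] := VP x Vx; exists (Psi x).
have cH : continuous (Phi \o @space_to_ball R p).
  move=> u; apply: (@continuous_comp _ _ _ (@space_to_ball R p) Phi); last exact: cPhi.
  exact: space_to_ball_continuous.
have HM u : V ((Phi \o @space_to_ball R p) u) /\
    (@ball_to_space R p \o Psi) ((Phi \o @space_to_ball R p) u) = u.
  have [u1 E] := space_to_ballP u; have [_ E'] := PhiP _ u1.
  by split; [exists (space_to_ball u)|rewrite /= E'].
have GM x : V x -> (Phi \o @space_to_ball R p) ((@ball_to_space R p \o Psi) x) = x.
  by move=> /VP[x1 Ex _] /=; rewrite ball_to_spaceK.
have cG x : V x -> {for x, continuous (@ball_to_space R p \o Psi)}.
  move=> Vx; have [x1 _ _] := VP x Vx.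
  apply: (@continuous_comp _ _ _ Psi (@ball_to_space R p)); first exact: cPsi.
  exact: ball_to_space_continuous.
exact: (lattice_manifold (ltn0Sn k) kg (@norm_hausdorff _ 'rV[R]_d) cH HM GM cG).
Qed.
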